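(* Let $a_1,a_2,\mu_1,\mu_2>0$ and $\beta\in\mathbb{R}$, and let $\mathcal{F}$ be a homotopy stable family of compact subsets of $\mathcal{P}_\beta$, with closed boundary $B\subset\mathcal{P}_\beta$. Let $$c_{\mathcal{F},\beta}:=\inf_{A\in\mathcal{F}}\max_{(u,v)\in A}J_\beta(u,v).$$ Suppose that $B$ is contained in a connected component of $\mathcal{P}_\beta$, and that $$\max\{\sup J_\beta(B),0\}<c_{\mathcal{F},\beta}<+\infty .$$ Then there exists a sequence $\{(u_n,v_n)\}$ with the following properties: (i) $(u_n,v_n)\in\mathcal{P}_\beta$ for every $n$; (ii) $J_\beta(u_n,v_n)\to c_{\mathcal{F},\beta}$ as $n\to\infty$; (iii) $\|\nabla(J_\beta|_{\mathcal{S}})(u_n,v_n)\|\to0$ as $n\to\infty$. If moreover there is a minimizing sequence $\{A_n\}\subset\mathcal{F}$ for $c_{\mathcal{F},\beta}$ (i.e. $\max_{A_n}J_\beta\to c_{\mathcal{F},\beta}$) such that $(u,v)\in A_n$ implies $u,v\ge0$ a.e., then the sequence $\{(u_n,v_n)\}$ can be found satisfying the additional condition (iv) $u_n^-,v_n^-\to0$ a.e. in $\mathbb{R}^3$ as $n\to\infty$.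
   Context: $H^1_{\mathrm{rad}}(\mathbb{R}^3)$ is the space of radial functions in $H^1(\mathbb{R}^3)$, $S_a=\{w\in H^1_{\mathrm{rad}}(\mathbb{R}^3):\int_{\mathbb{R}^3}w^2=a^2\}$, $\mathcal{S}=S_{a_1}\times S_{a_2}$, $$J_\beta(u,v)=\frac12\int_{\mathbb{R}^3}(|\nabla u|^2+|\nabla v|^2)-\frac14\int_{\mathbb{R}^3}(\mu_1u^4+2\beta u^2v^2+\mu_2v^4),$$ $$\mathcal{P}_\beta=\Big\{(u,v)\in\mathcal{S}:\int_{\mathbb{R}^3}(|\nabla u|^2+|\nabla v|^2)=\tfrac34\int_{\mathbb{R}^3}(\mu_1u^4+2\beta u^2v^2+\mu_2v^4)\Big\}.$$ $\|\cdot\|$ is the $H^1(\mathbb{R}^3,\mathbb{R}^2)$ norm; $w^-$ denotes the negative part of $w$. All sets carry the $H^1$ topology. Let $B$ be a closed subset of a set $X\subset H^1_{\mathrm{rad}}(\mathbb{R}^3,\mathbb{R}^2)$. A class $\mathcal{F}$ of compact subsets of $X$ is a homotopy stable family with closed boundary $B$ if: (a) every set in $\mathcal{F}$ contains $B$; (b) for any $A\in\mathcal{F}$ and any $\eta\in C([0,1]\times X,X)$ satisfying $\eta(t,x)=x$ for all $(t,x)\in(\{0\}\times X)\cup([0,1]\times B)$, one has $\eta(\{1\}\times A)\in\mathcal{F}$. The case $B=\emptyset$ is admissible, with the convention $\sup(\emptyset)=-\infty$. *)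

(* Defs.v *)
From HB Require Import structures.
From mathcomp Require Import all_boot all_order all_algebra.
From mathcomp Require Import all_classical all_reals all_analysis.
From mathcomp Require Import measurable_realfun ring lra.

Set Implicit Arguments.
Unset Strict Implicit.
Unset Printing Implicit Defensive.

Import Order.TTheory GRing.Theory Num.Theory.
Import numFieldNormedType.Exports.
Local Open Scope classical_set_scope.
Local Open Scope ring_scope.

Section Space.
Context (R : realType).

(* [R] itself also carries a Borel structure with another display; Lebesgue
   measure lives on [measurableTypeR R]. *)
Definition E3 : Type :=
  (measurableTypeR R * measurableTypeR R * measurableTypeR R)%type.

Definition leb3 : {measure set E3 -> \bar R} :=
  (@lebesgue_measure R \x @lebesgue_measure R \x @lebesgue_measure R)%E.

Definition L2 := LfunType leb3 (lee1n 2).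

End Space.

Section WeakDerivatives.
Context {R : realType}.
Implicit Types (u phi : E3 R -> R) (g : 'I_3 -> E3 R -> R).

Definition dir (i : 'I_3) : E3 R :=
  ((i == 0 :> nat)%:R, (i == 1 :> nat)%:R, (i == 2 :> nat)%:R).

Definition euclid (x : E3 R) : R :=
  Num.sqrt (x.1.1 ^+ 2 + x.1.2 ^+ 2 + x.2 ^+ 2).

Definition partial (i : 'I_3) phi : E3 R -> R := fun x => 'D_(dir i) phi x.

Definition smooth phi := forall s : seq 'I_3,
  continuous (foldr partial phi s) /\
  forall i x, derivable (foldr partial phi s) x (dir i).

Definition test_function phi :=
  smooth phi /\ compact (closure [set x | phi x != 0]).

Definition weak_gradient u g := forall i phi, test_function phi ->
  \int[leb3 R]_x (u x * partial i phi x) = - \int[leb3 R]_x (g i x * phi x).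

(* Radiality of an a.e. class: equal a.e. to a function of [|x|]. *)
Definition radial u :=
  exists f : R -> R, {ae leb3 R, forall x, u x = f (euclid x)}.

End WeakDerivatives.

Section TestFunctions.
Context {R : realType}.

Lemma open_measurable3 (U : set (E3 R)) : open U -> measurable U.
Proof.
move=> oU.
pose box (q : rat * rat * rat * nat) : set (E3 R) :=
  ball (ratr q.1.1.1 : R) q.2.+1%:R^-1 `*` ball (ratr q.1.1.2 : R) q.2.+1%:R^-1
   `*` ball (ratr q.1.2 : R) q.2.+1%:R^-1.
have -> : U = \bigcup_q (if `[< box q `<=` U >] then box q else set0).
  apply/seteqP; split => [x Ux|x [q _]]; last by case: ifPn => // /asboolP qU /qU.
  have /nbhs_ballP[e /= e0 xeU] : nbhs x U by exact: open_nbhs_nbhs.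
  have [n ne] : exists n : nat, (n.+1%:R^-1 : R) < e / 2.
    have e20 : 0 < e / 2 by exact: divr_gt0.
    have [n _ /(_ n (leqnn _))] := near_infty_natSinv_lt (PosNum e20).
    by exists n.
  have n0 : 0 < (n.+1%:R^-1 : R) by rewrite invr_gt0.
  set d := n.+1%:R^-1 in ne n0.
  have dens (y : R) : exists q : rat, ball (ratr q : R) d y.
    have [q] : exists q : rat, ratr q \in `](y - d), (y + d)[.
      by apply: rat_in_itvoo; lra.
    rewrite in_itv/= => /andP[h1 h2]; exists q.
    by rewrite /ball/= ltr_norml; apply/andP; split; lra.
  have [q1 hq1] := dens x.1.1; have [q2 hq2] := dens x.1.2.
  have [q3 hq3] := dens x.2.
  exists (q1, q2, q3, n) => //=.
  have qU : box (q1, q2, q3, n) `<=` U.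
    move=> y [[/= h1 h2] h3]; apply: xeU.
    have tri (a b c : R) : ball a d b -> ball a d c -> ball b e c.
      rewrite /ball/= => h h'; have -> : b - c = (a - c) - (a - b) by ring.
      by rewrite (le_lt_trans (ler_normB _ _))//; lra.
    by split; [split|]; [exact: tri hq1 h1|exact: tri hq2 h2|exact: tri hq3 h3].
  by rewrite asboolT.
apply: countable_bigcupT_measurable => // q.
case: ifPn => // _.
by apply: measurableX; [apply: measurableX|]; exact: measurable_ball.
Qed.

Lemma continuous_measurable3 (f : E3 R -> R) :
  continuous f -> measurable_fun setT f.
Proof.
move=> cf; apply: (measurability _ (RGenOpens.measurableE R)) => //.
move=> _ [_ [a [b ->] <-]]; rewrite setTI.
by apply: open_measurable3; apply: open_comp => // x _; exact: cf.
Qed.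

Lemma compact_finite_measure3 (K : set (E3 R)) : compact K ->
  exists B : set (E3 R), [/\ measurable B, K `<=` B & (leb3 R B < +oo)%E].
Proof.
move=> /compact_bounded[M [_ /(_ (M + 1))]]; rewrite ltrDl ltr01 => /(_ isT) KM.
pose I : set (measurableTypeR R) := `[- (M + 1), M + 1]%classic.
have mI : measurable I by exact: measurable_itv.
have mII : measurable (I `*` I) by exact: measurableX.
exists (I `*` I `*` I); split.
- exact: measurableX.
- move=> x /KM/=; rewrite prod_normE/= prod_normE/= !ge_max.
  by move=> /andP[/andP[]]; rewrite /I !ler_norml/= !in_itv/=.
- have Ifin : (lebesgue_measure I < +oo)%E.
    by rewrite /I lebesgue_measure_itv/=; case: ifP => // _; rewrite -EFinB ltry.
  have -> : leb3 R (I `*` I `*` I) =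
      (lebesgue_measure I * lebesgue_measure I * lebesgue_measure I)%E.
    rewrite -product_measure1E//.
    exact: (product_measure1E _ _ mII mI).
  by rewrite !lte_mul_pinfty// ?mule_ge0// ?fin_numM// ?ge0_fin_numE.
Qed.

Lemma compactly_supported_L2 (f : E3 R -> R) (K : set (E3 R)) :
  continuous f -> compact K -> (forall x, ~ K x -> f x = 0) ->
  f \in Lfun (leb3 R) 2%:E.
Proof.
move=> cf cK f0; have [B [mB KB Bfin]] := compact_finite_measure3 cK.
have mf := continuous_measurable3 cf.
have [M fM] : exists M : R, forall x, `|f x| <= M.
  have /compact_bounded[M [_ /(_ (M + 1))]] : compact (f @` K).
    by apply: continuous_compact => //; exact: continuous_subspaceT.
  rewrite ltrDl ltr01 => /(_ isT) fM; exists (Num.max 0 (M + 1)) => x.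
  have [Kx|/f0 ->] := pselect (K x); last by rewrite normr0 le_max lexx.
  by rewrite le_max; apply/orP; right; apply: fM; exists x.
pose h x := `|f x| `^ 2.
have mh : measurable_fun setT h.
  apply: (measurableT_comp (measurable_powR _)) => //.
  exact: measurableT_comp.
have ih : (leb3 R).-integrable setT (EFin \o h).
  have -> : EFin \o h = (EFin \o h) \_ B.
    apply/funext => x; rewrite patchE; case: ifPn => // /negP xB.
    rewrite /= /h f0 ?normr0 ?powR0//.
    by move=> /KB/mem_set.
  apply/(integrable_mkcond _ mB); apply: measurable_bounded_integrable => //.
    exact: measurable_funTS.
  exists (M `^ 2); split; first exact: num_real.
  move=> N MN x _ /=; rewrite ger0_norm ?powR_ge0//; apply: ltW.
  apply: le_lt_trans MN; rewrite /h ge0_ler_powR ?nnegrE//.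
  exact: le_trans (fM x).
rewrite inE; apply/andP; split; rewrite inE//= /finite_norm unlock /Lnorm.
apply: poweR_lty; case/integrableP: ih => _; apply: le_lt_trans.
apply: ge0_le_integral => //=.
- by apply/measurable_EFinP.
- by apply/measurable_EFinP; apply: measurableT_comp.
- by move=> x _; rewrite lee_fin; exact: ler_norm.
Qed.

Lemma test_function_L2 (phi : E3 R -> R) : test_function phi ->
  phi \in Lfun (leb3 R) 2%:E.
Proof.
move=> [/(_ [::])[cphi _] cs]; apply: (compactly_supported_L2 cphi cs) => x.
by apply: contra_notP => /eqP ?; exact: subset_closure.
Qed.

Lemma partial_test_function_L2 (phi : E3 R -> R) i : test_function phi ->
  partial i phi \in Lfun (leb3 R) 2%:E.
Proof.
move=> [/(_ [:: i])[/= cphi _] cs]; apply: (compactly_supported_L2 cphi cs) => x nx.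
have -> : partial i phi x = 'D_(dir i) (cst 0) x; last exact: derive_cst.
apply: near_eq_derive; near=> y; apply/eqP; apply: contrapT => /negP py.
have : (~` closure [set x | phi x != 0]) y.
  near: y; apply: open_nbhs_nbhs; split => //.
  by rewrite openC; exact: closed_closure.
by apply; exact: subset_closure.
Unshelve. all: by end_near. Qed.

End TestFunctions.

Section RadialSobolev.
Context (R : realType).

(* An element of the radial Sobolev space is represented as a function of L^2
   paired with its weak gradient in (L^2)^3, which the function determines up
   to a null set. [H1rad] below is the quotient by a.e. equality. *)
Definition sobolev_radial : {pred (L2 R * {ffun 'I_3 -> L2 R})} :=
  [pred w : L2 R * {ffun 'I_3 -> L2 R} |
   `[< weak_gradient w.1 (fun i => w.2 i) /\ radial w.1 >]].

Lemma Lfun2_val (u : L2 R) : (u : E3 R -> R) \in Lfun (leb3 R) 2%:E.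
Proof. exact: LfunP. Qed.

Lemma L2_mul_integrable (f g : E3 R -> R) :
  f \in Lfun (leb3 R) 2%:E -> g \in Lfun (leb3 R) 2%:E ->
  (leb3 R).-integrable setT (EFin \o (fun x => f x * g x)).
Proof. by move=> f2 g2; apply/Lfun1_integrable; exact: Lfun2_mul_Lfun1. Qed.

Lemma Rint_linear (a : R) (u v h : E3 R -> R) :
  u \in Lfun (leb3 R) 2%:E -> v \in Lfun (leb3 R) 2%:E ->
  h \in Lfun (leb3 R) 2%:E ->
  \int[leb3 R]_x ((a * u x + v x) * h x) =
  a * \int[leb3 R]_x (u x * h x) + \int[leb3 R]_x (v x * h x).
Proof.
move=> u2 v2 h2.
have iu := L2_mul_integrable u2 h2; have iv := L2_mul_integrable v2 h2.
rewrite -RintegralZl// -RintegralD//.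
  by apply: eq_Rintegral => x _; rewrite mulrDl mulrA.
by have := integrableZl measurableT a iu.
Qed.

Lemma sobolev_radial_submod : submod_closed sobolev_radial.
Proof.
split.
  apply/asboolP; split => [i phi _|/=].
    rewrite [LHS](_ : _ = \int[leb3 R]_x 0); last first.
      by apply: eq_Rintegral => x _; rewrite mul0r.
    rewrite (_ : \int[leb3 R]_x (_ * phi x) = \int[leb3 R]_x 0); last first.
      by apply: eq_Rintegral => x _; rewrite ffunE mul0r.
    by rewrite /Rintegral integral0 oppr0.
  by exists (cst 0); apply: aeW.
move=> a w w' /asboolP[wg [f wf]] /asboolP[wg' [f' wf']]; apply/asboolP.
split => [i phi tphi|].
  transitivity (\int[leb3 R]_x ((a * w.1 x + w'.1 x) * partial i phi x)) => //.
  rewrite Rint_linear ?Lfun2_val//; last exact: partial_test_function_L2.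
  rewrite wg// wg'// mulrN -opprD; congr (- _).
  rewrite -Rint_linear ?Lfun2_val//; last exact: test_function_L2.
  by apply: eq_Rintegral => x _; rewrite !ffunE.
exists (fun r => a * f r + f' r).
apply: filterS2 wf wf' => x wx wx'.
by transitivity (a * w.1 x + w'.1 x) => //; rewrite wx wx'.
Qed.

HB.instance Definition _ := GRing.isSubmodClosed.Build R _ sobolev_radial
  sobolev_radial_submod.

Record preH1rad := PreH1rad {
  preH1rad_val :> L2 R * {ffun 'I_3 -> L2 R};
  _ : preH1rad_val \in sobolev_radial }.

HB.instance Definition _ := [isSub for preH1rad_val].
HB.instance Definition _ := [Choice of preH1rad by <:].
HB.instance Definition _ := [SubChoice_isSubLmodule of preH1rad by <:].

Definition pre_dot (w w' : preH1rad) : R :=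
  \int[leb3 R]_x ((val w).1 x * (val w').1 x) +
  \sum_(i < 3) \int[leb3 R]_x ((val w).2 i x * (val w').2 i x).

Lemma pre_dotC w w' : pre_dot w w' = pre_dot w' w.
Proof.
rewrite /pre_dot; congr (_ + _).
  by apply: eq_Rintegral => x _; rewrite mulrC.
by apply: eq_bigr => i _; apply: eq_Rintegral => x _; rewrite mulrC.
Qed.

Lemma pre_dot_linear a w1 w2 w :
  pre_dot (a *: w1 + w2) w = a * pre_dot w1 w + pre_dot w2 w.
Proof.
rewrite /pre_dot mulrDr addrACA; congr (_ + _).
  by rewrite -Rint_linear ?Lfun2_val.
rewrite mulr_sumr -big_split/=; apply: eq_bigr => i _.
rewrite -Rint_linear ?Lfun2_val//.
by apply: eq_Rintegral => x _; rewrite !ffunE.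
Qed.

Lemma pre_dotD w1 w2 w : pre_dot (w1 + w2) w = pre_dot w1 w + pre_dot w2 w.
Proof. by have := pre_dot_linear 1 w1 w2 w; rewrite scale1r mul1r. Qed.

Lemma pre_dot0 w : pre_dot 0 w = 0.
Proof. by apply: (addrI (pre_dot 0 w)); rewrite -pre_dotD !addr0. Qed.

Lemma pre_dotZ a w1 w : pre_dot (a *: w1) w = a * pre_dot w1 w.
Proof. by have := pre_dot_linear a w1 0 w; rewrite addr0 pre_dot0 addr0. Qed.

Lemma pre_dot_ge0 w : 0 <= pre_dot w w.
Proof.
by rewrite addr_ge0 ?sumr_ge0// => *; apply: Rintegral_ge0 => x _; 
  rewrite -expr2 sqr_ge0.
Qed.

Lemma pre_dot_CauchySchwarz w w' :
  pre_dot w w' ^+ 2 <= pre_dot w w * pre_dot w' w'.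
Proof.
set b := pre_dot w w'; set A := pre_dot w w; set C := pre_dot w' w'.
have q a : 0 <= A + 2 * a * b + a ^+ 2 * C.
  have := pre_dot_ge0 (a *: w' + w).
  rewrite pre_dot_linear [pre_dot w' _]pre_dotC [pre_dot w (_ + _)]pre_dotC.
  rewrite !pre_dot_linear -/C -/A [pre_dot w' w]pre_dotC -/b.
  by move=> h; apply: (le_trans h); rewrite le_eqVlt; apply/orP; left; apply/eqP; ring.
have A0 : 0 <= A by exact: pre_dot_ge0.
have [C0|C0] := eqVneq C 0.
  rewrite C0 mulr0; have [->|b0] := eqVneq b 0; first by rewrite expr0n.
  have := q (- (A + 1) / (2 * b)); rewrite C0 mulr0 addr0.
  have -> : 2 * (- (A + 1) / (2 * b)) * b = - (A + 1) by field.
  by lra.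
have Cp : 0 < C by rewrite lt_neqAle eq_sym C0 pre_dot_ge0.
have := q (- b / C).
have -> : A + 2 * (- b / C) * b + (- b / C) ^+ 2 * C = (A * C - b ^+ 2) / C.
  by field.
by rewrite pmulr_lge0 ?invr_gt0// subr_ge0.
Qed.

Definition null_fun : {pred preH1rad} :=
  [pred w : preH1rad | `[< {ae leb3 R, forall x, (val w).1 x = 0} /\
               forall i, {ae leb3 R, forall x, (val w).2 i x = 0} >]].

Lemma null_dot w w' : w \in null_fun -> pre_dot w w' = 0.
Proof.
move=> /asboolP[w0 g0]; rewrite /pre_dot.
have int0 (f g : L2 R) : {ae leb3 R, forall x, f x = 0} ->
    \int[leb3 R]_x (f x * g x) = 0.
  move=> f0; rewrite /Rintegral (_ : integral _ _ _ = 0%E)//.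
  transitivity (integral (leb3 R) setT (cst 0%E)); last exact: integral0.
  apply: ae_eq_integral => //.
    by apply/measurable_EFinP; exact: measurable_funM.
  by apply: filterS f0 => x /= -> _; rewrite mul0r.
rewrite int0// big1 ?addr0// => i _; exact: int0.
Qed.

Lemma dot_null w : pre_dot w w = 0 -> w \in null_fun.
Proof.
have int0 (f : L2 R) : \int[leb3 R]_x (f x * f x) = 0 ->
    {ae leb3 R, forall x, f x = 0}.
  move=> If; have iff := L2_mul_integrable (Lfun2_val f) (Lfun2_val f).
  have : (\int[leb3 R]_x `|(f x * f x)%:E| = 0)%E.
    under eq_integral do rewrite gee0_abs ?lee_fin -?expr2 ?sqr_ge0//.
    rewrite -[LHS]fineK; last exact: integrable_fin_num.
    by congr (_%:E).
  move/ae_eq_integral_abs => /(_ measurableT).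
  have mff : measurable_fun setT (fun x : E3 R => (f x * f x)%:E).
    by case/integrableP: iff.
  move=> /(_ mff); apply: filterS => x /(_ I)[/eqP].
  by rewrite mulf_eq0 orbb => /eqP.
have ge (f : L2 R) : 0 <= \int[leb3 R]_x (f x * f x).
  by apply: Rintegral_ge0 => x _; rewrite -expr2 sqr_ge0.
move=> /eqP; rewrite paddr_eq0 ?sumr_ge0// => /andP[/eqP h1].
rewrite psumr_eq0// => /allP h2; apply/asboolP; split; first exact: int0.
by move=> i; apply: int0; apply/eqP; exact: (implyP (h2 i (mem_index_enum i))).
Qed.

Lemma null_fun_zmod : zmod_closed null_fun.
Proof.
have N0 w : (w \in null_fun) = (pre_dot w w == 0).
  by apply/idP/eqP => [/null_dot ->//|/dot_null].
split=> [|w w' wn w'n]; first by rewrite N0 pre_dot0.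
rewrite N0 pre_dotD -scaleN1r pre_dotZ ![pre_dot _ (w + _)]pre_dotC.
by rewrite pre_dotC null_dot// pre_dotC null_dot// mulr0 addr0.
Qed.

HB.instance Definition _ := GRing.isZmodClosed.Build _ null_fun null_fun_zmod.

Local Open Scope quotient_scope.

Definition H1rad : Type := {ideal_quot null_fun}.

HB.instance Definition _ := GRing.Zmodule.on H1rad.
HB.instance Definition _ := EqQuotient.on H1rad.

Lemma H1radP (w w' : preH1rad) :
  reflect (w = w' %[mod H1rad]) (w - w' \in null_fun).
Proof. by rewrite Quotient.idealrBE; exact: eqP. Qed.

Lemma repr_null w : repr (\pi_H1rad w) - w \in null_fun.
Proof. by apply/H1radP; rewrite reprK. Qed.

Lemma piD w w' : \pi_H1rad (w + w') = \pi_H1rad w + \pi_H1rad w'.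
Proof. by rewrite -[RHS]Quotient.pi_add. Qed.

Definition scale_H1rad (a : R) (x : H1rad) : H1rad := \pi_H1rad (a *: repr x).

Lemma null_funZ a w : w \in null_fun -> a *: w \in null_fun.
Proof. by move=> wn; apply: dot_null; rewrite pre_dotZ null_dot// mulr0. Qed.

Lemma pi_scale a w : \pi_H1rad (a *: w) = scale_H1rad a (\pi_H1rad w).
Proof.
by apply/esym/H1radP; rewrite -scalerBr; exact/null_funZ/repr_null.
Qed.

Lemma scale_H1radA a b x :
  scale_H1rad a (scale_H1rad b x) = scale_H1rad (a * b) x.
Proof. by rewrite -pi_scale scalerA. Qed.

Lemma scale_H1rad1 : left_id 1 scale_H1rad.
Proof. by move=> x; rewrite /scale_H1rad scale1r reprK. Qed.

Lemma scale_H1radDr : right_distributive scale_H1rad +%R.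
Proof.
by move=> a x y; rewrite -[x]reprK -[y]reprK -piD -!pi_scale scalerDr piD.
Qed.

Lemma scale_H1radDl x : {morph scale_H1rad^~ x : a b / a + b}.
Proof. by move=> a b; rewrite /scale_H1rad scalerDl piD. Qed.

HB.instance Definition _ := GRing.Zmodule_isLmodule.Build R H1rad
  scale_H1radA scale_H1rad1 scale_H1radDr scale_H1radDl.

(* A chosen representative of the class, and its weak gradient; only used in
   integrals and in a.e. statements. *)
Definition H1fun (w : H1rad) : E3 R -> R := (val (repr w)).1.
Definition H1grad (w : H1rad) (i : 'I_3) : E3 R -> R := (val (repr w)).2 i.

Definition H1dot (w w' : H1rad) : R :=
  \int[leb3 R]_x (H1fun w x * H1fun w' x) +
  \sum_(i < 3) \int[leb3 R]_x (H1grad w i x * H1grad w' i x).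

Definition H1norm (w : H1rad) : R := Num.sqrt (H1dot w w).

Lemma H1dotE w w' : H1dot (\pi_H1rad w) (\pi_H1rad w') = pre_dot w w'.
Proof.
have -> : H1dot (\pi_H1rad w) (\pi_H1rad w') = pre_dot (repr (\pi_H1rad w)) (repr (\pi_H1rad w')).
  by [].
rewrite -[repr (\pi_H1rad w)](subrK w) pre_dotD null_dot ?repr_null// add0r.
rewrite -[repr (\pi_H1rad w')](subrK w') pre_dotC pre_dotD null_dot ?repr_null//.
by rewrite add0r pre_dotC.
Qed.

Lemma H1norm_triangle x y : H1norm (x + y) <= H1norm x + H1norm y.
Proof.
rewrite -[x]reprK -[y]reprK -piD /H1norm !H1dotE.
set u := repr x; set v := repr y.
rewrite -ler_sqr ?nnegrE ?addr_ge0 ?sqrtr_ge0//.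
rewrite sqrrD !sqr_sqrtr ?pre_dot_ge0// pre_dotD.
rewrite ![pre_dot _ (u + v)]pre_dotC !pre_dotD [pre_dot v u]pre_dotC.
have : pre_dot u v <= Num.sqrt (pre_dot u u) * Num.sqrt (pre_dot v v).
  rewrite -sqrtrM ?pre_dot_ge0// (le_trans (ler_norm _))// -sqrtr_sqr.
  by apply: ler_wsqrtr; exact: pre_dot_CauchySchwarz.
rewrite mulr2n; lra.
Qed.

Lemma H1normZ a x : H1norm (a *: x) = `|a| * H1norm x.
Proof.
have -> : a *: x = \pi_H1rad (a *: repr x) by [].
rewrite -{2}[x]reprK /H1norm !H1dotE pre_dotZ pre_dotC pre_dotZ mulrA -expr2.
by rewrite sqrtrM ?sqr_ge0// sqrtr_sqr.
Qed.

Lemma H1norm0 x : H1norm x = 0 -> x = 0.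
Proof.
rewrite -[x]reprK /H1norm H1dotE => /eqP; rewrite sqrtr_eq0 => x0.
have /dot_null : pre_dot (repr x) (repr x) = 0.
  by apply/eqP; rewrite eq_le x0 pre_dot_ge0.
rewrite -[X in X \in _]subr0 => /H1radP ->.
by apply: (addrI (\pi_H1rad 0)); rewrite -piD !addr0.
Qed.

HB.instance Definition _ := @Lmodule_isNormed.Build R H1rad H1norm
  H1norm_triangle H1normZ H1norm0.

End RadialSobolev.

Section MiniMax.
Context {R : realType} {W : topologicalType}.
Implicit Types (X B A : set W) (F : set (set W)).

Definition closed_in X B := B `<=` X /\ exists2 C, closed C & B = X `&` C.

(* A deformation in C([0,1] x X, X) is given by a function on the ambient space
   of which only the restriction to [0,1] x X matters. *)
Definition homotopy_stable X B F := [/\ closed_in X B,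
  forall A, F A -> compact A /\ A `<=` X,
  forall A, F A -> B `<=` A &
  forall A (eta : R * W -> W), F A ->
    {within `[0, 1]%classic `*` X, continuous eta} ->
    (forall t x, 0 <= t <= 1 -> X x -> X (eta (t, x))) ->
    (forall x, X x -> eta (0, x) = x) ->
    (forall t x, 0 <= t <= 1 -> B x -> eta (t, x) = x) ->
    F (eta @` ([set 1] `*` A))].

(* Extended-real supremum, so that the empty set yields -oo. On a nonempty
   compact set and for a continuous functional it is the maximum. *)
Definition sup_on (J : W -> R) A : \bar R := ereal_sup [set (J w)%:E | w in A].

Definition minimax_level (J : W -> R) F : \bar R :=
  ereal_inf [set sup_on J A | A in F].

End MiniMax.
Arguments homotopy_stable R {W}.

Section Problem.
Context {R : realType}.
Implicit Types (u v : H1rad R) (w h g : H1rad R * H1rad R).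

(* The norm that the library puts on the product [H1rad R * H1rad R] is the
   maximum of the norms of the components: it induces the H^1 topology, but the
   Hilbert norm of H^1(R^3, R^2) is [pair_norm]. *)
Definition pair_dot w h : R := H1dot w.1 h.1 + H1dot w.2 h.2.

Definition pair_norm w : R := Num.sqrt (pair_dot w w).

Definition sphere (a : R) : set (H1rad R) :=
  [set u | \int[leb3 R]_x (H1fun u x ^+ 2) = a ^+ 2].

Definition mass_constraint (a1 a2 : R) : set (H1rad R * H1rad R) :=
  sphere a1 `*` sphere a2.

Definition grad_sq u (x : E3 R) : R := \sum_(i < 3) H1grad u i x ^+ 2.

Definition kinetic w : R :=
  \int[leb3 R]_x (grad_sq w.1 x + grad_sq w.2 x).

Definition quartic (mu1 mu2 beta : R) w : R :=
  \int[leb3 R]_x (mu1 * H1fun w.1 x ^+ 4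
    + 2 * beta * H1fun w.1 x ^+ 2 * H1fun w.2 x ^+ 2
    + mu2 * H1fun w.2 x ^+ 4).

Definition energy (mu1 mu2 beta : R) w : R :=
  1 / 2 * kinetic w - 1 / 4 * quartic mu1 mu2 beta w.

Definition pohozaev (a1 a2 mu1 mu2 beta : R) : set (H1rad R * H1rad R) :=
  [set w | mass_constraint a1 a2 w /\
           kinetic w = 3 / 4 * quartic mu1 mu2 beta w].

Definition tangent w : set (H1rad R * H1rad R) :=
  [set h | \int[leb3 R]_x (H1fun w.1 x * H1fun h.1 x) = 0 /\
           \int[leb3 R]_x (H1fun w.2 x * H1fun h.2 x) = 0].

(* [g] is the gradient at [w] of the restriction of [J] to the product of
   spheres through [w]: the element of the tangent space that represents the
   restriction of the differential of [J] in the H^1 scalar product. *)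
Definition is_constrained_gradient (J : H1rad R * H1rad R -> R) w g :=
  [/\ differentiable J w, tangent w g &
      forall h, tangent w h -> 'd J w h = pair_dot g h].

Definition palais_smale_on_pohozaev (a1 a2 mu1 mu2 beta : R) (c : \bar R)
    (w : nat -> H1rad R * H1rad R) :=
  [/\ forall n, pohozaev a1 a2 mu1 mu2 beta (w n),
      (energy mu1 mu2 beta (w n))%:E @[n --> \oo] --> c &
      exists2 g : nat -> H1rad R * H1rad R,
        forall n, is_constrained_gradient (energy mu1 mu2 beta) (w n) (g n) &
        pair_norm (g n) @[n --> \oo] --> (0 : R)].

Definition ae_ge0 u := {ae leb3 R, forall x, 0 <= H1fun u x}.

Definition neg_part_cvg0 (u : nat -> H1rad R) :=
  {ae leb3 R, forall x, (H1fun (u n))^\- x @[n --> \oo] --> (0 : R)}.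

End Problem.

(* Main.v *)
Require Import Defs.
From HB Require Import structures.
From mathcomp Require Import all_boot all_order all_algebra.
From mathcomp Require Import all_classical all_reals all_analysis.
From mathcomp Require Import measurable_realfun ring lra.

Set Implicit Arguments.
Unset Strict Implicit.
Unset Printing Implicit Defensive.

Import Order.TTheory GRing.Theory Num.Theory.
Import numFieldNormedType.Exports.
Local Open Scope classical_set_scope.
Local Open Scope ring_scope.

(** Let K and Q be the kinetic and the quartic integral, so that J = K/2 - Q/4.
    A pair of given masses with K, Q > 0 is carried onto the Pohozaev set by a
    unique mass-preserving dilation, and its energy there is (8/27) K^3 / Q^2. On
    the set itself Q = 4K/3, J = K/6, and the differential of (8/27) K^3 / Q^2
    is that of J. Hence a step of size s along minus the constrained gradient g,
    followed by normalisation of the masses and by the dilation, lowers J by at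
    least s |g|^2 / 2, with s uniform as long as J stays in a compact interval of
    (0, oo). Switched off at low energies, this step is a deformation of the
    Pohozaev set that fixes B. Applied to a set A of the family whose maximal
    energy is close to the minimax level, it cannot push the maximum below that
    level; so A itself contains a point of energy close to the level at which g
    is small. The Palais-Smale sequence thus lies in the given sets A_n, and (iv)
    is immediate.

    The gradient is a Riesz representative, which needs the completeness of
    radial H^1 and the embedding H^1 -> L^4. The latter is obtained from the weak
    gradient alone, by comparing a function with its averages over small cubes. *)

(** * The space of square integrable functions *)

(** On its dilation orbit, where the energy is [l^2 K / 2 - l^3 Q / 4], a point of the Pohozaev set
    is the maximum, so sliding along the orbit costs nothing to first order. This is why the
    gradient relative to the masses alone controls the descent, and why no manifold structure on the
    Pohozaev set enters. The orbit map is only continuous in H^1: [l |-> u(l x)] is not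
    differentiable for a general [u]. The energy after projection is therefore never differentiated
    through that map; it is read off the closed formula in [K] and [Q], whose variation is estimated
    with explicit constants. A single step of variable length replaces a flow, so that no
    differential equation and no pseudo-gradient is involved: only continuity of the deformation
    remains to be checked. The positive level keeps [K] and [Q] away from 0 near the points that are
    moved; for negative [beta], [Q] may well vanish off the Pohozaev set. An upper bound on the
    energy, the masses being fixed, bounds the H^1 norm. *)

Lemma le_of_eq (disp : Order.disp_t) (T : porderType disp) (x y : T) : x = y -> (x <= y)%O.
Proof. by move=> ->. Qed.

Section SquareIntegrable.
Context d (T : measurableType d) (R : realType) (mu : {measure set T -> \bar R}).
Implicit Types f g h : T -> R.

(** Plain functions instead of elements of [L2]: affine substitutions, products and pointwise limits
    can then be taken without repackaging. *)
Definition sqint f :=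
  measurable_fun setT f /\ mu.-integrable setT (EFin \o (fun x => f x ^+ 2)).

Definition ip f g : R := \int[mu]_x (f x * g x).

Definition nrm f : R := Num.sqrt (ip f f).

Lemma sqintP f : f \in Lfun mu 2%:E <-> sqint f.
Proof.
split=> [f2|[mf intf]].
  split; last exact: Lfun2_integrable_sqr.
  by move: f2; rewrite inE => /andP[+ _]; rewrite inE.
rewrite inE; apply/andP; split; rewrite inE//= /finite_norm unlock /Lnorm.
apply: poweR_lty; case/integrableP: intf => _; apply: le_lt_trans.
apply: ge0_le_integral => //=.
- apply/measurable_EFinP; apply: (measurableT_comp (measurable_powR _)) => //.
  exact: measurableT_comp.
- by apply/measurable_EFinP; apply: measurableT_comp => //; exact: measurable_funX.
- by move=> x _; rewrite lee_fin normrX powR_mulrn.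
Qed.

Lemma sqint_mul f g : sqint f -> sqint g ->
  mu.-integrable setT (EFin \o (fun x => f x * g x)).
Proof.
by move=> /sqintP f2 /sqintP g2; apply/Lfun1_integrable; exact: Lfun2_mul_Lfun1.
Qed.

Lemma sqint0 : sqint (cst 0).
Proof.
split; first exact: measurable_cst.
have -> : EFin \o (fun x => (cst 0 : T -> R) x ^+ 2) = cst 0%E.
  by apply/funext => x /=; rewrite expr0n.
exact: integrable0.
Qed.

Lemma sqintZ a f : sqint f -> sqint (fun x => a * f x).
Proof.
move=> [mf intf]; split; first exact: measurable_funM.
have -> : EFin \o (fun x => (a * f x) ^+ 2) =
    (fun x => (a ^+ 2)%:E * (EFin \o (fun x => f x ^+ 2)%R) x)%E.
  by apply/funext => x /=; rewrite exprMn EFinM.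
exact: integrableZl.
Qed.

Lemma sqintD f g : sqint f -> sqint g -> sqint (f \+ g).
Proof.
move=> sf sg; have [mf intf] := sf; have [mg intg] := sg.
split; first exact: measurable_funD.
have -> : EFin \o (fun x => (f \+ g) x ^+ 2) =
  (fun x => (EFin \o (fun x => f x ^+ 2)%R) x + (2%:E * (EFin \o (fun x => f x * g x)%R) x
     + (EFin \o (fun x => g x ^+ 2)%R) x))%E.
  apply/funext => x /=; rewrite -EFinM -!EFinD; congr EFin; ring.
apply: integrableD => //; apply: integrableD => //.
by apply: integrableZl => //; exact: sqint_mul.
Qed.

Lemma sqintN f : sqint f -> sqint (\- f).
Proof.
move=> /(sqintZ (-1)).
by have -> : (fun x => -1 * f x) = \- f by apply/funext => x; rewrite mulN1r.
Qed.

Lemma sqintB f g : sqint f -> sqint g -> sqint (f \- g).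
Proof. by move=> sf /sqintN; exact: sqintD. Qed.

Lemma sqint_norm f : sqint f -> sqint (fun x => `|f x|).
Proof.
move=> [mf intf]; split; first exact: measurableT_comp.
have -> // : EFin \o (fun x => `|f x| ^+ 2) = EFin \o (fun x => f x ^+ 2).
by apply/funext => x /=; rewrite real_normK// num_real.
Qed.

Lemma sqint_sum (I : Type) (r : seq I) (F : I -> T -> R) :
  (forall i, sqint (F i)) -> sqint (fun x => \sum_(i <- r) F i x).
Proof.
move=> sF; elim: r => [|i r ih].
  have -> : (fun x => \sum_(i <- [::]) F i x) = cst 0.
    by apply/funext => x; rewrite big_nil.
  exact: sqint0.
have -> : (fun x => \sum_(j <- i :: r) F j x) =
    F i \+ (fun x => \sum_(j <- r) F j x).
  by apply/funext => x; rewrite big_cons.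
exact: sqintD.
Qed.

Lemma sqint_le f g : measurable_fun setT f -> sqint g ->
  (forall x, `|f x| <= `|g x|) -> sqint f.
Proof.
move=> mf [mg ig] fg; split => //; apply: le_integrable ig => //.
  by apply/measurable_EFinP; exact: measurable_funX.
by move=> x _ /=; rewrite lee_fin !normrX lerXn2r ?nnegrE.
Qed.

Lemma eq_ip_ae f f' g g' : sqint f -> sqint f' -> sqint g -> sqint g' ->
  {ae mu, forall x, f x = f' x} -> {ae mu, forall x, g x = g' x} ->
  ip f g = ip f' g'.
Proof.
move=> sf sf' sg sg' ff' gg'; rewrite /ip /Rintegral; congr fine.
apply: ae_eq_integral => //.
- by case/integrableP: (sqint_mul sf sg).
- by case/integrableP: (sqint_mul sf' sg').
- by apply: filterS2 ff' gg' => x -> ->.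
Qed.

Lemma ipC f g : ip f g = ip g f.
Proof. by apply: eq_Rintegral => x _; rewrite mulrC. Qed.

Lemma ipDl f g h : sqint f -> sqint g -> sqint h ->
  ip (f \+ g) h = ip f h + ip g h.
Proof.
move=> sf sg sh; rewrite -RintegralD//; try exact: sqint_mul.
by apply: eq_Rintegral => x _ /=; rewrite mulrDl.
Qed.

Lemma ipZl a f h : sqint f -> sqint h -> ip (fun x => a * f x) h = a * ip f h.
Proof.
move=> sf sh; rewrite -RintegralZl//; last exact: sqint_mul.
by apply: eq_Rintegral => x _ /=; rewrite mulrA.
Qed.

Lemma ipNl f h : sqint f -> sqint h -> ip (\- f) h = - ip f h.
Proof.
move=> sf sh; rewrite -mulN1r -ipZl//.
by apply: eq_Rintegral => x _ /=; rewrite mulN1r.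
Qed.

Lemma ipBl f g h : sqint f -> sqint g -> sqint h ->
  ip (f \- g) h = ip f h - ip g h.
Proof. by move=> sf sg sh; rewrite ipDl ?ipNl//; exact: sqintN. Qed.

Lemma ipDr f g h : sqint f -> sqint g -> sqint h ->
  ip h (f \+ g) = ip h f + ip h g.
Proof. by move=> *; rewrite ipC ipDl// ![ip _ h]ipC. Qed.

Lemma ipZr a f h : sqint f -> sqint h -> ip h (fun x => a * f x) = a * ip h f.
Proof. by move=> *; rewrite ipC ipZl// ipC. Qed.

Lemma ipBr f g h : sqint f -> sqint g -> sqint h ->
  ip h (f \- g) = ip h f - ip h g.
Proof. by move=> *; rewrite ipC ipBl// ![ip _ h]ipC. Qed.

Lemma ip_ge0 f : 0 <= ip f f.
Proof. by apply: Rintegral_ge0 => x _; rewrite -expr2 sqr_ge0. Qed.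

Lemma nrm_ge0 f : 0 <= nrm f. Proof. exact: sqrtr_ge0. Qed.

Lemma sqr_nrm f : nrm f ^+ 2 = ip f f.
Proof. by rewrite sqr_sqrtr ?ip_ge0. Qed.

Lemma nrmE f : sqint f ->
  ((nrm f ^+ 2)%:E = \int[mu]_x (f x ^+ 2)%:E)%E.
Proof.
move=> [mf intf]; rewrite sqr_nrm /ip /Rintegral.
under eq_integral do rewrite -expr2.
by rewrite fineK//; exact: integrable_fin_num.
Qed.

(* Cauchy-Schwarz from the discriminant of [s |-> |f + s g|^2]. *)
Lemma ip_CauchySchwarz f g : sqint f -> sqint g -> `|ip f g| <= nrm f * nrm g.
Proof.
move=> sf sg; rewrite -sqrtrM ?ip_ge0// -sqrtr_sqr; apply: ler_wsqrtr.
set b := ip f g; set A := ip f f; set C := ip g g.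
have q a : 0 <= A + 2 * a * b + a ^+ 2 * C.
  have := ip_ge0 (f \+ (fun x => a * g x)); have sag := sqintZ a sg.
  rewrite ipDl//; last exact: sqintD.
  rewrite ipDr// ipDr// ipZr// !ipZl// ipZr// [ip g f]ipC -/A -/b -/C.
  by move=> /le_trans; apply; apply: le_of_eq; ring.
have A0 : 0 <= A by exact: ip_ge0.
have [C0|C0] := eqVneq C 0.
  rewrite C0 mulr0; have [->|b0] := eqVneq b 0; first by rewrite expr0n.
  have := q (- (A + 1) / (2 * b)); rewrite C0 mulr0 addr0.
  have -> : 2 * (- (A + 1) / (2 * b)) * b = - (A + 1) by field.
  by lra.
have Cp : 0 < C by rewrite lt_neqAle eq_sym C0 ip_ge0.
have := q (- b / C).
have -> : A + 2 * (- b / C) * b + (- b / C) ^+ 2 * C = (A * C - b ^+ 2) / C.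
  by field.
by rewrite pmulr_lge0 ?invr_gt0// subr_ge0.
Qed.

Lemma eq_nrm f g : f =1 g -> nrm f = nrm g.
Proof. by move=> /funext ->. Qed.

Lemma nrmD f g : sqint f -> sqint g -> nrm (f \+ g) <= nrm f + nrm g.
Proof.
move=> sf sg; rewrite -ler_sqr ?nnegrE ?addr_ge0 ?nrm_ge0//.
rewrite sqrrD !sqr_nrm ipDl//; last exact: sqintD.
rewrite !ipDr// [ip g f]ipC.
by have := le_trans (ler_norm _) (ip_CauchySchwarz sf sg); rewrite mulr2n; lra.
Qed.

Lemma nrmZ a f : sqint f -> nrm (fun x => a * f x) = `|a| * nrm f.
Proof.
move=> sf; rewrite /nrm ipZl// ?ipZr//; last exact: sqintZ.
by rewrite mulrA -expr2 sqrtrM ?sqr_ge0// sqrtr_sqr.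
Qed.

Lemma nrmN f : nrm (\- f) = nrm f.
Proof. by rewrite /nrm; congr Num.sqrt; apply: eq_Rintegral => x _; rewrite mulrNN. Qed.

Lemma nrmBC f g : nrm (f \- g) = nrm (g \- f).
Proof. by rewrite -nrmN; apply: eq_nrm => x /=; rewrite opprB. Qed.

Lemma nrm_trans f g h : sqint f -> sqint g -> sqint h ->
  nrm (f \- h) <= nrm (f \- g) + nrm (g \- h).
Proof.
move=> sf sg sh; apply: le_trans (nrmD (sqintB sf sg) (sqintB sg sh)).
by rewrite (eq_nrm (g := (f \- g) \+ (g \- h)))// => x /=; rewrite subrKA.
Qed.

Lemma nrm_norm f : nrm (fun x => `|f x|) = nrm f.
Proof.
congr Num.sqrt; apply: eq_Rintegral => x _.
by rewrite -!expr2 real_normK// num_real.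
Qed.

Lemma nrm_sum (I : Type) (r : seq I) (F : I -> T -> R) (M : I -> R) :
  (forall i, sqint (F i)) -> (forall i, nrm (F i) <= M i) ->
  nrm (fun x => \sum_(i <- r) F i x) <= \sum_(i <- r) M i.
Proof.
move=> sF FM; elim: r => [|i r ih].
  rewrite big_nil (eq_nrm (g := cst 0)) => [|x]; last by rewrite big_nil.
  rewrite /nrm /ip /Rintegral.
  by under eq_integral do rewrite mulr0; rewrite integral0 sqrtr0.
rewrite big_cons (eq_nrm (g := F i \+ (fun x => \sum_(j <- r) F j x))); last first.
  by move=> x; rewrite big_cons.
by rewrite (le_trans (nrmD _ _))//; [exact: sqint_sum|exact: lerD].
Qed.

Lemma fatou_bound (f : nat -> T -> R) g (M : \bar R) :
  (forall n, measurable_fun setT (f n)) -> (forall n x, 0 <= f n x) ->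
  measurable_fun setT g -> {ae mu, forall x, f n x @[n --> \oo] --> g x} ->
  (forall n, \int[mu]_x (f n x)%:E <= M)%E -> (\int[mu]_x (g x)%:E <= M)%E.
Proof.
move=> mf f0 mg fg fM.
have mF n : measurable_fun setT (EFin \o f n) by exact/measurable_EFinP.
have F0 n x : setT x -> (0 <= (EFin \o f n) x)%E by rewrite lee_fin.
have H := @fatou _ _ _ mu setT measurableT _ mF F0.
rewrite (ae_eq_integral (fun x => limn_einf (fun n => (EFin \o f n) x)))//.
- apply: (le_trans H); rewrite limn_einf_lim; apply: lime_le.
    apply: is_cvg_einfs.
  apply: nearW => n; apply: ge_ereal_inf; exists (\int[mu]_x (f n x)%:E)%E.
    by exists n => //=.
  exact: fM.
- exact/measurable_EFinP.
- rewrite (_ : (fun x => _) = \- (fun x => limn_esup (fun n => - (EFin \o f n) x)%E))%E//.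
  apply: measurableT_comp => //; apply: measurable_fun_limn_esup => n.
  by apply: measurableT_comp.
- apply: filterS fg => x fgx _ /=.
  have /cvg_limn_einf_sup[-> _] // : (EFin \o f n) x @[n --> \oo] --> (g x)%:E.
  by apply: cvg_EFin => //; exact: nearW.
Qed.

Lemma nrm_fatou (f : nat -> T -> R) g (M : R) : 0 <= M ->
  (forall n, sqint (f n)) -> measurable_fun setT g ->
  {ae mu, forall x, f n x @[n --> \oo] --> g x} ->
  (forall n, nrm (f n) <= M) -> sqint g /\ nrm g <= M.
Proof.
move=> M0 sf mg fg fM.
have int_le : (\int[mu]_x (g x ^+ 2)%:E <= (M ^+ 2)%:E)%E.
  apply: (@fatou_bound (fun n x => f n x ^+ 2)).
  - by move=> n; apply: measurable_funX; case: (sf n).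
  - by move=> n x; exact: sqr_ge0.
  - exact: measurable_funX.
  - by apply: filterS fg => x h; rewrite expr2; under eq_fun do rewrite expr2; exact: cvgM.
  - by move=> n; rewrite -nrmE// lee_fin lerXn2r ?nnegrE ?nrm_ge0.
have sg : sqint g.
  split => //; apply/integrableP; split.
    by apply/measurable_EFinP; exact: measurable_funX.
  apply: le_lt_trans (ltry (M ^+ 2)); apply: le_trans int_le.
  by apply: ge0_le_integral => //=;
    [by apply/measurable_EFinP/measurableT_comp => //; exact: measurable_funX
    |by apply/measurable_EFinP; exact: measurable_funX
    |by move=> x _; rewrite lee_fin ger0_norm ?sqr_ge0].
split => //; move: int_le; rewrite -nrmE// lee_fin.
by rewrite ler_pXn2r ?nnegrE ?nrm_ge0.
Qed.

(** Monotone convergence bounds the integral of the limit of the squares by [M ^+ 2]; that limit is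
    thus finite a.e., and a bounded monotone sequence converges. *)
Lemma ae_bounded_of_int_sqr (G : nat -> T -> R) (M : R) : 0 <= M ->
  (forall n, sqint (G n)) -> (forall n, nrm (G n) <= M) ->
  (forall n x, 0 <= G n x) -> (forall x, nondecreasing_seq (G ^~ x)) ->
  {ae mu, forall x, cvgn (G ^~ x)}.
Proof.
move=> M0 sG GM G0 Gnd.
have nd2 x : nondecreasing_seq (fun n => (G n x ^+ 2)%:E).
  by move=> m n mn; rewrite lee_fin lerXn2r ?nnegrE//; exact: Gnd.
have H := @monotone_convergence _ _ _ mu setT measurableT
  (fun n x => (G n x ^+ 2)%:E) _ _ _.
have intG : (\int[mu]_x (limn (fun n => (G n x ^+ 2)%:E)) <= (M ^+ 2)%:E)%E.
  rewrite H.
  - apply: lime_le; last first.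
      by apply: nearW => n; rewrite -nrmE// lee_fin lerXn2r ?nnegrE ?nrm_ge0.
    apply: ereal_nondecreasing_is_cvgn => m n mn; apply: ge0_le_integral => //=.
    + by move=> x _; rewrite lee_fin sqr_ge0.
    + by apply/measurable_EFinP/measurable_funX; case: (sG m).
    + by apply/measurable_EFinP/measurable_funX; case: (sG n).
    + by move=> x _; exact: nd2.
  - by move=> n; apply/measurable_EFinP/measurable_funX; case: (sG n).
  - by move=> n x _; rewrite lee_fin sqr_ge0.
  - by move=> x _; exact: nd2.
have lim0 x : (0 <= limn (fun n => (G n x ^+ 2)%:E))%E.
  apply: lime_ge; first exact/ereal_nondecreasing_is_cvgn/nd2.
  by apply: nearW => n; rewrite lee_fin sqr_ge0.
have : mu.-integrable setT (fun x => limn (fun n => (G n x ^+ 2)%:E)).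
  apply/integrableP; split.
    apply: (@emeasurable_fun_cvg _ _ _ _ (fun n x => (G n x ^+ 2)%:E)) => //.
      by move=> n; apply/measurable_EFinP/measurable_funX; case: (sG n).
    by move=> x _; exact/ereal_nondecreasing_is_cvgn/nd2.
  under eq_integral do rewrite gee0_abs//.
  exact: le_lt_trans intG (ltry _).
move=> /(integrable_ae measurableT); apply: filterS => x /(_ I) fn.
apply: nondecreasing_is_cvgn; first exact: Gnd.
(* From [t ^+ 2 <= L] follows [t <= 1 + L], which avoids a square root. *)
exists (1 + fine (limn (fun n => (G n x ^+ 2)%:E))) => _ [n _ <-].
have : ((G n x ^+ 2)%:E <= limn (fun n => (G n x ^+ 2)%:E))%E.
  apply: lime_ge; first exact/ereal_nondecreasing_is_cvgn/nd2.
  by exists n => // m /= nm; exact: nd2.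
by rewrite -[limn _]fineK//= lee_fin => /= h; have := G0 n x; nra.
Qed.

Definition sqint_cauchy (f : nat -> T -> R) := forall e, 0 < e ->
  exists N, forall m n, (N <= m)%N -> (N <= n)%N -> nrm (f m \- f n) <= e.

Lemma fast_subsequence (f : nat -> T -> R) : sqint_cauchy f ->
  exists2 phi : nat -> nat, (forall k, (k <= phi k)%N) &
    forall k n, (phi k <= n)%N -> nrm (f n \- f (phi k)) <= 2^-1 ^+ k.
Proof.
move=> fC.
have /choice[N hN] : forall k, exists N, forall m n, (N <= m)%N -> (N <= n)%N ->
    nrm (f m \- f n) <= 2^-1 ^+ k.
  by move=> k; apply: fC; rewrite exprn_gt0.
exists (fun k => maxn k (N k)) => [k|k n]; first exact: leq_maxl.
rewrite geq_max => /andP[_ Nn].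
by apply: hN => //; exact: leq_maxr.
Qed.

(** Riesz-Fischer. The a.e. convergent subsequence is part of the conclusion because the radiality
    of a limit is read off pointwise. *)
Lemma sqint_complete (f : nat -> T -> R) :
  (forall n, sqint (f n)) -> sqint_cauchy f ->
  exists g, [/\ sqint g, nrm (f n \- g) @[n --> \oo] --> (0 : R) &
    exists2 phi : nat -> nat, (forall k, (k <= phi k)%N) &
    {ae mu, forall x, f (phi k) x @[k --> \oo] --> g x}].
Proof.
move=> sf fC; have [psi psik hpsi] := fast_subsequence fC.
(* Running maxima make the indices monotone, so that [phi k] and [phi k.+1] both lie beyond [psi k]
   and can be compared through it. *)
pose phi := fix phi k := if k is k'.+1 then maxn (psi k) (phi k') else psi 0.
have phiS k : (phi k <= phi k.+1)%N by exact: leq_maxr.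
have psiphi k : (psi k <= phi k)%N by case: k => //= k; exact: leq_maxl.
pose h k x : R := `|f (phi k.+1) x - f (phi k) x|.
have sh k : sqint (h k) by apply: sqint_norm; exact: sqintB.
have hk k : nrm (h k) <= 2 * 2^-1 ^+ k.
  rewrite nrm_norm.
  have := nrm_trans (sf (phi k.+1)) (sf (psi k)) (sf (phi k)).
  move=> /le_trans; apply; rewrite [nrm (f (psi k) \- _)]nrmBC.
  rewrite [leRHS](_ : _ = 2^-1 ^+ k + 2^-1 ^+ k); last by ring.
  by apply: lerD; apply: hpsi => //; exact: leq_trans (phiS k).
pose G n x : R := \sum_(k < n) h k x.
have cvG : {ae mu, forall x, cvgn (G ^~ x)}.
  (* The bound 4 is the sum of all [2 * 2^-1 ^+ k]. *)
  apply: (@ae_bounded_of_int_sqr G 4) => //.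
  - by move=> n; exact: sqint_sum.
  - move=> n; apply: (le_trans (nrm_sum (index_enum 'I_n) (fun i => sh i) (fun i => hk i))).
    rewrite -mulr_sumr.
    suff -> : \sum_(i < n) 2^-1 ^+ i = 2 - 2 * 2^-1 ^+ n :> R.
      have : 0 <= 2^-1 ^+ n :> R by rewrite exprn_ge0.
      by lra.
    elim: n => [|n ih]; first by rewrite big_ord0; ring.
    by rewrite big_ord_recr /= ih exprS; field.
  - by move=> n x; apply: sumr_ge0 => i _; exact: normr_ge0.
  - move=> x; apply/nondecreasing_seqP => n.
    by rewrite /G big_ord_recr /= lerDl normr_ge0.
have cvf : {ae mu, forall x, cvgn (fun k => f (phi k) x)}.
  apply: filterS cvG => x cvGx.
  have /normed_cvg cs : cvgn [normed series (fun k => f (phi k.+1) x - f (phi k) x)].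
    have -> // : [normed series (fun k => f (phi k.+1) x - f (phi k) x)] = G ^~ x.
    apply/funext => n; rewrite /G /series /=. by rewrite -(big_mkord xpredT (fun k => h k x)).
  have : cvgn (fun n => f (phi 0) x + series (fun k => f (phi k.+1) x - f (phi k) x) n).
    by apply: is_cvgD => //; exact: is_cvg_cst.
  suff -> : (fun n => f (phi 0) x + series (fun k => f (phi k.+1) x - f (phi k) x) n) =
     (fun k => f (phi k) x) by [].
  apply/funext => n; rewrite /series /= telescope_sumr//.
  by rewrite addrC subrK.
pose g x := fine (limn_esup (fun k => (f (phi k) x)%:E)).
have mg : measurable_fun setT g.
  apply: measurableT_comp => //; apply: measurable_fun_limn_esup => n.
  by apply/measurable_EFinP; case: (sf (phi n)).
have fg : {ae mu, forall x, f (phi k) x @[k --> \oo] --> g x}.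
  apply: filterS cvf => x cvx.
  have /cvg_limn_einf_sup[_] : (f (phi k) x)%:E @[k --> \oo] -->
      (limn (fun k => f (phi k) x))%:E.
    by apply: cvg_EFin => //; exact: nearW.
  by rewrite /g => -> /=.
have phik k : (k <= phi k)%N by exact: leq_trans (psik k) (psiphi k).
have lim_le e : 0 < e -> exists N, forall n, (N <= n)%N ->
    sqint (f n \- g) /\ nrm (f n \- g) <= e.
  move=> e0; have [N hN] := fC e e0; exists N => n Nn.
  (* With [n] fixed, Fatou along the subsequence turns the Cauchy bound into a bound on the distance
     to the limit. *)
  apply: (@nrm_fatou (fun k => f n \- f (phi (k + N)%N))) => //; first exact: ltW.
  - by move=> k; exact: sqintB.
  - by apply: measurable_funB => //; case: (sf n).
  - apply: filterS fg => x fgx /=; apply: cvgB; first exact: cvg_cst.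
    by have := fgx; rewrite -(cvg_shiftn N).
  - by move=> k; apply: hN => //; rewrite (leq_trans _ (phik _))// leq_addl.
exists g; split.
- have [N hN] := lim_le 1 ltr01; have [sfg _] := hN N (leqnn N).
  have := sqintB (sf N) sfg.
  suff -> : f N \- (f N \- g) = g by [].
  by apply/funext => x /=; rewrite opprB addrC subrK.
- apply/cvgrPdist_le => e e0; have [N hN] := lim_le e e0; exists N => // n Nn.
  by rewrite sub0r normrN ger0_norm ?nrm_ge0//; exact: (hN n Nn).2.
- by exists phi.
Qed.

End SquareIntegrable.

(** * Affine changes of variables *)

Section DominatedL2.
Context d (T : measurableType d) (R : realType) (mu : {measure set T -> \bar R}).

Lemma nrm_dominated (f : nat -> T -> R) (g h : T -> R) :
  (forall n, measurable_fun setT (f n)) -> measurable_fun setT g ->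
  sqint mu h -> (forall x, f n x @[n --> \oo] --> g x) ->
  (forall n x, `|f n x| <= h x) ->
  sqint mu g /\ nrm mu (f n \- g) @[n --> \oo] --> (0 : R).
Proof.
move=> mf mg sh fg fh.
have gh x : `|g x| <= h x.
  have : `|f n x| @[n --> \oo] --> `|g x| by exact: cvg_norm.
  move=> /cvgP cv; rewrite -(cvg_lim _ (cvg_norm (fg x)))//.
  by apply: limr_le => //; apply: nearW.
have hh x : `|h x| = h x by rewrite ger0_norm//; exact: le_trans (gh x).
have sg : sqint mu g.
  by apply: (sqint_le mg sh) => x; rewrite hh; exact: gh.
have sf n : sqint mu (f n) by apply: (sqint_le (mf n) sh) => x; rewrite hh.
split => //.
have ih : mu.-integrable setT (fun x => (4 * h x ^+ 2)%:E).
  rewrite (_ : (fun x => _) = (fun x => (4%:E * (EFin \o (fun x => h x ^+ 2)%R) x)%E))//.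
  by apply: integrableZl => //; case: sh.
have := @dominated_convergence _ _ _ mu setT measurableT
  (fun n x => ((f n x - g x) ^+ 2)%:E) (cst 0%E) (fun x => (4 * h x ^+ 2)%:E).
case.
- by move=> n; apply/measurable_EFinP/measurable_funX/measurable_funB.
- exact: measurable_cst.
- apply: aeW => x _; apply: cvg_EFin; first exact: nearW.
  rewrite /= [X in _ --> X](_ : _ = (g x - g x) * (g x - g x)); last by rewrite subrr mul0r.
  under eq_fun do rewrite expr2.
  by apply: cvgM; apply: cvgB => //; exact: cvg_cst.
- exact: ih.
- apply: aeW => x n _; rewrite /= lee_fin ger0_norm ?sqr_ge0//.
  have := fh n x; have := gh x; rewrite !ler_norml => /andP[a b] /andP[a' b'].
  by nra.
move=> _ _; rewrite integral0 => H.
have {}H : nrm mu (f n \- g) ^+ 2 @[n --> \oo] --> (0 : R).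
  rewrite [X in X @ _ --> _](_ : _ = fine \o [sequence (\int[mu]_x ((f n x - g x) ^+ 2)%:E)%E]_n).
    exact: (fine_cvg H).
  apply/funext => n /=; rewrite -(@nrmE _ _ _ mu (f n \- g))//=; exact: sqintB.
apply/cvgrPdist_lt => e e0; have e20 : 0 < e ^+ 2 by rewrite exprn_gt0.
have /cvgrPdist_lt/(_ _ e20) := H; apply: filterS => n.
rewrite !sub0r !normrN ger0_norm ?sqr_ge0// ger0_norm ?nrm_ge0//.
by rewrite ltr_pXn2r ?nnegrE ?nrm_ge0// ltW.
Qed.

End DominatedL2.

Section ScaledMeasure.

Definition push d1 d2 (T1 : measurableType d1) (T2 : measurableType d2)
    (R : realType) (mu : {measure set T1 -> \bar R}) (f : T1 -> T2)
    (mf : measurable_fun setT f) : {measure set T2 -> \bar R} :=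
  measure_function_pushforward__canonical__measure_function_Measure mu mf.

(** Here [c] is the Jacobian of [f]. The formulation by preimages is one about the pushforward
    measure, to which uniqueness theorems for measures apply. *)
Definition scaled_by d (T : measurableType d) (R : realType)
    (mu : set T -> \bar R) (f : T -> T) (c : R) :=
  forall A, measurable A -> mu A = (c%:E * mu (f @^-1` A))%E.

(** The rescaled pushforward has the right value on half-open intervals, and these determine
    Lebesgue measure. *)
Lemma lebesgue_affine (R : realType) (a b : R) : (0 < a)%R ->
  scaled_by (@lebesgue_measure R) (fun x => a * x + b) a.
Proof.
move=> a0 A mA.
pose f : measurableTypeR R -> measurableTypeR R := fun x => (a * x + b)%R.
have mf : measurable_fun setT f.
  by apply: measurable_funD => //; exact: measurable_funM.
pose c : {nonneg R} := NngNum (ltW a0).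
have := @lebesgue_measure_unique R (mscale c (push lebesgue_measure mf)).
move=> /(_ _ A mA) ->// _ [[x y] _ <-].
change (lebesgue_measure `]x, y]%classic =
    (a%:E * lebesgue_measure (f @^-1` `]x, y]))%E).
have -> : f @^-1` `]x, y] = `](x - b) / a, (y - b) / a]%classic.
  apply/seteqP; split => z /=; rewrite /f !in_itv/= => /andP[h1 h2]; apply/andP; split.
  - by rewrite ltr_pdivrMr//; lra.
  - by rewrite ler_pdivlMr//; lra.
  - by move: h1; rewrite ltr_pdivrMr//; lra.
  - by move: h2; rewrite ler_pdivlMr//; lra.
rewrite !lebesgue_measure_itv/= !lte_fin ltr_pM2r ?invr_gt0// ltrBlDr subrK.
case: ifPn => xy; last by rewrite mule0.
by rewrite -!EFinD -EFinM; congr EFin; field; rewrite gt_eqF.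
Qed.

Lemma scaled_by_prod d1 d2 (T1 : measurableType d1) (T2 : measurableType d2)
    (R : realType) (m1 : {sigma_finite_measure set T1 -> \bar R})
    (m2 : {sigma_finite_measure set T2 -> \bar R}) f1 f2 (c1 c2 : R) :
  (0 <= c1)%R -> (0 <= c2)%R ->
  measurable_fun setT f1 -> measurable_fun setT f2 ->
  scaled_by m1 f1 c1 -> scaled_by m2 f2 c2 ->
  scaled_by (m1 \x m2)%E (fun p => (f1 p.1, f2 p.2)) (c1 * c2)%R.
Proof.
move=> c10 c20 mf1 mf2 s1 s2 X mX.
pose f p := (f1 p.1, f2 p.2).
have mf : measurable_fun setT f.
  apply: measurable_fun_pair.
    exact: (measurableT_comp mf1).
  exact: (measurableT_comp mf2).
pose c : {nonneg R} := NngNum (mulr_ge0 c10 c20).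
have := @product_measure_unique _ _ _ _ _ m1 m2 (mscale c (push (m1 \x m2)%E mf)).
move=> -> // A B mA mB; rewrite /mscale/= /pushforward.
change ((c1 * c2)%:E * (m1 \x m2)%E ((f1 @^-1` A) `*` (f2 @^-1` B)) = m1 A * m2 B)%E.
rewrite product_measure1E; last 2 first.
- by rewrite -[X in measurable X]setTI; exact: mf1.
- by rewrite -[X in measurable X]setTI; exact: mf2.
by rewrite (s1 _ mA) (s2 _ mB) EFinM muleACA.
Qed.

Lemma integral_scaled d (T : measurableType d) (R : realType)
    (mu : {measure set T -> \bar R}) (f : T -> T) (c : R) (F : T -> \bar R) :
  0 < c -> measurable_fun setT f -> scaled_by mu f c ->
  measurable_fun setT F -> (forall x, 0 <= F x)%E ->
  (\int[mu]_x F x = c%:E * \int[mu]_x F (f x))%E.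
Proof.
move=> c0 mf smu mF F0.
pose k : {nonneg R} := NngNum (ltW c0).
have -> : (\int[mu]_x F (f x) = \int[push mu mf]_x F x)%E.
  by apply/esym/ge0_integral_pushforward.
rewrite -(@ge0_integral_mscale _ _ _ (push mu mf) setT measurableT k F)//.
by apply: eq_measure_integral => // A mA _; rewrite smu.
Qed.

End ScaledMeasure.

Section ProductSigmaFinite.
Context d1 d2 (T1 : measurableType d1) (T2 : measurableType d2) (R : realType).
Variables (m1 : {sigma_finite_measure set T1 -> \bar R}).
Variables (m2 : {sigma_finite_measure set T2 -> \bar R}).

Lemma sigma_finite_prod : sigma_finite setT (m1 \x m2)%E.
Proof.
have [F FT Foo] := sigma_finiteT m1; have [G GT Goo] := sigma_finiteT m2.
exists (fun n => if @unpickle (nat * nat)%type n is Some p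
  then F p.1 `*` G p.2 else set0).
  apply/seteqP; split => // -[x y] _.
  have [i _ Fx] : (\bigcup_i F i) x by rewrite -FT.
  have [j _ Gy] : (\bigcup_i G i) y by rewrite -GT.
  by exists (pickle (i, j)) => //; rewrite pickleK.
move=> n; case: unpickle => [[i j]|]; last by rewrite measure0.
have [mF Fi] := Foo i; have [mG Gj] := Goo j; split; first exact: measurableX.
by rewrite product_measure1E// lte_mul_pinfty// ge0_fin_numE.
Qed.

Definition prodm : {sigma_finite_measure set (T1 * T2)%type -> \bar R} :=
  HB.pack (m1 \x m2)%E (Measure_isSigmaFinite.Build _ _ _ (m1 \x m2)%E
    sigma_finite_prod).

End ProductSigmaFinite.

Section Leb3SigmaFinite.
Context (R : realType).

Definition leb2 := prodm (@lebesgue_measure R) (@lebesgue_measure R).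

(** The measure [leb3 R] together with the sigma-finiteness that Tonelli's theorem on pairs of
    points requires. *)
Definition sleb3 : {sigma_finite_measure set (E3 R) -> \bar R} :=
  prodm leb2 (@lebesgue_measure R).

End Leb3SigmaFinite.

Section Affine.
Context {R : realType}.
Implicit Types (a : R) (b x : E3 R).

Definition affine3 a b x : E3 R :=
  (a * x.1.1 + b.1.1, a * x.1.2 + b.1.2, a * x.2 + b.2).

Lemma measurable_affine1 (a b : R) :
  measurable_fun setT (fun x : measurableTypeR R => a * x + b : measurableTypeR R).
Proof. by apply: measurable_funD => //; exact: measurable_funM. Qed.

Lemma measurable_affine3 a b : measurable_fun setT (affine3 a b).
Proof.
apply: measurable_fun_pair; first apply: measurable_fun_pair.
- apply: (measurableT_comp (measurable_affine1 a b.1.1)).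
  exact: (measurableT_comp measurable_fst measurable_fst).
- apply: (measurableT_comp (measurable_affine1 a b.1.2)).
  exact: (measurableT_comp measurable_snd measurable_fst).
- exact: (measurableT_comp (measurable_affine1 a b.2) measurable_snd).
Qed.

Lemma leb3_affine a b : 0 < a -> scaled_by (leb3 R) (affine3 a b) (a ^+ 3).
Proof.
move=> a0; rewrite exprSr expr2.
have s1 (b' : R) := @lebesgue_affine R a b' a0.
have m1 (b' : R) := measurable_affine1 a b'.
have H := @scaled_by_prod _ _ _ _ R (leb2 R)
  lebesgue_measure (fun p : measurableTypeR R * measurableTypeR R =>
    (a * p.1 + b.1.1, a * p.2 + b.1.2) : measurableTypeR R * measurableTypeR R)
  (fun x : measurableTypeR R => a * x + b.2 : measurableTypeR R) (a * a) a.
apply: H => //.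
- by rewrite mulr_ge0// ltW.
- exact: ltW.
- apply: measurable_fun_pair.
    exact: (measurableT_comp (m1 b.1.1) measurable_fst).
  exact: (measurableT_comp (m1 b.1.2) measurable_snd).
apply: (@scaled_by_prod _ _ _ _ R lebesgue_measure lebesgue_measure
  (fun x : measurableTypeR R => a * x + b.1.1 : measurableTypeR R)
  (fun x : measurableTypeR R => a * x + b.1.2 : measurableTypeR R)) => //; exact: ltW.
Qed.

Lemma ge0_integral_affine a b (F : E3 R -> \bar R) : 0 < a ->
  measurable_fun setT F -> (forall x, 0 <= F x)%E ->
  (\int[leb3 R]_x F (affine3 a b x) = (a ^- 3)%:E * \int[leb3 R]_x F x)%E.
Proof.
move=> a0 mF F0.
rewrite (integral_scaled (exprn_gt0 3 a0) (measurable_affine3 a b) (leb3_affine b a0) mF F0).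
by rewrite muleA -EFinM mulVf ?mul1e// gt_eqF// exprn_gt0.
Qed.

Lemma integrable_affine a b (F : E3 R -> \bar R) : 0 < a ->
  (leb3 R).-integrable setT F -> (leb3 R).-integrable setT (F \o affine3 a b).
Proof.
move=> a0 /integrableP[mF Foo]; apply/integrableP; split.
  exact: (measurableT_comp mF (measurable_affine3 a b)).
rewrite (ge0_integral_affine b a0 (F := fun x => `|F x|%E))//; last first.
  exact: measurableT_comp.
by rewrite lte_mul_pinfty// lee_fin invr_ge0 exprn_ge0// ltW.
Qed.

Lemma Rintegral_affine a b (F : E3 R -> R) : 0 < a ->
  (leb3 R).-integrable setT (EFin \o F) ->
  \int[leb3 R]_x F (affine3 a b x) = a ^- 3 * \int[leb3 R]_x F x.
Proof.
move=> a0 iF; have iFa := integrable_affine b a0 iF.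
rewrite /Rintegral; have fin := integrable_fin_num measurableT.
have [/measurable_EFinP mF _] := integrableP _ _ _ iF.
have comp (G : E3 R -> \bar R) : (leb3 R).-integrable setT G -> (forall x, 0 <= G x)%E ->
    (\int[leb3 R]_x (G \o affine3 a b) x = (a ^- 3)%:E * \int[leb3 R]_x G x)%E.
  by move=> /integrableP[mG _] G0; exact: ge0_integral_affine.
have ifp : (leb3 R).-integrable setT ((EFin \o F)^\+)%E by exact: integrable_funepos.
have ifn : (leb3 R).-integrable setT ((EFin \o F)^\-)%E by exact: integrable_funeneg.
have -> : (\int[leb3 R]_x (F (affine3 a b x))%:E =
    (a ^- 3)%:E * \int[leb3 R]_x ((EFin \o F)^\+)%E x -
    (a ^- 3)%:E * \int[leb3 R]_x ((EFin \o F)^\-)%E x)%E.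
  by rewrite -!comp// -funepos_comp -funeneg_comp; exact: integralE.
rewrite [in RHS]integralE.
rewrite -muleBr//; last exact/fin_num_adde_defr/fin.
by rewrite fineM// fin_numB !fin.
Qed.

End Affine.

(** * Smooth functions *)

Section DirectionalDerivative.
Context {R : realType} {V : normedModType R}.
Implicit Types (f : V -> R).

Lemma is_derive_cast f (x v : V) (a b : R) :
  is_derive x v f a -> a = b -> is_derive x v f b.
Proof. by move=> fa <-. Qed.

(** Reduces directional derivatives to derivatives at 0 of functions of one real variable, where the
    chain rule and the mean value theorem are applied. *)
Lemma is_derive_line f (x v : V) (df : R) :
  is_derive x v f df <-> is_derive (0 : R) (1 : R) (fun h : R => f (h *: v + x)) df.
Proof.
have E : 'D_v f x = 'D_(1 : R) (fun h : R => f (h *: v + x)) (0 : R).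
  rewrite /derive; set g1 := fun h => h^-1 *: _; set g2 := fun h => h^-1 *: _.
  suff -> : g1 = g2 by [].
  by rewrite funeqE /g1 /g2 => h /=; rewrite addr0 scale0r add0r [_%:A]mulr1.
split=> -[d e].
  by apply: DeriveDef; [exact: (derivable1P f x v).1|rewrite -E].
by apply: DeriveDef; [exact: (derivable1P f x v).2|rewrite E].
Qed.

End DirectionalDerivative.

Lemma is_derive_affine_line {R : realType} (f : R -> R) (a b df : R) :
  is_derive b (1 : R) f df ->
  is_derive (0 : R) (1 : R) (fun h : R => f (a * h + b)) (df * a).
Proof.
move=> fb; apply: (@is_derive1_comp _ f (fun h => a * h + b)).
  by rewrite mulr0 add0r.
have h := @is_deriveD R R R (a \*: id) (cst b) 0 1 _ _
  (@is_deriveZ R R R id a 0 1 1 (is_derive_id _ _)) (is_derive_cst _ _ _).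
by apply: (is_derive_cast h); rewrite addr0 [_ *: _]mulr1.
Qed.

(** * A flat function and its derivatives *)

Section FlatExponential.
Context {R : realType}.
Implicit Types (p : {poly R}) (t : R).

(** The flat function [exp(-1/t)], with a polynomial in [1/t] in front so that the family is stable
    under derivation. *)
Definition bexp p t : R := if 0 < t then p.[t^-1] * expR (- t^-1) else 0.

(** The term of degree [k + 2] in the exponential series bounds [expR s] from below; the two extra
    degrees provide the quadratic decay of [bexp] at 0. *)
Lemma pow_expR_bound (k : nat) (s : R) : 0 < s ->
  s ^+ k * expR (- s) <= k.+2`!%:R * (s^-1) ^+ 2.
Proof.
move=> s0; rewrite expRN exprVn.
rewrite -[leLHS]/(s ^+ k / expR s) ler_pdivrMr ?expR_gt0//.
rewrite -mulrA mulrC -ler_pdivrMr ?ltr0n ?fact_gt0//.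
rewrite [leLHS](_ : _ = s ^- 2 * (s ^+ k.+2 / k.+2`!%:R)).
  apply: ler_wpM2l; first by rewrite invr_ge0 exprn_ge0// ltW.
  by apply: le_trans (expR_ge1Dxn k.+1 (ltW s0)); rewrite lerDr.
rewrite -addn2 exprD; field.
by rewrite pnatr_eq0 -lt0n fact_gt0 gt_eqF.
Qed.

Lemma bexp_bound p : exists2 C : R, 0 <= C & forall t, `|bexp p t| <= C * t ^+ 2.
Proof.
exists (\sum_(i < size p) `|p`_i| * i.+2`!%:R).
  by apply: sumr_ge0 => i _; rewrite mulr_ge0.
move=> t; rewrite /bexp; case: ifPn => t0; last first.
  by rewrite normr0 mulr_ge0 ?sqr_ge0//; apply: sumr_ge0 => i _; rewrite mulr_ge0.
rewrite horner_coef mulr_suml mulr_suml (le_trans (ler_norm_sum _ _ _))//.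
apply: ler_sum => i _; rewrite -mulrA normrM -mulrA ler_wpM2l//.
rewrite ger0_norm; last by rewrite mulr_ge0 ?expR_ge0// exprn_ge0// invr_ge0 ltW.
have ti : 0 < t^-1 by rewrite invr_gt0.
by have := pow_expR_bound i ti; rewrite invrK.
Qed.

Lemma bexp_le0 p t : t <= 0 -> bexp p t = 0.
Proof. by rewrite /bexp leNgt => /negbTE ->. Qed.

(** For positive [t] this is the product rule in the variable [t^-1]; at 0 the quadratic bound makes
    the difference quotient tend to 0. *)
Lemma is_derive_bexp p t :
  is_derive t 1 (bexp p) (bexp ('X^2 * (p - p^`())) t).
Proof.
have [t0|t0|->] := ltgtP t 0.
- rewrite bexp_le0 ?ltW//.
  have e : \forall s \near t, (cst 0 : R -> R) s = bexp p s.
    by near=> s; rewrite /= bexp_le0// ltW//; near: s; exact: lt_nbhsl.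
  exact: (near_eq_is_derive e (is_derive_cst _ _ _)).
- pose q (s : R) : R := p.[s^-1] * expR (- s^-1).
  have e : \forall s \near t, q s = bexp p s.
    by near=> s; rewrite /bexp ifT//; near: s; exact: lt_nbhsr.
  apply: (near_eq_is_derive e).
  have dV : is_derive t 1 (fun s : R => s^-1) (- t ^- 2).
    apply: DeriveDef; first by apply: derivableV => //; rewrite gt_eqF.
    by rewrite (deriveV (f := id)) ?gt_eqF// derive_id [_ *: _]mulr1.
  have d1 : is_derive t 1 (horner p \o (fun s => s^-1)) (p^`().[t^-1] * - t ^- 2).
    exact: is_derive1_comp.
  have d2 : is_derive t 1 (expR \o (fun s : R => - s^-1)) (expR (- t^-1) * t ^- 2).
    apply: is_derive1_comp; rewrite -[X in is_derive _ _ _ X]opprK.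
    exact: is_deriveN.
  have -> : q = (horner p \o (fun s => s^-1)) * (expR \o (fun s : R => - s^-1)) by [].
  apply: (is_derive_cast (is_deriveM d1 d2)) => /=.
  have sc (a b : R) : a *: (b : R) = a * b by [].
  rewrite /bexp t0 hornerM hornerXn hornerD hornerN !sc exprVn.
  by set u := p.[_]; set w := p^`().[_]; set y := expR _; set z := _^-1; ring.
- rewrite bexp_le0//; have [C C0 bC] := bexp_bound p.
  have lim : h^-1 *: ((bexp p \o shift 0) (h *: 1) - bexp p 0) @[h --> 0^'] --> (0 : R).
    apply/cvgrPdist_le => e e0; near=> h.
    rewrite sub0r normrN /= addr0 [h *: 1]mulr1 (@bexp_le0 p 0)// subr0.
    have h0 : h != 0 by near: h; exact: nbhs_dnbhs_neq.
    rewrite [_ *: _]/(_ * _) normrM normfV ler_pdivrMl ?normr_gt0//.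
    rewrite (le_trans (bC h))// -[h ^+ 2]real_normK ?num_real// expr2 mulrA.
    rewrite [leRHS]mulrC ler_wpM2r//.
    have : `|h| <= e / (C + 1).
      near: h; apply: dnbhs0_le; by rewrite divr_gt0// ltr_wpDl.
    rewrite ler_pdivlMr ?ltr_wpDl// => he; apply: le_trans he.
    by rewrite mulrC ler_wpM2l// lerDl.
  apply: DeriveDef; first by apply/cvg_ex; exists 0.
  exact: cvg_lim lim.
Unshelve. all: by end_near. Qed.

Lemma continuous_bexp p : continuous (bexp p).
Proof.
move=> t; apply/differentiable_continuous/derivable1_diffP.
by have [] := is_derive_bexp p t.
Qed.

Lemma bexp1_ge0 t : 0 <= bexp 1 t.
Proof. by rewrite /bexp; case: ifPn => // _; rewrite hornerC mul1r expR_ge0. Qed.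

Lemma bexp1_le1 t : bexp 1 t <= 1.
Proof.
rewrite /bexp; case: ifPn => // t0.
by rewrite hornerC mul1r -expR0 ler_expR oppr_le0 invr_ge0 ltW.
Qed.

(** Under rescaling the flat function approaches the indicator of the positive half-line; this
    produces smooth approximations of boxes. *)
Lemma bexp1_cvg t : 0 < t -> bexp 1 (n%:R * t) @[n --> \oo] --> (1 : R).
Proof.
move=> t0; rewrite -[X in _ --> X]expR0 -[X in expR X]oppr0.
have lim : - (n%:R * t)^-1 @[n --> \oo] --> (- 0 : R).
  apply: cvgN; under eq_fun do rewrite invfM.
  have h : n%:R^-1 @[n --> \oo] --> (0 : R).
    by rewrite -(cvg_shiftS (fun n => n%:R^-1 : R)); exact: cvg_harmonic.
  by have := @cvgM _ _ _ _ _ _ _ _ h (cvg_cst t^-1); rewrite mul0r; exact.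
have := cvg_comp _ _ lim (@continuous_expR R (- 0)).
apply: cvg_trans; apply: near_eq_cvg; near=> n.
rewrite /bexp hornerC mul1r ifT// mulr_gt0// ltr0n.
by near: n; exact: nbhs_infty_gt.
Unshelve. all: by end_near. Qed.

End FlatExponential.

Section TestFunctionAlgebra.
Context {R : realType}.
Implicit Types (f g phi : E3 R -> R) (x b : E3 R).

Definition coord3 (i : 'I_3) x : R :=
  if i == 0 :> nat then x.1.1 else if i == 1 :> nat then x.1.2 else x.2.

Lemma coord3_dir (i j : 'I_3) (h : R) x :
  coord3 i (h *: dir j + x) = h * (i == j)%:R + coord3 i x.
Proof.
by case: i => [[|[|[|//]]] ?]; case: j => [[|[|[|//]]] ?];
  rewrite /coord3 /dir /=.
Qed.

Lemma continuous_coord3 i : continuous (coord3 i).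
Proof.
case: i => [[|[|[|//]]] ?] x; rewrite /coord3 /=.
- exact: (@continuous_comp _ _ _ fst fst _ cvg_fst cvg_fst).
- exact: (@continuous_comp _ _ _ fst snd _ cvg_fst cvg_snd).
- exact: cvg_snd.
Qed.

(* Closed under products and partial derivatives, hence made of smooth
   functions. *)
Inductive bump_alg : (E3 R -> R) -> Prop :=
| bump_cst c : bump_alg (cst c)
| bump_gen p (c a : R) i : bump_alg (fun x => bexp p (c * coord3 i x + a))
| bump_add f g : bump_alg f -> bump_alg g -> bump_alg (f + g)
| bump_mul f g : bump_alg f -> bump_alg g -> bump_alg (f * g).

Lemma bump_alg_continuous f : bump_alg f -> continuous f.
Proof.
elim=> [c|p c a i|{}f g _ cf _ cg|{}f g _ cf _ cg] x.
- exact: cvg_cst.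
- apply: (@continuous_comp _ _ _ (fun x => c * coord3 i x + a) (bexp p)); last exact: continuous_bexp.
  by apply: cvgD; [apply: cvgM; [exact: cvg_cst|exact: continuous_coord3]|exact: cvg_cst].
- by apply: cvgD; [exact: cf|exact: cg].
- by apply: cvgM; [exact: cf|exact: cg].
Qed.

Lemma bump_alg_derive f i : bump_alg f ->
  exists2 g, bump_alg g & forall x, is_derive x (dir i) f (g x).
Proof.
elim=> [c|p c a j|{}f g _ [f' bf' df] _ [g' bg' dg]|
  {}f g bf [f' bf' df] bg [g' bg' dg]].
- by exists (cst 0); [exact: bump_cst|move=> x; exact: is_derive_cst].
- exists (cst (c * (j == i)%:R) * (fun x => bexp ('X^2 * (p - p^`())) (c * coord3 j x + a))).
    by apply: bump_mul; [exact: bump_cst|exact: bump_gen].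
  move=> x; apply/is_derive_line.
  have := is_derive_affine_line (c * (j == i)%:R) (is_derive_bexp p (c * coord3 j x + a)).
  rewrite [X in is_derive _ _ X _](_ : _ =
      (fun h : R => bexp p (c * coord3 j (h *: dir i + x) + a))); last first.
    by apply/funext => h; rewrite coord3_dir; congr bexp; ring.
  by move=> h; apply: (is_derive_cast h); rewrite mulrC.
- by exists (f' + g'); [exact: bump_add|move=> x; exact: is_deriveD].
- exists (f * g' + g * f'); first by apply: bump_add; exact: bump_mul.
  by move=> x; exact: is_deriveM.
Qed.

Lemma bump_alg_partial f i : bump_alg f -> bump_alg (partial i f).
Proof.
move=> /(bump_alg_derive i)[g bg dg].
by have -> : partial i f = g by apply/funext => x; rewrite /partial derive_val.
Qed.

Lemma bump_alg_smooth f : bump_alg f -> smooth f.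
Proof.
move=> bf s; have {}bf : bump_alg (foldr partial f s).
  by elim: s => //= i s; exact: bump_alg_partial.
split; first exact: bump_alg_continuous.
by move=> i x; have [g _ /(_ x)[]] := bump_alg_derive i bf.
Qed.

Lemma affine3_dir a b i (h : R) x :
  affine3 a b (h *: dir i + x) = (a * h) *: dir i + affine3 a b x.
Proof.
have lem (e y c : R) : a * (h * e + y) + c = a * h * e + (a * y + c) by ring.
by congr (_, _, _); exact: lem.
Qed.

Lemma is_derive_comp_affine3 (a : R) b i f x : derivable f (affine3 a b x) (dir i) ->
  is_derive x (dir i) (f \o affine3 a b) (a * partial i f (affine3 a b x)).
Proof.
move=> /derivableP/is_derive_line df; apply/is_derive_line.
have := @is_derive_affine_line _ _ a 0 _ df.
rewrite [X in is_derive _ _ X _](_ : _ =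
    (fun h : R => (f \o affine3 a b) (h *: dir i + x))).
  by move=> h; apply: (is_derive_cast h); rewrite mulrC.
by apply/funext => h /=; rewrite affine3_dir addr0.
Qed.

Lemma continuous_affine3 (a : R) b : continuous (affine3 a b).
Proof.
move=> x.
have h1 : a * y.1.1 + b.1.1 @[y --> x] --> a * x.1.1 + b.1.1.
  by apply: cvgD; [apply: cvgM; [exact: cvg_cst|exact: (@continuous_comp _ _ _ fst fst x cvg_fst cvg_fst)]|exact: cvg_cst].
have h2 : a * y.1.2 + b.1.2 @[y --> x] --> a * x.1.2 + b.1.2.
  by apply: cvgD; [apply: cvgM; [exact: cvg_cst|exact: (@continuous_comp _ _ _ fst snd x cvg_fst cvg_snd)]|exact: cvg_cst].
have h3 : a * y.2 + b.2 @[y --> x] --> a * x.2 + b.2.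
  by apply: cvgD; [apply: cvgM; [exact: cvg_cst|exact: cvg_snd]|exact: cvg_cst].
exact: (cvg_pair (cvg_pair h1 h2) h3).
Qed.

Lemma affine3K (a : R) b : a != 0 ->
  cancel (affine3 a b) (affine3 a^-1 (- a^-1 * b.1.1, - a^-1 * b.1.2, - a^-1 * b.2)).
Proof.
by move=> a0 [[x y] z]; rewrite /affine3 /=; congr (_, _, _); field.
Qed.

Lemma foldr_partial_affine (a : R) b f s : smooth f ->
  foldr partial (f \o affine3 a b) s =
  (fun x => a ^+ size s * foldr partial f s (affine3 a b x)).
Proof.
move=> sf; elim: s => [|i s ih] /=; first by apply/funext => x; rewrite mul1r.
apply/funext => x; rewrite ih /partial.
have [_ /(_ i (affine3 a b x)) df] := sf s.
have dc := is_derive_comp_affine3 df.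
have := @is_deriveZ _ _ _ _ (a ^+ size s) _ _ _ dc => -[_ h].
by rewrite h exprSr [_ *: _]mulrA.
Qed.

Lemma smooth_affine (a : R) b f : smooth f -> smooth (f \o affine3 a b).
Proof.
move=> sf s; rewrite foldr_partial_affine//; have [cf df] := sf s; split.
  move=> x; apply: cvgM; first exact: cvg_cst.
  exact: (continuous_comp (@continuous_affine3 a b x) (cf _)).
move=> i x.
have dc := is_derive_comp_affine3 (df i (affine3 a b x)).
by have [h _] := @is_deriveZ _ _ _ _ (a ^+ size s) _ _ _ dc.
Qed.

Lemma partial_affine (a : R) b f i : smooth f ->
  partial i (f \o affine3 a b) = (fun x => a * partial i f (affine3 a b x)).
Proof. by move=> sf; have := foldr_partial_affine a b [:: i] sf; rewrite /= expr1. Qed.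

Lemma test_function_affine (a : R) b phi : a != 0 ->
  test_function phi -> test_function (phi \o affine3 a b).
Proof.
move=> a0 [sphi cphi]; split; first exact: smooth_affine.
set K := closure [set x | phi x != 0] in cphi.
set T' := affine3 a^-1 (- a^-1 * b.1.1, - a^-1 * b.1.2, - a^-1 * b.2).
have cT : compact (T' @` K).
  by apply: continuous_compact => //; apply: continuous_subspaceT; exact: continuous_affine3.
apply: (subclosed_compact _ cT); first exact: closed_closure.
rewrite closureE => x; apply; split.
  by apply: compact_closed => //; exact: norm_hausdorff.
move=> y /= py; exists (affine3 a b y); last exact: affine3K.
exact: subset_closure.
Qed.

End TestFunctionAlgebra.

(** * Density of test functions *)

Section TestFunctionDensity.
Import HBNNSimple.
Context {R : realType}.
Notation mu := (leb3 R).
Implicit Types (f g h phi : E3 R -> R) (x a b : E3 R) (A X Y : set (E3 R)).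

(** Taken inside [bump_alg], sums and multiples of test functions are smooth by construction. *)
Definition bump_test phi := bump_alg phi /\ compact (closure [set x | phi x != 0]).

Lemma bump_test_function phi : bump_test phi -> test_function phi.
Proof. by move=> [bphi cphi]; split => //; exact: bump_alg_smooth. Qed.

Lemma bump_testD phi psi : bump_test phi -> bump_test psi -> bump_test (phi + psi).
Proof.
move=> [bphi cphi] [bpsi cpsi]; split; first exact: bump_add.
apply: (subclosed_compact _ (compactU cphi cpsi)); first exact: closed_closure.
rewrite -closureU; apply: closureS => x /=; apply: contra_neqP.
by move=> /not_orP[/negP/negPn/eqP + /negP/negPn/eqP]; rewrite -[(phi + psi) x]/(phi x + psi x) => -> ->; rewrite addr0.
Qed.

Lemma bump_testZ c phi : bump_test phi -> bump_test (cst c * phi).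
Proof.
move=> [bphi cphi]; split; first by apply: bump_mul => //; exact: bump_cst.
apply: (subclosed_compact _ cphi); first exact: closed_closure.
apply: closureS => x /=; apply: contra_neq.
by rewrite -[(cst c * phi) x]/(c * phi x) => ->; rewrite mulr0.
Qed.

Lemma bump_test_sqint phi : bump_test phi -> sqint mu phi.
Proof. by move=> /bump_test_function/test_function_L2/sqintP. Qed.

(** The L^2 closure of the bump test functions: a linear space, stable under dominated pointwise
    limits, which is what a Dynkin argument needs. *)
Definition tdense f :=
  sqint mu f /\ forall e, 0 < e -> exists2 phi, bump_test phi & nrm mu (f \- phi) <= e.

Lemma tdense_bump phi : bump_test phi -> tdense phi.
Proof.
move=> bphi; split; first exact: bump_test_sqint.
move=> e e0; exists phi => //; apply: le_trans (ltW e0).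
rewrite (eq_nrm _ (g := fun x => 0 * phi x)); last first.
  by move=> x /=; rewrite subrr mul0r.
by rewrite nrmZ ?normr0 ?mul0r//; exact: bump_test_sqint.
Qed.

Lemma tdenseD f g : tdense f -> tdense g -> tdense (f \+ g).
Proof.
move=> [sf df] [sg dg]; split; first exact: sqintD.
move=> e e0; have e20 : 0 < e / 2 by rewrite divr_gt0.
have [phi bphi fphi] := df _ e20; have [psi bpsi gpsi] := dg _ e20.
have [sphi spsi] := (bump_test_sqint bphi, bump_test_sqint bpsi).
exists (phi + psi); first exact: bump_testD.
rewrite (eq_nrm _ (g := (f \- phi) \+ (g \- psi))); last first.
  by move=> x /=; rewrite opprD addrACA.
by rewrite (le_trans (nrmD (sqintB sf sphi) (sqintB sg spsi)))// [leRHS]splitr lerD.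
Qed.

Lemma tdenseZ c f : tdense f -> tdense (fun x => c * f x).
Proof.
move=> [sf df]; split; first exact: sqintZ.
move=> e e0; have ec0 : 0 < e / (`|c| + 1) by rewrite divr_gt0// ltr_wpDl.
have [phi bphi fphi] := df _ ec0; have sphi := bump_test_sqint bphi.
exists (cst c * phi); first exact: bump_testZ.
rewrite (eq_nrm _ (g := fun x => c * (f \- phi) x)); last first.
  by move=> x /=; rewrite mulrBr.
rewrite nrmZ; last exact: sqintB.
move: fphi; rewrite ler_pdivlMr ?ltr_wpDl//; apply: le_trans.
by rewrite mulrDr mulr1 mulrC lerDl nrm_ge0.
Qed.

Lemma tdenseB f g : tdense f -> tdense g -> tdense (f \- g).
Proof.
move=> df /(tdenseZ (-1)) dg.
suff -> : f \- g = f \+ (fun x => -1 * g x) by exact: tdenseD.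
by apply/funext => x /=; rewrite mulN1r.
Qed.

Lemma tdense_sum n (c : 'I_n -> R) (F : 'I_n -> E3 R -> R) :
  (forall i, tdense (F i)) -> tdense (fun x => \sum_(i < n) c i * F i x).
Proof.
elim: n c F => [|n ih] c F dF.
  have -> : (fun x => \sum_(i < 0) c i * F i x) = cst 0.
    by apply/funext => x; rewrite big_ord0.
  apply: tdense_bump; split; first exact: bump_cst.
  rewrite (_ : [set x | _] = set0) ?closure0; first exact: compact0.
  by apply/seteqP; split => x //=; rewrite eqxx.
have -> : (fun x => \sum_(i < n.+1) c i * F i x) =
    (fun x => c ord0 * F ord0 x) \+ (fun x => \sum_(i < n) c (lift ord0 i) * F (lift ord0 i) x).
  by apply/funext => x; rewrite big_ord_recl.
by apply: tdenseD; [exact: tdenseZ|exact: ih].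
Qed.

Lemma tdense_cvg (F : nat -> E3 R -> R) f h : (forall n, tdense (F n)) ->
  measurable_fun setT f -> sqint mu h ->
  (forall x, F n x @[n --> \oo] --> f x) -> (forall n x, `|F n x| <= h x) ->
  tdense f.
Proof.
move=> dF mf sh Ff Fh.
have [sf nf] := @nrm_dominated _ _ _ mu F f h (fun n => (dF n).1.1) mf sh Ff Fh.
split => // e e0; have e20 : 0 < e / 2 by rewrite divr_gt0.
move/cvgrPdist_le : nf => /(_ _ e20)[N _ /(_ N (leqnn N))].
rewrite sub0r normrN ger0_norm ?nrm_ge0// => hN.
have [sFN /(_ _ e20)[phi bphi Fphi]] := dF N.
exists phi => //; have sphi := bump_test_sqint bphi.
apply: (le_trans (nrm_trans sf sFN sphi)).
by rewrite nrmBC [leRHS]splitr lerD.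
Qed.

Definition obox a b : set (E3 R) := [set x : E3 R | [/\ a.1.1 < x.1.1 < b.1.1,
  a.1.2 < x.1.2 < b.1.2 & a.2 < x.2 < b.2]].

Definition cbox a b := `[a.1.1, b.1.1]%classic `*` `[a.1.2, b.1.2]%classic
  `*` `[a.2, b.2]%classic : set (E3 R).

Lemma compact_cbox a b : compact (cbox a b).
Proof.
by apply: compact_setX; [apply: compact_setX|]; exact: segment_compact.
Qed.

Lemma open_obox a b : open (obox a b).
Proof.
have cc (f : E3 R -> R) (r t : R) : continuous f -> open [set x | r < f x < t].
  move=> cf; rewrite (_ : [set x | _] = f @^-1` `]r, t[%classic).
    by apply: open_comp => // x _; exact: cf.
  by apply/seteqP; split => x /=; rewrite in_itv.
have -> : obox a b = [set x | a.1.1 < x.1.1 < b.1.1] `&`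
    ([set x | a.1.2 < x.1.2 < b.1.2] `&` [set x | a.2 < x.2 < b.2]).
  by apply/seteqP; split => x /=; [case|move=> [? []]].
apply: openI; last apply: openI; apply: cc.
- exact: (@continuous_coord3 R (Ordinal (isT : 0 < 3)%N)).
- exact: (@continuous_coord3 R (Ordinal (isT : 1 < 3)%N)).
- exact: (@continuous_coord3 R (Ordinal (isT : 2 < 3)%N)).
Qed.

Lemma measurable_obox a b : measurable (obox a b).
Proof. by apply: open_measurable3; exact: open_obox. Qed.

Lemma obox_cbox a b : obox a b `<=` cbox a b.
Proof.
move=> x [/andP[h1 h2] /andP[h3 h4] /andP[h5 h6]].
by split; [split|]; rewrite /= in_itv/= ?(ltW h1, ltW h2, ltW h3, ltW h4, ltW h5, ltW h6).
Qed.

Lemma finite_obox a b : (mu (obox a b) < +oo)%E.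
Proof.
have [C [mC sC fC]] := compact_finite_measure3 (compact_cbox (a := a) (b := b)).
apply: le_lt_trans fC; apply: le_measure; rewrite ?inE//; first exact: measurable_obox.
exact: subset_trans (@obox_cbox a b) sC.
Qed.

Lemma sqint_indic X : measurable X -> (mu X < +oo)%E -> sqint mu \1_X.
Proof.
move=> mX X0; split; first exact: measurable_indic.
have -> : EFin \o (fun x => (\1_X x : R) ^+ 2) = EFin \o (\1_X : E3 R -> R).
  apply/funext => x /=; rewrite indicE.
  by case: (x \in X); rewrite /= ?expr1n ?expr0n.
apply/integrableP; split; first exact/measurable_EFinP/measurable_indic.
under eq_integral do rewrite /= ger0_norm//.
by rewrite integral_indic// setIT.
Qed.

(** A product of six rescaled flat functions, two for each axis, vanishes off the box, tends to 1
    inside it and never exceeds the indicator, which serves as the dominating function. *)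
Lemma tdense_obox a b : tdense \1_(obox a b).
Proof.
(* Written in the shape [c * y + a] that [bump_gen] expects. *)
pose e n (s t y : R) := bexp 1 (n%:R * y + (- (n%:R * s))) *
  bexp 1 (- n%:R * y + n%:R * t) : R.
have eE n s t y : e n s t y = bexp 1 (n%:R * (y - s)) * bexp 1 (n%:R * (t - y)).
  by rewrite /e; congr (bexp 1 _ * bexp 1 _); ring.
have e0 n s t y : 0 <= e n s t y by rewrite mulr_ge0 ?bexp1_ge0.
have e1 n s t y : e n s t y <= 1 by rewrite mulr_ile1 ?bexp1_ge0 ?bexp1_le1.
have ez n s t y : ~~ (s < y < t) -> e n s t y = 0.
  rewrite negb_and -!leNgt eE => /orP[ys|ty].
    by rewrite [X in X * _]bexp_le0 ?mul0r// mulr_ge0_le0// subr_le0.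
  by rewrite [X in _ * X]bexp_le0 ?mulr0// mulr_ge0_le0// subr_le0.
have ecvg s t y : s < y < t -> e n s t y @[n --> \oo] --> (1 : R).
  move=> /andP[sy yt]; under eq_fun do rewrite eE.
  have h1 := @bexp1_cvg R (y - s); have h2 := @bexp1_cvg R (t - y).
  by have := cvgM (h1 _) (h2 _); rewrite !subr_gt0 mulr1; exact.
pose F n x := e n a.1.1 b.1.1 x.1.1 * e n a.1.2 b.1.2 x.1.2 * e n a.2 b.2 x.2 : R.
have Fz n x : ~ obox a b x -> F n x = 0.
  move=> nb; rewrite /F.
  have [h1|/ez ->] := boolP (a.1.1 < x.1.1 < b.1.1); last by rewrite !mul0r.
  have [h2|/ez ->] := boolP (a.1.2 < x.1.2 < b.1.2); last by rewrite mulr0 mul0r.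
  have [h3|/ez ->] := boolP (a.2 < x.2 < b.2); last by rewrite mulr0.
  by case: nb.
apply: (@tdense_cvg F _ \1_(obox a b)) => [n| | |x|n x].
- apply: tdense_bump; split.
    have gen i s t : bump_alg (fun x => e n s t (coord3 i x)).
      by apply: bump_mul; exact: bump_gen.
    exact: (bump_mul (bump_mul (gen (Ordinal (isT : 0 < 3)%N) _ _)
      (gen (Ordinal (isT : 1 < 3)%N) _ _)) (gen (Ordinal (isT : 2 < 3)%N) _ _)).
  apply: (subclosed_compact _ (compact_cbox (a := a) (b := b))); first exact: closed_closure.
  rewrite closureE => x; apply; split.
    by apply: compact_closed; [exact: norm_hausdorff|exact: compact_cbox].
  move=> y /= /eqP Fy; apply: obox_cbox; apply: contrapT => /(Fz n).
  exact: Fy.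
- by apply: measurable_indic; exact: measurable_obox.
- by apply: sqint_indic; [exact: measurable_obox|exact: finite_obox].
- have [bx|bx] := pselect (obox a b x); last first.
    rewrite indicE memNset//; under eq_fun do rewrite Fz//.
    exact: cvg_cst.
  rewrite indicE mem_set//=; case: bx => h1 h2 h3.
  have := cvgM (cvgM (ecvg _ _ _ h1) (ecvg _ _ _ h2)) (ecvg _ _ _ h3).
  by rewrite !mulr1; exact.
- rewrite ger0_norm; last by apply: mulr_ge0 => //; exact: mulr_ge0.
  have [bx|bx] := pselect (obox a b x); last by rewrite Fz// indicE.
  rewrite indicE mem_set//=; apply: mulr_ile1 => //; first exact: mulr_ge0.
  exact: mulr_ile1.
Qed.

Lemma in_preimage (S U : Type) (k : S -> U) (A : set U) (x : S) :
  (x \in k @^-1` A) = (k x \in A).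
Proof. by apply/idP/idP; rewrite !inE. Qed.

(** The sets [A] for which the claim holds form a lambda-system: differences by linearity,
    increasing unions by domination with [\1_Y]. A generating family stable under intersection is
    thus enough. The map [k] allows one coordinate to be treated at a time. *)
Lemma tdense_dynkin d (S : measurableType d) (k : E3 R -> S) (G : set (set S)) Y :
  measurable_fun setT k -> measurable Y -> (mu Y < +oo)%E -> setI_closed G ->
  d.-measurable = <<s G >> -> tdense \1_Y ->
  (forall A : set S, G A -> tdense \1_(k @^-1` A `&` Y)) ->
  forall A : set S, measurable A -> tdense \1_(k @^-1` A `&` Y).
Proof.
move=> mk mY Yoo GI mG dY GY.
pose H := [set A : set S | measurable A /\ tdense \1_(k @^-1` A `&` Y)].
suff : <<s G >> `<=` H by rewrite -mG => sH A /sH[].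
apply: (lambda_system_subset GI) => //; last first.
  by move=> A GA; split; [rewrite mG; exact: sub_sigma_algebra|exact: GY].
split => //.
- by split => //; rewrite preimage_setT setTI.
- move=> A B BA [mA dA] [mB dB]; split; first exact: measurableD.
  suff -> : \1_(k @^-1` (A `\` B) `&` Y) =
      \1_(k @^-1` A `&` Y) \- \1_(k @^-1` B `&` Y) :> (E3 R -> R) by exact: tdenseB.
  apply/funext => x; rewrite indicE in_setI in_preimage in_setD /=.
  rewrite !indicE !in_setI !in_preimage.
  have [Bx|nBx] := pselect (B (k x)).
    by rewrite (mem_set Bx) (mem_set (BA _ Bx))/= subrr.
  by rewrite (memNset nBx)/= andbT subr0.
- move=> A ndA HA.
  have mU : measurable (\bigcup_i A i) by apply: bigcup_measurable => i _; case: (HA i).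
  split => //.
  have mpre B : measurable B -> measurable (k @^-1` B).
    by move=> mB; rewrite -[X in measurable X]setTI; exact: mk.
  apply: (@tdense_cvg (fun n => \1_(k @^-1` A n `&` Y)) _ \1_Y).
  + by move=> n; case: (HA n).
  + by apply: measurable_indic; apply: measurableI => //; exact: mpre.
  + exact: sqint_indic.
  + move=> x; have [Ux|Ux] := pselect ((\bigcup_i A i) (k x)); last first.
      rewrite indicE in_setI in_preimage [k x \in _]memNset//=.
      under eq_fun do rewrite indicE in_setI in_preimage.
      rewrite (_ : (fun n => _) = cst 0); first exact: cvg_cst.
      apply/funext => n /=; rewrite [k x \in _]memNset// => Akx.
      by apply: Ux; exists n.
    apply: cvg_near_cst; case: (Ux) => n _ An; exists n => // m /= nm.
    have Am : A m (k x) by move/subsetPset : (ndA _ _ nm); apply.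
    by rewrite !indicE !in_setI !in_preimage (mem_set Am) (mem_set Ux).
  + move=> n x; rewrite !indicE in_setI.
    by case: (_ \in _); case: (_ \in _); rewrite ?normr1 ?normr0.
Qed.

Lemma setI_closed_rays : setI_closed (@RGenOInfty.G R).
Proof.
move=> _ _ [r ->] [s ->]; exists (Num.max r s); apply/seteqP; split => y /=.
  by rewrite !in_itv/= !andbT gt_max => -[-> ->].
by rewrite !in_itv/= !andbT gt_max => /andP[-> ->].
Qed.

Lemma setI_closed_rectangles d1 d2 (T1 : measurableType d1) (T2 : measurableType d2) :
  setI_closed [set A `*` B | A in @measurable _ T1 & B in @measurable _ T2].
Proof.
move=> _ _ [A mA [B mB <-]] [A' mA' [B' mB' <-]]; rewrite -setXI.
exists (A `&` A'); first exact: measurableI.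
by exists (B `&` B') => //; exact: measurableI.
Qed.

(** One coordinate after the other: a ray in one coordinate cuts a box in a smaller box, and rays
    generate the measurable sets of the line. *)
Lemma tdense_rectangle (A1 A2 A3 : set (measurableTypeR R)) a b :
  measurable A1 -> measurable A2 -> measurable A3 ->
  tdense \1_(snd @^-1` A3 `&` ((fun x => x.1.2) @^-1` A2 `&`
    ((fun x => x.1.1) @^-1` A1 `&` obox a b))).
Proof.
have m1 : measurable_fun setT (fun x : E3 R => x.1.1) by exact: (measurableT_comp measurable_fst measurable_fst).
have m2 : measurable_fun setT (fun x : E3 R => x.1.2) by exact: (measurableT_comp measurable_snd measurable_fst).
have m3 : measurable_fun setT (fun x : E3 R => x.2) by exact: measurable_snd.
have mpre (k : E3 R -> measurableTypeR R) (A : set (measurableTypeR R)) : measurable_fun setT k -> measurable A -> measurable (k @^-1` A).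
  by move=> mk mA; rewrite -[X in measurable X]setTI; exact: mk.
have fin A (X : set (E3 R)) : measurable A -> measurable X -> (mu X < +oo)%E -> (mu (A `&` X) < +oo)%E.
  move=> mA mX; apply: le_lt_trans.
  by apply: le_measure; rewrite ?inE//; exact: measurableI.
have mO := @measurable_obox.
move=> mA1 mA2 mA3.
have S1 c d : tdense \1_((fun x => x.1.1) @^-1` A1 `&` obox c d).
  move: mA1; apply: (tdense_dynkin m1 (mO c d) (finite_obox c d) setI_closed_rays (RGenOInfty.measurableE R)).
    exact: tdense_obox.
  move=> _ [r ->]; rewrite (_ : _ `&` _ = obox (Num.max c.1.1 r, c.1.2, c.2) d); first exact: tdense_obox.
  apply/seteqP; split => x; rewrite /obox /=.
    by rewrite in_itv/= andbT gt_max => -[-> [/andP[-> ->] -> ->]].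
  by rewrite in_itv/= andbT gt_max => -[/andP[/andP[-> ->] ->] -> ->].
have mS1 c d : measurable ((fun x => x.1.1) @^-1` A1 `&` obox c d).
  by apply: measurableI; [exact: mpre|exact: mO].
have fS1 c d : (mu ((fun x => x.1.1) @^-1` A1 `&` obox c d) < +oo)%E.
  by apply: fin; [exact: mpre|exact: mO|exact: finite_obox].
have S2 c d : tdense \1_((fun x => x.1.2) @^-1` A2 `&` ((fun x => x.1.1) @^-1` A1 `&` obox c d)).
  move: mA2; apply: (tdense_dynkin m2 (mS1 c d) (fS1 c d) setI_closed_rays (RGenOInfty.measurableE R)).
    exact: S1.
  move=> _ [r ->]; rewrite (_ : _ `&` _ = (fun x => x.1.1) @^-1` A1 `&` obox (c.1.1, Num.max c.1.2 r, c.2) d); first exact: S1.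
  apply/seteqP; split => x; rewrite /obox /=.
    by rewrite in_itv/= andbT gt_max => -[-> [? [-> /andP[-> ->] ->]]].
  by rewrite in_itv/= andbT gt_max => -[? [-> /andP[/andP[-> ->] ->] ->]].
have mS2 c d : measurable ((fun x => x.1.2) @^-1` A2 `&` ((fun x => x.1.1) @^-1` A1 `&` obox c d)).
  by apply: measurableI => //; exact: mpre.
have fS2 c d : (mu ((fun x => x.1.2) @^-1` A2 `&` ((fun x => x.1.1) @^-1` A1 `&` obox c d)) < +oo)%E.
  by apply: fin => //; exact: mpre.
move: mA3; apply: (tdense_dynkin m3 (mS2 a b) (fS2 a b) setI_closed_rays (RGenOInfty.measurableE R)).
  exact: S2.
move=> _ [r ->]; rewrite (_ : _ `&` _ = (fun x => x.1.2) @^-1` A2 `&` ((fun x => x.1.1) @^-1` A1 `&` obox (a.1, Num.max a.2 r) b)); first exact: S2.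
apply/seteqP; split => x; rewrite /obox /=.
  by rewrite in_itv/= andbT gt_max => -[-> [? [? [-> -> /andP[-> ->]]]]].
by rewrite in_itv/= andbT gt_max => -[? [? [-> -> /andP[/andP[-> ->] ->]]]].
Qed.

(** Two more Dynkin arguments, since [E3] is an iterated product: from rectangles to measurable sets
    of the plane, then from products with the third factor to all measurable sets. *)
Lemma tdense_measurable X a b : measurable X -> tdense \1_(X `&` obox a b).
Proof.
have mO := @measurable_obox.
have mpre (A : set (measurableTypeR R)) : measurable A -> measurable (@snd _ _ @^-1` A : set (E3 R)).
  by move=> mA; rewrite -[X in measurable X]setTI; exact: measurable_snd.
have S3 (A3 : set (measurableTypeR R)) (A12 : set (measurableTypeR R * measurableTypeR R)) :
    measurable A3 -> measurable A12 ->
    tdense \1_(fst @^-1` A12 `&` (snd @^-1` A3 `&` obox a b)).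
  move=> mA3; move: A12; apply: (tdense_dynkin measurable_fst _ _ (@setI_closed_rectangles _ _ _ _)).
  - by apply: measurableI => //; exact: mpre.
  - apply: le_lt_trans (finite_obox a b).
    by apply: le_measure; rewrite ?inE//; apply: measurableI => //; exact: mpre.
  - exact: measurable_prod_measurableType.
  - have := tdense_rectangle a b measurableT measurableT mA3.
    by rewrite !preimage_setT !setTI.
  - move=> _ [A1 mA1 [A2 mA2 <-]].
    have := tdense_rectangle a b mA1 mA2 mA3.
    rewrite (_ : _ `&` _ = fst @^-1` (A1 `*` A2) `&` (snd @^-1` A3 `&` obox a b))//.
    by apply/seteqP; split => x /=; [move=> [? [? []]]|move=> [[? ?] []]].
move=> mX; apply: (@tdense_dynkin _ _ id _ _ _ _ _ (@setI_closed_rectangles _ _ _ _)) mX => //.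
- exact: finite_obox.
- exact: measurable_prod_measurableType.
- exact: tdense_obox.
- move=> _ [A12 mA12 [A3 mA3 <-]]; have := S3 _ _ mA3 mA12.
  rewrite (_ : _ `&` _ = id @^-1` (A12 `*` A3) `&` obox a b)//.
  by apply/seteqP; split => x /=; [move=> [? []]|move=> [[? ?]]].
Qed.

(** Simple functions below [f], cut off to growing boxes so that each level set has finite measure,
    converge pointwise and are dominated by [f] itself. *)
Lemma tdense_ge0 f : sqint mu f -> (forall x, 0 <= f x) -> tdense f.
Proof.
move=> sf f0; have mf := sf.1.
have mF : measurable_fun setT (EFin \o f) by exact/measurable_EFinP.
pose s n := nnsfun_approx measurableT mF n.
pose c n : E3 R := (n%:R, n%:R, n%:R).
pose O n := obox (- n%:R, - n%:R, - n%:R) (c n).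
have F0 x : setT x -> (0 <= (EFin \o f) x)%E by rewrite lee_fin.
have scvg x : s n x @[n --> \oo] --> f x.
  have := cvg_nnsfun_approx measurableT mF F0 (I : setT x).
  exact: fine_cvg.
have sle n x : s n x <= f x.
  have nd : nondecreasing_seq (s ^~ x).
    by move=> p q pq; exact/lefP/nd_nnsfun_approx.
  rewrite -(cvg_lim _ (scvg x))//.
  by apply: nondecreasing_cvgn_le => //; apply/cvg_ex; exists (f x).
have s0 n x : 0 <= s n x by [].
apply: (@tdense_cvg (fun n x => s n x * \1_(O n) x) f f) => //.
- move=> n.
  have [m [r rE]] : exists m (r : 'I_m -> R), forall x,
      s n x = \sum_(i < m) r i * \1_(s n @^-1` [set r i]) x.
    by do 2 eexists; exact: fimfunEord.
  have -> : (fun x => s n x * \1_(O n) x) = (fun x => \sum_(i < m)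
      r i * \1_(s n @^-1` [set r i] `&` O n) x).
    apply/funext => x; rewrite rE mulr_suml; apply: eq_bigr => i _.
    by rewrite -mulrA; congr (_ * _); rewrite indicI.
  apply: tdense_sum => i; apply: tdense_measurable.
  exact: measurable_funPTI.
- move=> x; rewrite -[X in _ --> X]mulr1; apply: cvgM; first exact: scvg.
  apply: cvg_near_cst; near=> n; rewrite indicE mem_set//.
  have h (y : R) : `|y| < n%:R -> - n%:R < y < n%:R by rewrite ltr_norml.
  by split; apply: h; near: n; exact: nbhs_infty_gtr.
- move=> n x; rewrite ger0_norm ?mulr_ge0//.
  rewrite (le_trans _ (sle n x))// indicE.
  by case: (_ \in _); rewrite ?mulr1 ?mulr0.
Unshelve. all: by end_near. Qed.

Theorem test_functions_dense f : sqint mu f -> forall e, 0 < e ->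
  exists phi, [/\ test_function phi, sqint mu phi & nrm mu (f \- phi) <= e].
Proof.
move=> sf e e0.
have sp : sqint mu (fun x => 2^-1 * (`|f x| + f x)).
  by apply: sqintZ; apply: (sqintD (sqint_norm sf) sf).
have sn : sqint mu (fun x => 2^-1 * (`|f x| - f x)).
  by apply: sqintZ; apply: (sqintB (sqint_norm sf) sf).
have : tdense ((fun x => 2^-1 * (`|f x| + f x)) \- (fun x => 2^-1 * (`|f x| - f x))).
  apply: tdenseB; apply: tdense_ge0 => // x; rewrite mulr_ge0//.
    by rewrite -lerBlDr sub0r; have := ler_norm (- f x); rewrite normrN.
  by rewrite subr_ge0 ler_norm.
rewrite (_ : _ \- _ = f); last by apply/funext => x /=; field.
move=> [_ /(_ _ e0)[phi bphi fphi]]; exists phi; split => //.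
  exact: bump_test_function.
exact: bump_test_sqint.
Qed.

End TestFunctionDensity.

(** * Translations and dilations in L^2 *)

Section AffineL2.
Context {R : realType}.
Notation mu := (leb3 R).
Implicit Types (f g : E3 R -> R) (a : R) (b : E3 R).

Lemma sqint_affine a b f : 0 < a -> sqint mu f -> sqint mu (f \o affine3 a b).
Proof.
move=> a0 [mf intf]; split; first exact: (measurableT_comp mf (measurable_affine3 a b)).
exact: (integrable_affine b a0 intf).
Qed.

Lemma ip_affine a b f g : 0 < a -> sqint mu f -> sqint mu g ->
  ip mu (f \o affine3 a b) (g \o affine3 a b) = a ^- 3 * ip mu f g.
Proof.
move=> a0 sf sg; exact: (Rintegral_affine (F := fun x => f x * g x) b a0 (sqint_mul sf sg)).
Qed.

Definition shift3 (i : 'I_3) (s : R) : E3 R -> E3 R := affine3 1 (s *: dir i).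

Lemma shift3E i s x : shift3 i s x = s *: dir i + x.
Proof.
rewrite /shift3 /affine3; case: x => -[x y] z /=.
have lem (e c : R) : 1 * c + s * e = s * e + c by rewrite mul1r addrC.
by congr (_, _, _); exact: lem.
Qed.

Lemma shift30 i x : shift3 i 0 x = x.
Proof. by rewrite shift3E scale0r add0r. Qed.

Lemma shift3D i s t x : shift3 i s (shift3 i t x) = shift3 i (s + t) x.
Proof. by rewrite !shift3E scalerDl addrA. Qed.

Lemma sqint_shift i s f : sqint mu f -> sqint mu (f \o shift3 i s).
Proof. exact: sqint_affine. Qed.

Lemma ip_shift i s f g : sqint mu f -> sqint mu g ->
  ip mu (f \o shift3 i s) (g \o shift3 i s) = ip mu f g.
Proof. by move=> sf sg; rewrite ip_affine// expr1n invr1 mul1r. Qed.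

Lemma nrm_shift i s f : sqint mu f -> nrm mu (f \o shift3 i s) = nrm mu f.
Proof. by move=> sf; rewrite /nrm ip_shift. Qed.

(** Testing against an approximation of [f] itself yields [N ^+ 2 <= C * N] up to an arbitrarily
    small error, [N] being the norm. *)
Lemma nrm_le_dual f C : sqint mu f ->
  (forall phi, test_function phi -> sqint mu phi -> `|ip mu f phi| <= C * nrm mu phi) ->
  0 <= C -> nrm mu f <= C.
Proof.
move=> sf fC C0; set N := nrm mu f; have N0 : 0 <= N := nrm_ge0 _ _.
have key e : 0 < e -> N ^+ 2 <= C * N + e * (C + N).
  move=> e0; have [phi [tphi sphi fphi]] := test_functions_dense sf e0.
  have sB := sqintB sf sphi.
  rewrite /N sqr_nrm (_ : ip mu f f = ip mu f phi + ip mu f (f \- phi)); last first.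
    by rewrite ipBr// addrC subrK.
  have h1 := le_trans (ler_norm _) (fC _ tphi sphi).
  have h2 := le_trans (ler_norm _) (ip_CauchySchwarz sf sB).
  have h3 : nrm mu phi <= N + e.
    rewrite (eq_nrm _ (g := f \- (f \- phi))); last by move=> x /=; rewrite opprB addrC subrK.
    apply: le_trans (nrmD sf (sqintN sB)) _.
    by rewrite nrmN lerD2l.
  rewrite -/N in h2 *; have := ler_wpM2l C0 h3; have := ler_wpM2l N0 fphi; nra.
have [N00|Npos] := eqVneq N 0; first by rewrite N00.
have {}Npos : 0 < N by rewrite lt_neqAle eq_sym Npos.
rewrite leNgt; apply/negP => CN.
(* With this [e] the error is at most half of [N * (N - C)], which contradicts [C < N]. *)
have e0 : 0 < N * (N - C) / (2 * (C + N + 1)).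
  by rewrite divr_gt0 ?mulr_gt0 ?subr_gt0//; lra.
have := key _ e0.
have : N * (N - C) / (2 * (C + N + 1)) * (C + N) <= N * (N - C) / 2.
  rewrite [leLHS](_ : _ = N * (N - C) / 2 * ((C + N) / (C + N + 1))); last by field; lra.
  apply: ler_piMr; first by rewrite divr_ge0 ?mulr_ge0 ?subr_ge0//; lra.
  by rewrite ler_pdivrMr ?mul1r; lra.
by have := mulr_gt0 Npos (_ : 0 < N - C); rewrite subr_gt0 => /(_ CN); nra.
Qed.

End AffineL2.

Section CompactSupport.
Context {R : realType}.
Notation mu := (leb3 R).
Implicit Types (phi : E3 R -> R) (K : set (E3 R)).

Lemma bounded_compact_support (f : E3 R -> R) K : continuous f -> compact K ->
  (forall x, ~ K x -> f x = 0) -> exists2 M : R, 0 <= M & forall x, `|f x| <= M.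
Proof.
move=> cf cK f0.
have /compact_bounded[M [_ /(_ (M + 1))]] : compact (f @` K).
  by apply: continuous_compact => //; exact: continuous_subspaceT.
rewrite ltrDl ltr01 => /(_ isT) fM; exists (Num.max 0 (M + 1)).
  by rewrite le_max lexx.
move=> x; have [Kx|/f0 ->] := pselect (K x); last by rewrite normr0 le_max lexx.
by rewrite le_max; apply/orP; right; apply: fM; exists x.
Qed.

Definition cube (M : R) : set (E3 R) := cbox (- M, - M, - M) (M, M, M).

Lemma measurable_cube M : measurable (cube M).
Proof.
apply: measurableX; first apply: measurableX; exact: measurable_itv.
Qed.

Lemma finite_cube M : (mu (cube M) < +oo)%E.
Proof.
have [C [mC sC fC]] := compact_finite_measure3 (compact_cbox (a := (- M, - M, - M)) (b := (M, M, M))).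
apply: le_lt_trans fC; apply: le_measure; rewrite ?inE//; exact: measurable_cube.
Qed.

Lemma cubeP M x : cube M x <-> [/\ `|x.1.1| <= M, `|x.1.2| <= M & `|x.2| <= M].
Proof.
rewrite !ler_norml; split=> [[[]]|[h1 h2 h3]]; first by rewrite /= !in_itv/= => -> -> ->.
by split; [split|]; rewrite /= in_itv/=.
Qed.

Lemma bounded_support phi : compact (closure [set x | phi x != 0]) ->
  exists2 M : R, 0 <= M & forall x, phi x != 0 -> cube M x.
Proof.
move=> /compact_bounded[M [_ /(_ (M + 1))]]; rewrite ltrDl ltr01 => /(_ isT) KM.
exists (Num.max 0 (M + 1)); first by rewrite le_max lexx.
move=> x px; apply/cubeP.
have : `|x| <= M + 1 by apply: KM; exact: subset_closure.
rewrite prod_normE/= prod_normE/= !ge_max => /andP[/andP[h1 h2] h3].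
by split; rewrite le_max; apply/orP; right.
Qed.

Lemma sqint_cube M : sqint mu \1_(cube M).
Proof. by apply: sqint_indic; [exact: measurable_cube|exact: finite_cube]. Qed.

End CompactSupport.

(** * Translation differences controlled by the weak gradient *)

Section DifferenceBound.
Context {R : realType}.
Notation mu := (leb3 R).
Implicit Types (u phi : E3 R -> R) (x : E3 R).

Lemma test_function_sqint phi : test_function phi -> sqint mu phi.
Proof. by move=> /test_function_L2/sqintP. Qed.

Lemma partial_sqint phi i : test_function phi -> sqint mu (partial i phi).
Proof. by move=> /(partial_test_function_L2 i)/sqintP. Qed.

Lemma is_derive_along phi i x (s : R) : smooth phi ->
  is_derive s (1 : R) (fun h => phi (shift3 i h x)) (partial i phi (shift3 i s x)).
Proof.
move=> sphi; have [_ d] := sphi [::].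
have /derivableP/is_derive_line dl := d i (shift3 i s x).
have h := @is_derive_affine_line _ (fun h : R => phi (h *: dir i + shift3 i s x)) 1 0 _ dl.
have e : (fun h => phi (shift3 i h x)) = (fun h : R => phi (h *: dir i + shift3 i s x)) \o (fun h => h - s).
  by apply/funext => h' /=; rewrite !shift3E addrA -scalerDl subrK.
rewrite e.
have ds : is_derive s (1 : R) (fun h : R => h - s) 1.
  by apply: is_derive_cast (is_deriveB (is_derive_id s 1) (is_derive_cst s s 1)) _; rewrite subr0.
have := @is_derive1_comp _ (fun h : R => phi (h *: dir i + shift3 i s x)) (fun h => h - s) s _ _ _ ds.
rewrite subrr => /(_ _ dl) hh; apply: (is_derive_cast hh).
by rewrite mulr1.
Qed.

Lemma smooth_partial phi i : smooth phi -> smooth (partial i phi).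
Proof. by move=> sphi s; have := sphi (rcons s i); rewrite -cats1 foldr_cat. Qed.

Lemma mvt_along phi i x (M s : R) : smooth phi -> 0 <= s ->
  (forall y, `|partial i phi y| <= M) -> `|phi (shift3 i s x) - phi x| <= M * s.
Proof.
move=> sphi s0 pM.
have [c cs] := @MVT_segment R (fun h => phi (shift3 i h x))
  (fun h => partial i phi (shift3 i h x)) 0 s s0 (fun y _ => is_derive_along i x y sphi)
  (derivable_within_continuous (fun y _ => @ex_derive _ _ _ _ _ _ _ (is_derive_along i x y sphi))).
by rewrite shift30 subr0 => ->; rewrite normrM (ger0_norm s0) ler_wpM2r.
Qed.

Lemma taylor_along phi i x (M s : R) : smooth phi -> 0 <= s ->
  (forall y, `|partial i (partial i phi) y| <= M) ->
  `|phi (shift3 i s x) - phi x - s * partial i phi x| <= M * s ^+ 2.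
Proof.
move=> sphi s0 pM; have M0 : 0 <= M by exact: le_trans (pM x).
have [c] := @MVT_segment R (fun h => phi (shift3 i h x))
  (fun h => partial i phi (shift3 i h x)) 0 s s0 (fun y _ => is_derive_along i x y sphi)
  (derivable_within_continuous (fun y _ => @ex_derive _ _ _ _ _ _ _ (is_derive_along i x y sphi))).
rewrite shift30 subr0 in_itv/= => /andP[c0 cs] ->.
rewrite [_ - s * _](_ : _ = (partial i phi (shift3 i c x) - partial i phi x) * s); last by ring.
rewrite normrM (ger0_norm s0) expr2 mulrA ler_wpM2r//.
apply: le_trans (mvt_along x (smooth_partial i sphi) c0 pM) _.
by rewrite ler_wpM2l.
Qed.

Lemma partial_eq0 phi i x (M : R) : (forall x, phi x != 0 -> cube M x) ->
  ~ cube (M + 1) x -> partial i phi x = 0.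
Proof.
move=> pM nx; have -> : partial i phi x = 'D_(dir i) (cst 0) x; last exact: derive_cst.
apply: near_eq_derive; near=> y; apply/eqP; apply: contrapT => /negP /pM /cubeP[h1 h2 h3].
apply: nx; have : ball x 1 y by near: y; exact: nbhsx_ballx.
move=> [[/= b1 b2] b3]; apply/cubeP.
have tri (p q : R) : ball p 1 q -> `|q| <= M -> `|p| <= M + 1.
  rewrite /ball/= => pq qM; rewrite -[p](subrK q) (le_trans (ler_normD _ _))//.
  by rewrite addrC lerD// ltW.
by split; [exact: tri b1 _|exact: tri b2 _|exact: tri b3 _].
Unshelve. all: by end_near. Qed.

(** The pointwise remainder is at most [M2 * s ^+ 2]. A shift by [s <= 1] moves points by at most 1,
    so the remainder vanishes off the fixed cube of half-side [M + 1], and [C] is the norm of [M2]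
    times its indicator. *)
Lemma taylor_nrm phi i : test_function phi ->
  exists2 C : R, 0 <= C & forall s, 0 <= s <= 1 ->
    nrm mu (fun x => phi (shift3 i s x) - phi x - s * partial i phi x) <= C * s ^+ 2.
Proof.
move=> tphi; have [sphi cphi] := tphi.
have [M M0 pM] := bounded_support cphi.
have cc := compact_cbox (a := (- (M + 1 + 1), - (M + 1 + 1), - (M + 1 + 1))) (b := (M + 1 + 1, M + 1 + 1, M + 1 + 1)).
have sub1 (L L' : R) : L <= L' -> cube L `<=` cube L'.
  by move=> LL x /cubeP[? ? ?]; apply/cubeP; split; apply: le_trans LL.
have p1 x : partial i phi x != 0 -> cube (M + 1) x.
  by apply: contra_neqP => /(partial_eq0 i pM).
have p2 x : ~ cube (M + 1 + 1) x -> partial i (partial i phi) x = 0.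
  exact: partial_eq0 p1.
have [M2 M20 pM2] := bounded_compact_support (sphi [:: i; i]).1 cc p2.
pose h x := M2 * \1_(cube (M + 1)) x : R.
have sh : sqint mu h by exact: sqintZ (sqint_cube _).
exists (nrm mu h) => [|s /andP[s0 s1]]; first exact: nrm_ge0.
have srem : sqint mu (fun x => phi (shift3 i s x) - phi x - s * partial i phi x).
  apply: (sqintB (f := fun x => phi (shift3 i s x) - phi x) (g := fun x => s * partial i phi x)).
    exact: (sqintB (sqint_shift i s (test_function_sqint tphi)) (test_function_sqint tphi)).
  exact/sqintZ/partial_sqint.
rewrite mulrC -[s ^+ 2]ger0_norm ?sqr_ge0// -nrmZ//.
have le (f g : E3 R -> R) : sqint mu f -> sqint mu g -> (forall x, `|f x| <= g x) -> nrm mu f <= nrm mu g.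
  move=> sf sg fg; rewrite /nrm ler_wsqrtr//.
  apply: le_Rintegral => //; [exact: sqint_mul|exact: sqint_mul|move=> x _].
  by rewrite -!expr2 -[leLHS]real_normK ?num_real// lerXn2r ?nnegrE// (le_trans _ (fg x)).
apply: le => //; first exact: sqintZ.
move=> x; have [cx|cx] := pselect (cube (M + 1) x).
  rewrite /h indicE mem_set// mulr1 [leRHS]mulrC; exact: taylor_along.
have z1 : partial i phi x = 0 by exact: partial_eq0 pM cx.
have z2 : phi x = 0.
  apply: contra_notP cx => /eqP/pM; apply: sub1; lra.
have z3 : phi (shift3 i s x) = 0.
  apply: contra_notP cx => /eqP/pM/cubeP; rewrite shift3E /dir => -[h1 h2 h3].
  have tri (p e : R) : 0 <= e <= 1 -> `|s * e + p| <= M -> `|p| <= M + 1.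
    move=> /andP[e0 e1]; have se : 0 <= s * e <= 1 by rewrite mulr_ge0//= mulr_ile1.
    by rewrite !ler_norml => /andP[? ?]; apply/andP; split; lra.
  have b01 (b : bool) : 0 <= (b%:R : R) <= 1 by case: b; rewrite ?lexx ?ler01.
  apply/cubeP; split; [exact: tri (b01 (i == 0 :> nat)) h1|exact: tri (b01 (i == 1 :> nat)) h2|].
  exact: tri (b01 (i == 2 :> nat)) h3.
by rewrite z1 z2 z3 mulr0 !subr0 normr0 /h mulr_ge0 ?sqr_ge0 ?mulr_ge0.
Qed.

(** The definition of the weak gradient moves the linear Taylor term from [psi] to [g i]; only the
    remainder is paired with [u]. *)
Lemma weak_translation_step u (g : 'I_3 -> E3 R -> R) i psi (r C : R) :
  sqint mu u -> sqint mu (g i) -> weak_gradient u g -> test_function psi -> 0 <= r ->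
  nrm mu (fun x => psi (shift3 i r x) - psi x - r * partial i psi x) <= C ->
  `|ip mu u (psi \o shift3 i r) - ip mu u psi| <=
    r * (nrm mu (g i) * nrm mu psi) + nrm mu u * C.
Proof.
move=> su sg wg tpsi r0 hC; have spsi := test_function_sqint tpsi.
have sp := partial_sqint i tpsi.
have sd := sqintB (sqint_shift i r spsi) spsi.
have srem : sqint mu (fun x => psi (shift3 i r x) - psi x - r * partial i psi x).
  exact: (sqintB sd (sqintZ r sp)).
have e : ip mu u (psi \o shift3 i r) - ip mu u psi = - (r * ip mu (g i) psi) +
    ip mu u (fun x => psi (shift3 i r x) - psi x - r * partial i psi x).
  rewrite -(ipBr (sqint_shift i r spsi) spsi su).
  rewrite (ipBr sd (sqintZ r sp) su) (ipZr r sp su).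
  have -> : ip mu u (partial i psi) = - ip mu (g i) psi by exact: wg.
  by rewrite mulrN opprK addrC addrK.
have h1 := ip_CauchySchwarz sg spsi.
have h2 := ip_CauchySchwarz su srem.
have h3 := ler_wpM2l (nrm_ge0 mu u) hC.
have {}h2 := le_trans h2 h3.
rewrite e; move: (ip mu (g i) psi) (ip mu u _) (nrm mu (g i) * _) (nrm mu u * _) h1 h2.
move=> A D X Y h1 h2; rewrite (le_trans (ler_normD _ _))// lerD//.
by rewrite normrN normrM (ger0_norm r0) ler_wpM2l.
Qed.

(* The translation is split into [n] equal steps; the Taylor error, quadratic in
   the length of a step, vanishes as [n] grows. *)
Lemma weak_translation u (g : 'I_3 -> E3 R -> R) i phi (s : R) :
  sqint mu u -> sqint mu (g i) -> weak_gradient u g -> test_function phi -> 0 <= s ->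
  `|ip mu u (phi \o shift3 i s) - ip mu u phi| <= s * (nrm mu (g i) * nrm mu phi).
Proof.
move=> su sg wg tphi s0; have sphi := test_function_sqint tphi.
have [C C0 hC] := taylor_nrm i tphi.
have tshift t : test_function (phi \o shift3 i t).
  by apply: test_function_affine => //; exact: oner_neq0.
have step (t r : R) : 0 <= r <= 1 ->
    `|ip mu u (phi \o shift3 i (t + r)) - ip mu u (phi \o shift3 i t)| <=
    r * (nrm mu (g i) * nrm mu phi) + nrm mu u * (C * r ^+ 2).
  move=> r01; have /andP[r0 r1] := r01.
  have tpsi := tshift t; have [smphi _] := tphi.
  have E : (fun x => (phi \o shift3 i t) (shift3 i r x) - (phi \o shift3 i t) x -
      r * partial i (phi \o shift3 i t) x) =
    (fun x => phi (shift3 i r x) - phi x - r * partial i phi x) \o shift3 i t.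
    apply/funext => x; rewrite partial_affine//= mul1r.
    by rewrite !shift3D [t + r]addrC.
  have srem : sqint mu (fun x => phi (shift3 i r x) - phi x - r * partial i phi x).
    exact: (sqintB (sqintB (sqint_shift i r sphi) sphi) (sqintZ r (partial_sqint i tphi))).
  have hCr : nrm mu (fun x => (phi \o shift3 i t) (shift3 i r x) - (phi \o shift3 i t) x -
      r * partial i (phi \o shift3 i t) x) <= C * r ^+ 2.
    by rewrite E (nrm_shift i t srem); exact: hC.
  have := weak_translation_step su sg wg tpsi r0 hCr.
  rewrite (nrm_shift i t sphi).
  have -> : (phi \o shift3 i t) \o shift3 i r = phi \o shift3 i (t + r).
    by apply/funext => x /=; rewrite shift3D.
  exact.
have steps (r : R) n : 0 <= r <= 1 ->
    `|ip mu u (phi \o shift3 i (r *+ n)) - ip mu u phi| <=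
    (r * (nrm mu (g i) * nrm mu phi) + nrm mu u * (C * r ^+ 2)) *+ n.
  move=> r01; elim: n => [|n ih].
    rewrite mulr0n (_ : phi \o shift3 i 0 = phi) ?subrr ?normr0//.
    by apply/funext => x /=; rewrite shift30.
  have h0 := step (r *+ n) r r01; rewrite -mulrSr in h0; rewrite [leRHS]mulrS.
  rewrite -(subrKA (ip mu u (phi \o shift3 i (r *+ n)))).
  by apply: le_trans (ler_normD _ _) _; apply: lerD; [exact: h0|exact: ih].
apply/ler_addgt0Pr => e e0.
set D := nrm mu u * C * s ^+ 2.
have D0 : 0 <= D by rewrite !mulr_ge0 ?nrm_ge0 ?sqr_ge0.
(* More than [s] steps, so that each has length at most 1, and more than [D / e], so that the
   accumulated error [D / n] is at most [e]. *)
pose n := (Num.truncn (s + D / e)).+1.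
have nb : s + D / e < n%:R by rewrite /n -truncn_le_nat ?leqnn.
have De : 0 <= D / e by rewrite divr_ge0// ltW.
have n0 : 0 < n%:R :> R by rewrite ltr0n.
have r01 : 0 <= s / n%:R <= 1.
  by rewrite divr_ge0 ?ler0n//= ler_pdivrMr// mul1r; lra.
have := steps _ n r01.
have -> : s / n%:R *+ n = s by rewrite -mulr_natr divfK// gt_eqF.
move=> h; apply: le_trans h _.
rewrite -[leLHS]mulr_natr mulrDl mulrAC divfK ?gt_eqF// lerD2l.
rewrite [leLHS](_ : _ = D / n%:R); last by rewrite /D; field; rewrite gt_eqF.
rewrite ler_pdivrMr//.
have : D / e < n%:R by lra.
by rewrite ltr_pdivrMr// => /ltW; rewrite mulrC.
Qed.

(** By duality the translation passes to the test function, where [weak_translation] applies; [u]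
    itself is never regularised. *)
Lemma difference_bound u (g : 'I_3 -> E3 R -> R) i (s : R) :
  sqint mu u -> sqint mu (g i) -> weak_gradient u g -> 0 <= s ->
  nrm mu (u \o shift3 i s \- u) <= s * nrm mu (g i).
Proof.
move=> su sg wg s0; have sus := sqint_shift i s su.
apply: nrm_le_dual; first exact: sqintB.
  move=> phi tphi sphi; rewrite ipBl//.
  have tpsi : test_function (phi \o shift3 i (- s)).
    by apply: test_function_affine => //; exact: oner_neq0.
  have spsi := test_function_sqint tpsi.
  have := weak_translation su sg wg tpsi s0.
  have phiE : phi = (phi \o shift3 i (- s)) \o shift3 i s.
    by apply/funext => x /=; rewrite shift3D addNr shift30.
  rewrite -phiE nrm_shift// distrC mulrA.
  suff -> : ip mu (u \o shift3 i s) phi = ip mu u (phi \o shift3 i (- s)) by [].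
  by rewrite [in LHS]phiE ip_shift.
by rewrite mulr_ge0 ?nrm_ge0.
Qed.

End DifferenceBound.

(** * Strong continuity of dilations on L^2 *)

Section DilationContinuity.
Context {R : realType}.
Notation mu := (leb3 R).
Implicit Types (f phi : E3 R -> R).

Definition dil (l : R) : E3 R -> E3 R := affine3 l (0, 0, 0).

Lemma nrm_dil l f : 0 < l -> sqint mu f ->
  nrm mu (f \o dil l) ^+ 2 = l ^- 3 * nrm mu f ^+ 2.
Proof. by move=> l0 sf; rewrite !sqr_nrm ip_affine. Qed.

(** The constant comes from [l ^- 3 <= 8 <= 3 ^+ 2]. *)
Lemma nrm_dil_le l f : 2^-1 <= l -> sqint mu f -> nrm mu (f \o dil l) <= 3 * nrm mu f.
Proof.
move=> l2 sf; have l0 : 0 < l by lra.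
rewrite -ler_sqr ?nnegrE ?mulr_ge0 ?nrm_ge0// nrm_dil// exprMn.
apply: ler_wpM2r; first exact: sqr_ge0.
rewrite -exprVn; have : l^-1 <= 2 by rewrite invf_ple ?posrE.
have : 0 < l^-1 by rewrite invr_gt0.
move: (l^-1) => m m0 m2; nra.
Qed.

(** For [l >= 1/2] the dilated supports stay in the cube of half-side [2 * M], so dominated
    convergence applies. *)
Lemma test_dilation_cvg phi (l : nat -> R) : test_function phi ->
  (forall n, 2^-1 <= l n) -> l n @[n --> \oo] --> (1 : R) ->
  nrm mu (phi \o dil (l n) \- phi) @[n --> \oo] --> (0 : R).
Proof.
move=> tphi l2 l1; have [sphi cphi] := tphi.
have [M M0 pM] := bounded_support cphi.
have cf : continuous phi := (sphi [::]).1.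
have z0 x : ~ closure [set x | phi x != 0] x -> phi x = 0.
  by apply: contra_notP => /eqP px; exact: subset_closure.
have [K K0 phiK] := bounded_compact_support cf cphi z0.
apply: (@nrm_dominated _ _ _ mu (fun n => phi \o dil (l n)) phi
  (fun x => K * \1_(cube (2 * M)) x) _ _ _ _ _).2.
- move=> n; apply: (measurableT_comp _ (measurable_affine3 _ _)).
  exact: continuous_measurable3.
- exact: continuous_measurable3.
- exact/sqintZ/sqint_cube.
- move=> x; apply: (cvg_comp (fun n => dil (l n) x) phi); last exact: cf.
  have cc (y : R) : l n * y + 0 @[n --> \oo] --> y.
    have h : l n * y + 0 @[n --> \oo] --> 1 * y + 0.
      by apply: cvgD; [apply: cvgM; [exact: l1|exact: cvg_cst]|exact: cvg_cst].
    by move: h; rewrite mul1r addr0.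
  move: x => [[x1 x2] x3].
  exact: (cvg_pair (cvg_pair (cc x1) (cc x2)) (cc x3)).
- move=> n x /=; have [p0|p0] := eqVneq (phi (dil (l n) x)) 0.
    by rewrite p0 normr0 mulr_ge0// indicE.
  rewrite indicE mem_set ?mulr1//; have /cubeP[] := pM _ p0.
  rewrite /= !addr0 => h1 h2 h3; have := l2 n => ln; have ln0 : 0 < l n by lra.
  have sc (y : R) : `|l n * y| <= M -> `|y| <= 2 * M.
    rewrite normrM (gtr0_norm ln0) => h; have := normr_ge0 y; nra.
  by apply/cubeP; split; exact: sc.
Qed.

(** A test function within [e / 8] of [f] is dilated instead; by [nrm_dil_le] the three errors are
    at most [3 * e / 8], [e / 8] and [e / 8]. *)
Lemma dilation_continuous f : sqint mu f -> forall e, 0 < e ->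
  exists2 d, 0 < d & forall l, `|l - 1| < d -> nrm mu (f \o dil l \- f) <= e.
Proof.
move=> sf e e0; have e8 : 0 < e / 8 by rewrite divr_gt0.
have [phi [tphi sphi fphi]] := test_functions_dense sf e8.
have [d d0 dphi] : exists2 d, 0 < d & forall l, `|l - 1| < d ->
    2^-1 <= l /\ nrm mu (phi \o dil l \- phi) <= e / 8.
  apply: contrapT => H.
  (* If every radius [1 / (2 + n)] failed, the failing factors would tend to 1 and contradict the
     sequential statement; the 2 keeps them above 1/2. *)
  have /choice[l lP] : forall n, exists l, `|l - 1| < (2 + n%:R)^-1 /\
      ~ (nrm mu (phi \o dil l \- phi) <= e / 8).
    move=> n; apply: contrapT => Hn; apply: H; exists (2 + n%:R)^-1.
      by rewrite invr_gt0 ltr_wpDr.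
    move=> l ln; split.
      have : (2 + n%:R)^-1 <= 2^-1 :> R by rewrite lef_pV2 ?posrE ?lerDl// ltr_wpDr.
      by move: ln; rewrite ltr_norml => /andP[? ?]; lra.
    by apply: contrapT => nl; apply: Hn; exists l.
  have l2 n : 2^-1 <= l n.
    have [+ _] := lP n.
    have : (2 + n%:R)^-1 <= 2^-1 :> R by rewrite lef_pV2 ?posrE ?lerDl// ltr_wpDr.
    by rewrite ltr_norml => ? /andP[? ?]; lra.
  have l1 : l n @[n --> \oo] --> (1 : R).
    apply/cvgrPdist_lt => r r0; near=> n; rewrite distrC.
    have [+ _] := lP n => /lt_trans; apply.
    have n2 : 0 < 2 + n%:R :> R by rewrite ltr_wpDr.
    rewrite invf_plt ?posrE//.
    apply: (@lt_le_trans _ _ n%:R); last by lra.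
    by near: n; exact: nbhs_infty_gtr.
  have /cvgrPdist_le/(_ _ e8)[N _ /(_ N (leqnn N))] := test_dilation_cvg tphi l2 l1.
  by rewrite sub0r normrN ger0_norm ?nrm_ge0//; case: (lP N).
exists d => // l /dphi[l2 hl]; have l0 : 0 < l by lra.
have sfl : sqint mu (f \o dil l) by exact: sqint_affine.
have spl : sqint mu (phi \o dil l) by exact: sqint_affine.
apply: (le_trans (nrm_trans sfl spl sf)).
have h1 : nrm mu ((f \o dil l) \- (phi \o dil l)) <= 3 * (e / 8).
  apply: le_trans (nrm_dil_le l2 (sqintB sf sphi)) _.
  by rewrite ler_wpM2l.
have h2 := nrm_trans spl sphi sf; rewrite [nrm mu (phi \- f)]nrmBC in h2.
by lra.
Unshelve. all: by end_near. Qed.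

End DilationContinuity.

(** * The Sobolev embedding into L^4 *)

Section BoxAverages.
Context {R : realType}.
Notation mu := (leb3 R).
Implicit Types (u : E3 R -> R) (l x h : E3 R).

(** Half-open, so that halving along an axis is an exact partition. *)
Definition hbox l : set (E3 R) :=
  `[0, l.1.1[%classic `*` `[0, l.1.2[%classic `*` `[0, l.2[%classic.

Definition vol l : R := l.1.1 * l.1.2 * l.2.

Definition pos3 l := [/\ 0 < l.1.1, 0 < l.1.2 & 0 < l.2].

Definition ind1 (l y : R) : R := (0 <= y < l)%R%:R.

Definition boxind l x : R := ind1 l.1.1 x.1.1 * ind1 l.1.2 x.1.2 * ind1 l.2 x.2.

Lemma boxindE l : boxind l = \1_(hbox l).
Proof.
apply/funext => x; rewrite indicE /boxind /ind1 -!natrM !mulnb; congr (_%:R).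
congr nat_of_bool; apply/idP/idP.
  by move=> /andP[/andP[h1 h2] h3]; apply/mem_set; split; [split|]; rewrite /= in_itv.
by move=> /set_mem[[]]; rewrite /= !in_itv/= => -> -> ->.
Qed.

Lemma measurable_hbox l : measurable (hbox l).
Proof. by apply: measurableX; [apply: measurableX|]; exact: measurable_itv. Qed.

Lemma measure_hbox l : pos3 l -> mu (hbox l) = (vol l)%:E.
Proof.
move=> [l1 l2 l3].
pose I (s : R) : set (measurableTypeR R) := `[0, s[%classic.
have E (s : R) : 0 < s -> lebesgue_measure (I s) = s%:E.
  by move=> s0; rewrite lebesgue_measure_itv/= lte_fin s0 sube0.
have m (s : R) : measurable (I s) by exact: measurable_itv.
have -> : mu (hbox l) = (lebesgue_measure (I l.1.1) *
    lebesgue_measure (I l.1.2) * lebesgue_measure (I l.2))%E.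
  rewrite -product_measure1E//.
  exact: (product_measure1E _ _ (measurableX (m l.1.1) (m l.1.2)) (m l.2)).
by rewrite !E.
Qed.

Lemma sqint_boxind l : pos3 l -> sqint mu (boxind l).
Proof.
move=> pl; rewrite boxindE; apply: sqint_indic; first exact: measurable_hbox.
by rewrite measure_hbox// ltry.
Qed.

Lemma boxind_sq l x : boxind l x * boxind l x = boxind l x.
Proof. by rewrite boxindE indicE; case: (_ \in _); rewrite ?mulr1 ?mulr0. Qed.

Lemma ip_boxind l : pos3 l -> ip mu (boxind l) (boxind l) = vol l.
Proof.
move=> pl; rewrite /ip; under eq_Rintegral do rewrite boxind_sq.
rewrite /Rintegral boxindE integral_indic//; last exact: measurable_hbox.
by rewrite setIT measure_hbox.
Qed.

Lemma nrm_boxind l : pos3 l -> nrm mu (boxind l) = Num.sqrt (vol l).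
Proof. by move=> pl; rewrite /nrm ip_boxind. Qed.

Lemma vol_gt0 l : pos3 l -> 0 < vol l.
Proof. by move=> [l1 l2 l3]; rewrite !mulr_gt0. Qed.

(** The mean of [u] over [x + hbox l], written as an L^2 product so that Cauchy-Schwarz bounds
    it. *)
Definition avg u l x : R := (vol l)^-1 * ip mu (u \o affine3 1 x) (boxind l).

Lemma nrm_translate u x : sqint mu u -> nrm mu (u \o affine3 1 x) = nrm mu u.
Proof. by move=> su; rewrite /nrm ip_affine// expr1n invr1 mul1r. Qed.

Lemma avg_le u l x : sqint mu u -> pos3 l ->
  `|avg u l x| <= (Num.sqrt (vol l))^-1 * nrm mu u.
Proof.
move=> su pl; have v0 := vol_gt0 pl.
have sux := sqint_affine x ltr01 su.
rewrite normrM ger0_norm; last by rewrite invr_ge0 ltW.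
have := ip_CauchySchwarz sux (sqint_boxind pl).
rewrite nrm_translate// nrm_boxind// => h.
have iv : 0 <= (vol l)^-1 by rewrite invr_ge0 ltW.
apply: le_trans (ler_wpM2l iv h) _.
rewrite -{1}[vol l]sqr_sqrtr; last exact: ltW.
have s0 : 0 < Num.sqrt (vol l) by rewrite sqrtr_gt0.
by apply: le_of_eq; field; rewrite gt_eqF.
Qed.

Definition half (i : 'I_3) l : E3 R :=
  (if i == 0 :> nat then l.1.1 / 2 else l.1.1,
   if i == 1 :> nat then l.1.2 / 2 else l.1.2,
   if i == 2 :> nat then l.2 / 2 else l.2).

Lemma pos3_half i l : pos3 l -> pos3 (half i l).
Proof.
move=> [l1 l2 l3]; rewrite /half; split => /=; case: ifP => // _;
  by rewrite divr_gt0.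
Qed.

Lemma vol_half i l : vol (half i l) = vol l / 2.
Proof. by case: i => [[|[|[|//]]] ?]; rewrite /vol /half /=; field. Qed.

Lemma ind1_split (l y : R) : 0 < l -> ind1 l y = ind1 (l / 2) y + ind1 (l / 2) (y - l / 2).
Proof.
move=> l0; rewrite /ind1.
have -> : (0 <= y - l / 2 < l / 2) = (l / 2 <= y < l).
  by apply/idP/idP => /andP[? ?]; apply/andP; split; lra.
have [yl|yl] := ltP y (l / 2).
  have -> : y < l by lra.
  by rewrite andbT /= addr0.
have -> : 0 <= y by lra.
  by rewrite andbF add0r.
Qed.

Lemma boxind_split i l x : pos3 l ->
  boxind l x = boxind (half i l) x + boxind (half i l) (shift3 i (- (coord3 i l / 2)) x).
Proof.
move=> [l1 l2 l3].
have c (b : R * R * R) : boxind l b = boxind (half i l) b +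
    boxind (half i l) (b.1.1 - coord3 i l / 2 * (i == 0 :> nat)%:R,
    b.1.2 - coord3 i l / 2 * (i == 1 :> nat)%:R, b.2 - coord3 i l / 2 * (i == 2 :> nat)%:R).
  case: i => [[|[|[|//]]] ?]; rewrite /boxind /half /coord3 /= !mulr0 !mulr1 !subr0.
  - by rewrite (ind1_split _ l1); ring.
  - by rewrite (ind1_split _ l2); ring.
  - by rewrite (ind1_split _ l3); ring.
rewrite (c x); congr (_ + boxind _ _); rewrite shift3E.
have lem (s e y : R) : y - s * e = - s * e + y by ring.
by congr (_, _, _); exact: lem.
Qed.

(** The second half of the box is a translate of the first, so the difference of the two means is
    [(vol l)^-1] times the integral over a half box of a translation difference of [u]. *)
Lemma avg_half u (G : R) i l x : sqint mu u -> pos3 l ->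
  nrm mu (u \o shift3 i (coord3 i l / 2) \- u) <= G ->
  `|avg u l x - avg u (half i l) x| <= (Num.sqrt (vol l))^-1 * G.
Proof.
move=> su pl dG; have v0 := vol_gt0 pl; have ph := pos3_half i pl.
set s := coord3 i l / 2; set a := u \o affine3 1 x.
have sa : sqint mu a := sqint_affine x ltr01 su.
have sas := sqint_shift i s sa.
have sq := sqint_boxind ph.
have e : ip mu a (boxind l) = ip mu a (boxind (half i l)) + ip mu (a \o shift3 i s) (boxind (half i l)).
  have -> : boxind l = boxind (half i l) \+ (boxind (half i l) \o shift3 i (- s)).
    by apply/funext => y; rewrite (boxind_split i y pl).
  have sqs := sqint_shift i (- s) sq.
  rewrite (ipDr sq sqs sa) -(ip_shift i s sa sqs); congr (_ + ip mu _ _).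
  by apply/funext => y /=; rewrite shift3D addNr shift30.
have -> : avg u l x - avg u (half i l) x =
    (vol l)^-1 * ip mu (a \o shift3 i s \- a) (boxind (half i l)).
  rewrite /avg -/a e vol_half (ipBl sas sa sq).
  move: (ip mu a (boxind (half i l))) (ip mu (a \o shift3 i s) (boxind (half i l))) => A B'.
  by field; rewrite gt_eqF.
have aE : a \o shift3 i s \- a = (u \o shift3 i s \- u) \o affine3 1 x.
  apply/funext => y /=; congr (u _ - _).
  by rewrite /a /= !shift3E affine3_dir mul1r.
have h := ip_CauchySchwarz (sqintB sas sa) sq.
have iv : 0 <= (vol l)^-1 by rewrite invr_ge0 ltW.
rewrite normrM (ger0_norm iv); apply: le_trans (ler_wpM2l iv h) _.
rewrite aE nrm_translate; last exact: (sqintB (sqint_shift i s su) su).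
rewrite nrm_boxind// vol_half.
have s0 : 0 < Num.sqrt (vol l) by rewrite sqrtr_gt0.
have hle : Num.sqrt (vol l / 2) <= Num.sqrt (vol l).
  by rewrite ler_wsqrtr//; lra.
apply: (@le_trans _ _ ((vol l)^-1 * (G * Num.sqrt (vol l)))).
  apply: (ler_wpM2l iv); apply: ler_pM => //; exact: nrm_ge0.
rewrite -{1}[vol l]sqr_sqrtr; last exact: ltW.
by apply: le_of_eq; field; rewrite gt_eqF.
Qed.

End BoxAverages.

Lemma dyadic_le {R : realFieldType} (V : R) : 0 < V ->
  [/\ V / 64 <= V / 2, V / 64 <= V / 2 / 2, V / 64 <= V / 2 / 2 / 2,
      V / 64 <= V / 2 / 2 / 2 / 2 & V / 64 <= V / 2 / 2 / 2 / 2 / 2].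
Proof. by move=> V0; split; lra. Qed.

Lemma telescope6 {R : realDomainType} (a0 a1 a2 a3 a4 a5 a6 Y : R) :
  `|a0 - a1| <= 4 * Y -> `|a1 - a2| <= 4 * Y -> `|a2 - a3| <= 4 * Y ->
  `|a3 - a4| <= 4 * Y -> `|a4 - a5| <= 4 * Y -> `|a5 - a6| <= 4 * Y ->
  `|a0 - a6| <= 24 * Y.
Proof.
rewrite !ler_norml => /andP[? ?] /andP[? ?] /andP[? ?] /andP[? ?] /andP[? ?] /andP[? ?].
by apply/andP; split; lra.
Qed.

(* The averages of [u] over cubes of side [4^-k] are at most [24 * 2^k * N] and
   lie within [3 * 4^-k * N] of [u] in L^2, so that [|u| > 48 * 2^k * N] on a
   set of measure at most [64^-k] only: the weak form of the embedding into L^6.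
   Summing over the dyadic levels of [|u|] gives the L^4 bound. *)
Section Sobolev.
Context {R : realType}.
Notation mu := (leb3 R).
Variables (u : E3 R -> R) (g : 'I_3 -> E3 R -> R).
Hypotheses (su : sqint mu u) (sg : forall i, sqint mu (g i)).
Hypothesis wg : weak_gradient u g.
Variable N : R.
Hypotheses (N0 : 0 < N) (uN : nrm mu u <= N) (gN : forall i, nrm mu (g i) <= N).

Let diff i (s : R) : 0 <= s -> nrm mu (u \o shift3 i s \- u) <= s * N.
Proof.
move=> s0; apply: le_trans (difference_bound su (sg i) wg s0) _.
by rewrite ler_wpM2l.
Qed.

(** Powers of 4, so that the square roots of the volumes [64 ^- k] are the rational numbers
    [8 ^- k]. *)
Let L k : R := 4^-1 ^+ k.
Let C k : E3 R := (L k, L k, L k).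

Let L0 k : 0 < L k. Proof. by rewrite exprn_gt0. Qed.

Let pC k : pos3 (C k). Proof. by split; exact: L0. Qed.

(** The translation has length at most [L k / 2] and the square root of the volume is at least
    [L k.+1 * 2 ^- k.+1], that is [8 ^- k.+1]; the quotient is [4 * 2 ^+ k]. *)
Let halves k x l i : pos3 l -> coord3 i l <= L k -> vol (C k.+1) <= vol l ->
  `|avg u l x - avg u (half i l) x| <= 4 * 2 ^+ k * N.
Proof.
move=> pl li vl; have c0 : 0 <= coord3 i l / 2.
  rewrite divr_ge0//; case: pl => l1 l2 l3.
  by rewrite /coord3; case: ifP => _; [|case: ifP => _]; exact: ltW.
have dG : nrm mu (u \o shift3 i (coord3 i l / 2) \- u) <= L k / 2 * N.
  by apply: le_trans (diff i c0) _; apply: ler_wpM2r; [exact: ltW|lra].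
apply: le_trans (avg_half x su pl dG) _.
rewrite mulrA; apply: ler_wpM2r; first exact: ltW.
have sv : L k.+1 * 2 ^- k.+1 <= Num.sqrt (vol l).
  apply: le_trans (ler_wsqrtr vl).
  have eL : L k.+1 = (2 ^- k.+1) ^+ 2.
    by rewrite /L -exprVn -exprM mulnC exprM; congr (_ ^+ _); field.
  rewrite (_ : vol (C k.+1) = (L k.+1 * 2 ^- k.+1) ^+ 2) ?sqrtr_sqr ?ler_norm//.
  by rewrite /vol /C /= !eL; ring.
have p0 : 0 < L k.+1 * 2 ^- k.+1 by rewrite mulr_gt0// invr_gt0 exprn_gt0.
apply: (@le_trans _ _ ((L k.+1 * 2 ^- k.+1)^-1 * (L k / 2))).
  by apply: ler_wpM2r; [rewrite divr_ge0// ltW|rewrite lef_pV2 ?posrE// (lt_le_trans p0)].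
rewrite /L [4^-1 ^+ k.+1]exprS [2 ^+ k.+1]exprS.
have a0 : 4^-1 ^+ k != 0 :> R by rewrite gt_eqF// exprn_gt0.
have b0 : 2 ^+ k != 0 :> R by rewrite gt_eqF// exprn_gt0.
by apply: le_of_eq; field; rewrite a0 b0.
Qed.

Let i0 := Ordinal (isT : 0 < 3)%N.
Let i1 := Ordinal (isT : 1 < 3)%N.
Let i2 := Ordinal (isT : 2 < 3)%N.

(** Six halvings, two for each axis, lead from one cube to the next, and each costs
    [4 * 2 ^+ k * N]. *)
Let avg_step k x : `|avg u (C k) x - avg u (C k.+1) x| <= 24 * 2 ^+ k * N.
Proof.
have e : C k.+1 = half i2 (half i1 (half i0 (half i2 (half i1 (half i0 (C k)))))).
  have e4 : L k.+1 = L k / 2 / 2 by rewrite /L exprS; field.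
  by rewrite /C /half /= e4.
have v : vol (C k.+1) = vol (C k) / 64.
  by rewrite e !vol_half; field.
have v0 := vol_gt0 (pC k).
have Lk := L0 k.
set l0 := C k in e v *; set l1 := half i0 l0 in e; set l2 := half i1 l1 in e.
set l3 := half i2 l2 in e; set l4 := half i0 l3 in e; set l5 := half i1 l4 in e.
have p1 : pos3 l1 by exact: pos3_half (pC k).
have p2 := pos3_half i1 p1 : pos3 l2.
have p3 := pos3_half i2 p2 : pos3 l3.
have p4 := pos3_half i0 p3 : pos3 l4.
have p5 := pos3_half i1 p4 : pos3 l5.
have h0 := @halves k x l0 i0 (pC k); have h1 := @halves k x l1 i1 p1.
have h2 := @halves k x l2 i2 p2; have h3 := @halves k x l3 i0 p3.
have h4 := @halves k x l4 i1 p4; have h5 := @halves k x l5 i2 p5.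
have [w1 w2 w3 w4 w5] := dyadic_le (v0 : 0 < vol l0).
have d2 : L k / 2 <= L k by rewrite ler_pdivrMr// ler_peMr ?ltW// ltr1n.
have -> : 24 * 2 ^+ k * N = 24 * (2 ^+ k * N) by rewrite mulrA.
rewrite -!mulrA in h0 h1 h2 h3 h4 h5; rewrite e.
apply: (telescope6 (h0 _ _) (h1 _ _) (h2 _ _) (h3 _ _) (h4 _ _) (h5 _ _)) => //.
- by rewrite v ler_pdivrMr// ler_peMr ?ltW// ltr1n.
- by rewrite v /l1 vol_half.
- by rewrite v /l2 /l1 !vol_half.
- by rewrite v /l3 /l2 /l1 !vol_half.
- by rewrite v /l4 /l3 /l2 /l1 !vol_half.
- by rewrite v /l5 /l4 /l3 /l2 /l1 !vol_half.
Qed.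

Let avg_bound k x : `|avg u (C k) x| <= 24 * 2 ^+ k * N.
Proof.
(* The geometric sum [1 + 24 * (2 ^+ k - 1)], where the 1 bounds the mean over the unit cube. *)
suff : `|avg u (C k) x| <= (24 * 2 ^+ k - 23) * N.
  by move=> /le_trans; apply; apply: ler_wpM2r; [exact: ltW|lra].
elim: k => [|k ih].
  apply: le_trans (avg_le x su (pC 0)) _.
  have -> : vol (C 0) = 1 by rewrite /vol /C /L /= !expr0 !mulr1.
  have -> : (24 * 2 ^+ 0 - 23) * N = N by rewrite expr0; ring.
  by rewrite sqrtr1 invr1 mul1r.
move: ih (avg_step k x); rewrite exprS.
move: (avg u (C k) x) (avg u (C k.+1) x) => A B h1 h2.
have h3 : `|B| <= `|A| + `|A - B| by rewrite -{1}[B](subKr A); exact: ler_normB.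
apply: (le_trans h3); move: (`|A|) (`|A - B|) (2 ^+ k) h1 h2 => a b X h1 h2; lra.
Qed.

Let affine3_shifts (h x : E3 R) : affine3 1 h x = shift3 i0 h.1.1 (shift3 i1 h.1.2 (shift3 i2 h.2 x)).
Proof.
rewrite !shift3E /dir /affine3; case: x => -[x y] z; case: h => -[a b] c /=.
have e1 (p q r t : R) : 1 * t + p = p * 1 + (q * 0 + (r * 0 + t)) by ring.
have e2 (p q r t : R) : 1 * t + q = p * 0 + (q * 1 + (r * 0 + t)) by ring.
have e3 (p q r t : R) : 1 * t + r = p * 0 + (q * 0 + (r * 1 + t)) by ring.
by congr (_, _, _); [exact: (e1 a b c x)|exact: (e2 a b c y)|exact: (e3 a b c z)].
Qed.

Let diff3 k (h : E3 R) : hbox (C k) h -> nrm mu (u \o affine3 1 h \- u) <= 3 * L k * N.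
Proof.
move=> [[]]; rewrite /= !in_itv/= => /andP[a0 a1] /andP[b0 b1] /andP[c0 c1].
have s2 := sqint_shift i2 h.2 su.
have s1 := sqint_shift i1 h.1.2 su.
have s0 := sqint_shift i0 h.1.1 su.
have d2 := diff i2 c0; have d1 := diff i1 b0; have d0 := diff i0 a0.
have s21 := sqint_shift i2 h.2 s1.
have s210 := sqint_shift i2 h.2 (sqint_shift i1 h.1.2 s0).
have -> : u \o affine3 1 h = ((u \o shift3 i0 h.1.1) \o shift3 i1 h.1.2) \o shift3 i2 h.2.
  by apply/funext => x /=; rewrite affine3_shifts.
apply: le_trans (nrm_trans s210 s21 su) _.
have e1 : nrm mu ((((u \o shift3 i0 h.1.1) \o shift3 i1 h.1.2) \o shift3 i2 h.2) \-
    ((u \o shift3 i1 h.1.2) \o shift3 i2 h.2)) <= h.1.1 * N.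
  have -> : (((u \o shift3 i0 h.1.1) \o shift3 i1 h.1.2) \o shift3 i2 h.2) \-
    ((u \o shift3 i1 h.1.2) \o shift3 i2 h.2) =
    ((u \o shift3 i0 h.1.1 \- u) \o shift3 i1 h.1.2) \o shift3 i2 h.2 by [].
  rewrite nrm_shift; last exact: (sqint_shift i1 h.1.2 (sqintB s0 su)).
  by rewrite nrm_shift//; exact: (sqintB s0 su).
have e2 := nrm_trans s21 s2 su.
have e3 : nrm mu (((u \o shift3 i1 h.1.2) \o shift3 i2 h.2) \- (u \o shift3 i2 h.2)) <= h.1.2 * N.
  have -> : ((u \o shift3 i1 h.1.2) \o shift3 i2 h.2) \- (u \o shift3 i2 h.2) =
    (u \o shift3 i1 h.1.2 \- u) \o shift3 i2 h.2 by [].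
  by rewrite nrm_shift//; exact: (sqintB s1 su).
have m1 : h.1.1 * N <= L k * N by rewrite ler_wpM2r ?ltW.
have m2 : h.1.2 * N <= L k * N by rewrite ler_wpM2r ?ltW.
have m3 : h.2 * N <= L k * N by rewrite ler_wpM2r ?ltW.
move: e1 e2 e3 d2; move: (nrm _ _) (nrm _ _) (nrm _ _) (nrm _ _) => *; lra.
Qed.

Let F k (p : E3 R * E3 R) : R := (u (affine3 1 p.2 p.1) - u p.1) ^+ 2 * boxind (C k) p.2.

Let measurable_F k : measurable_fun setT (F k).
Proof.
have mu1 : measurable_fun setT u := su.1.
have m1 : measurable_fun setT (fun p : E3 R * E3 R => affine3 1 p.2 p.1).
  have mp (s : E3 R -> R) : measurable_fun setT (s : E3 R -> measurableTypeR R) ->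
      measurable_fun setT (fun p : E3 R * E3 R => 1 * s p.1 + s p.2 : measurableTypeR R).
    move=> ms; apply: measurable_funD.
      by apply: measurable_funM => //; exact: (measurableT_comp ms measurable_fst).
    exact: (measurableT_comp ms measurable_snd).
  apply: measurable_fun_pair; first apply: measurable_fun_pair.
  - exact: (mp (fun x => x.1.1) (measurableT_comp measurable_fst measurable_fst)).
  - exact: (mp (fun x => x.1.2) (measurableT_comp measurable_snd measurable_fst)).
  - exact: (mp (fun x => x.2) measurable_snd).
apply: measurable_funM.
  apply: measurable_funX; apply: measurable_funB.
    exact: (measurableT_comp mu1 m1).
  exact: (measurableT_comp mu1 measurable_fst).
have mb : measurable_fun setT (boxind (C k)) := (sqint_boxind (pC k)).1.
exact: (measurableT_comp mb measurable_snd).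
Qed.

Let F_ge0 k p : 0 <= F k p.
Proof. by rewrite mulr_ge0 ?sqr_ge0// boxindE indicE. Qed.

Let F_slice k (h : E3 R) :
  (\int[mu]_x (F k (x, h))%:E <= ((3 * L k * N) ^+ 2 * boxind (C k) h)%:E)%E.
Proof.
have sd : sqint mu (u \o affine3 1 h \- u) := sqintB (sqint_affine h ltr01 su) su.
have [hC|hC] := pselect (hbox (C k) h).
  rewrite /F boxindE indicE mem_set//=.
  under eq_integral do rewrite mulr1.
  have -> : (\int[mu]_x ((u (affine3 1 h x) - u x) ^+ 2)%:E =
    (nrm mu (u \o affine3 1 h \- u) ^+ 2)%:E)%E by rewrite (nrmE sd).
  rewrite mulr1 lee_fin lerXn2r ?nnegrE ?nrm_ge0 ?diff3//.
  by rewrite !mulr_ge0// ltW.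
rewrite /F boxindE indicE memNset//= mulr0.
under eq_integral do rewrite mulr0.
by rewrite integral0.
Qed.

Let affine3C (x h : E3 R) : affine3 1 x h = affine3 1 h x.
Proof.
have e (p q : R) : 1 * p + q = 1 * q + p by rewrite !mul1r addrC.
by rewrite /affine3; congr (_, _, _); exact: e.
Qed.

(** Jensen's inequality, from Cauchy-Schwarz. The indicator multiplies both [a] and the constant
    [u x], since constants are not square integrable on the whole space. *)
Let avg_sq k x : (((u x - avg u (C k) x) ^+ 2)%:E <=
  ((vol (C k))^-1)%:E * \int[mu]_h (F k (x, h))%:E)%E.
Proof.
set q := boxind (C k); have sq : sqint mu q := sqint_boxind (pC k).
have V0 := vol_gt0 (pC k).
pose a := u \o affine3 1 x; have sa : sqint mu a := sqint_affine x ltr01 su.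
pose aq h := a h * q h; pose b h := u x * q h.
have q1 h : `|q h| <= 1 by rewrite /q boxindE indicE; case: (_ \in _); rewrite ?normr1 ?normr0.
have saq : sqint mu aq.
  apply: (@sqint_le _ _ _ _ aq a) => //; first exact: (measurable_funM sa.1 sq.1).
  by move=> h; rewrite normrM ler_piMr.
have sb : sqint mu b by exact: sqintZ.
have sw := sqintB saq sb.
have e1 : ip mu aq q = ip mu a q.
  by apply: eq_Rintegral => h _; rewrite /aq -mulrA boxind_sq.
have e2 : ip mu (aq \- b) q = ip mu a q - u x * vol (C k).
  by rewrite (ipBl saq sb sq) e1 (ipZl (u x) sq sq) ip_boxind.
have cs := ip_CauchySchwarz sw sq.
have -> : (\int[mu]_h (F k (x, h))%:E = (nrm mu (aq \- b) ^+ 2)%:E)%E.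
  rewrite (nrmE sw); apply: eq_integral => h _; congr EFin.
  rewrite /F /= affine3C /aq /b /a /= -mulrBl exprMn; congr (_ * _).
  by rewrite expr2 boxind_sq.
rewrite -EFinM lee_fin.
have -> : u x - avg u (C k) x = - ((vol (C k))^-1 * ip mu (aq \- b) q).
  rewrite e2 /avg -/a -/q; move: (ip mu a q) => A; field; rewrite gt_eqF//.
rewrite sqrrN exprMn nrm_boxind// in cs *.
have {}cs : ip mu (aq \- b) q ^+ 2 <= nrm mu (aq \- b) ^+ 2 * vol (C k).
  rewrite -[X in _ * X]sqr_sqrtr; last exact: ltW.
  rewrite -exprMn -[leLHS]real_normK ?num_real//.
  by rewrite lerXn2r ?nnegrE ?mulr_ge0 ?nrm_ge0 ?sqrtr_ge0.
apply: le_trans (ler_wpM2l (sqr_ge0 _) cs) _.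
by apply: le_of_eq; field; rewrite gt_eqF.
Qed.

Let S k : set (E3 R) := [set x | 48 * 2 ^+ k * N < `|u x|].

Let measurable_S k : measurable (S k).
Proof.
have mn : measurable_fun setT (fun x => `|u x|) by apply: measurableT_comp => //; exact: su.1.
rewrite (_ : S k = (fun x => `|u x|) @^-1` `]48 * 2 ^+ k * N, +oo[%classic).
  by rewrite -[X in measurable X]setTI; apply: mn => //; exact: measurable_itv.
by apply/seteqP; split => x /=; rewrite /S /= in_itv/= andbT.
Qed.

(** Chebyshev: on [S k] the function exceeds twice the bound [T] on its means, hence differs from
    its mean by at least [T]. Tonelli and [F_slice] bound the squared L^2 distance to the means by
    [(3 * L k * N) ^+ 2], and dividing by [T ^+ 2] leaves [64 ^- k / 64]. *)
Let weak_bound k : (mu (S k) <= (64^-1 ^+ k)%:E)%E.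
Proof.
have V0 := vol_gt0 (pC k).
have iv0 : (0 <= ((vol (C k))^-1)%:E)%E by rewrite lee_fin invr_ge0 ltW.
set T := 24 * 2 ^+ k * N; have T0 : 0 < T by rewrite !mulr_gt0// exprn_gt0.
pose Fe (p : E3 R * E3 R) := (F k p)%:E.
have mFe : measurable_fun setT Fe by apply/measurable_EFinP; exact: measurable_F.
have Fe0 p : (0 <= Fe p)%E by rewrite lee_fin F_ge0.
have mI : measurable_fun setT (fun x => \int[sleb3 R]_h Fe (x, h))%E.
  exact: measurable_fun_fubini_tonelli_F.
have mG : measurable_fun setT (fun h => \int[sleb3 R]_x Fe (x, h))%E.
  exact: measurable_fun_fubini_tonelli_G.
have h1 x : ((T ^+ 2 * \1_(S k) x)%:E <= ((vol (C k))^-1)%:E * \int[sleb3 R]_h Fe (x, h))%E.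
  have [Sx|Sx] := pselect (S k x); last first.
    by rewrite indicE memNset// mulr0 mule_ge0// integral_ge0.
  apply: le_trans (avg_sq k x); rewrite indicE mem_set//= mulr1 lee_fin.
  rewrite -[leRHS]real_normK ?num_real//; apply: lerXn2r; rewrite ?nnegrE ?(ltW T0)//.
  have := avg_bound k x; have := Sx; rewrite /S /= -/T.
  have := ler_norm (`|u x|); have := lerB_dist (u x) (avg u (C k) x).
  rewrite -[48](_ : 2 * 24 = 48) -?natrM// -!mulrA -/T.
  by move: (`|u x - _|) => D; rewrite /T -!mulrA; lra.
have h2 : (\int[mu]_x (T ^+ 2 * \1_(S k) x)%:E <=
    \int[mu]_x (((vol (C k))^-1)%:E * \int[sleb3 R]_h Fe (x, h)))%E.
  apply: ge0_le_integral => //.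
  - by move=> x _; rewrite lee_fin mulr_ge0 ?sqr_ge0// indicE.
  - by apply/measurable_EFinP/measurable_funM => //; exact: measurable_indic.
  - exact: measurable_funeM.
move: h2; rewrite ge0_integralZl//; last by move=> x _; exact: integral_ge0.
have -> : (\int[mu]_x \int[sleb3 R]_h Fe (x, h) = \int[mu]_h \int[mu]_x Fe (x, h))%E.
  exact: (@fubini_tonelli _ _ _ _ _ (sleb3 R) (sleb3 R) Fe mFe Fe0).
have h3 : (\int[mu]_h \int[mu]_x Fe (x, h) <= \int[mu]_h ((3 * L k * N) ^+ 2 * boxind (C k) h)%:E)%E.
  apply: ge0_le_integral => //.
  - by move=> h _; exact: integral_ge0.
  - by apply/measurable_EFinP/measurable_funM => //; exact: (sqint_boxind (pC k)).1.
  - by move=> h _; exact: F_slice.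
have int_indic (c : R) (A : set (E3 R)) : 0 <= c -> measurable A ->
    (\int[mu]_x (c * \1_A x)%:E = c%:E * mu A)%E.
  move=> c0 mA; under eq_integral do rewrite EFinM.
  rewrite ge0_integralZl//; last by apply/measurable_EFinP; exact: measurable_indic.
  by rewrite integral_indic// setIT.
move: h3; rewrite boxindE int_indic ?sqr_ge0//; last exact: measurable_hbox.
rewrite measure_hbox// => h3; rewrite int_indic ?sqr_ge0// => h4.
have {}h4 := le_trans h4 (lee_wpmul2l iv0 h3).
have {h4} : ((T ^+ 2)%:E * mu (S k) <= ((3 * L k * N) ^+ 2)%:E)%E.
  apply: le_trans h4 _.
  rewrite -!EFinM lee_fin mulrCA mulVf ?mulr1//.
  by rewrite gt_eqF.
rewrite -lee_pdivlMl ?exprn_gt0// => /le_trans; apply.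
rewrite -EFinM lee_fin /T /L !exprMn.
have p2 : 2 ^+ k != 0 :> R by rewrite gt_eqF// exprn_gt0.
have e4 : 4^-1 ^+ k = (2 ^+ k) ^- 2 :> R.
  by rewrite -exprM mulnC exprM exprVn; congr (_^-1); congr (_ ^+ _); ring.
have e64 : 64^-1 ^+ k = (2 ^+ k) ^- 6 :> R.
  by rewrite -exprM mulnC exprM exprVn; congr (_^-1); congr (_ ^+ _); ring.
rewrite e4 e64 [leLHS](_ : _ = 64^-1 * (2 ^+ k) ^- 6); last first.
  by field; rewrite p2 gt_eqF.
rewrite ler_piMl ?invr_ge0 ?exprn_ge0//; lra.
Qed.

(** The first term comes from [|u| <= 48 * N], where [u ^+ 4 <= (48 * N) ^+ 2 * u ^+ 2]. The level
    between [48 * 2 ^+ k * N] and twice that contributes at most [96 ^+ 4 * 4 ^- k * N ^+ 4], and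
    the factor 2 exceeds the sum 4/3 of the powers of 1/4. *)
Definition sobolev_const : R := 48 ^+ 2 + 2 * 96 ^+ 4.

Let G K x : R := (48 * N) ^+ 2 * u x ^+ 2 + \sum_(k < K) (96 * 2 ^+ k * N) ^+ 4 * \1_(S k) x.

Let G_ge0 K x : 0 <= G K x.
Proof.
apply: addr_ge0; first by rewrite mulr_ge0 ?sqr_ge0.
by apply: sumr_ge0 => k _; rewrite mulr_ge0 ?indicE// exprn_even_ge0.
Qed.

Let measurable_G K : measurable_fun setT (G K).
Proof.
apply: measurable_funD.
  by apply: measurable_funM => //; apply: measurable_funX; exact: su.1.
elim: K => [|K ih].
  by under eq_fun do rewrite big_ord0; exact: measurable_cst.
under eq_fun do rewrite big_ord_recr/=; apply: measurable_funD => //.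
by apply: measurable_funM => //; exact: measurable_indic.
Qed.

Let int_G K : (\int[mu]_x (G K x)%:E <=
  ((48 ^+ 2 + 2 * 96 ^+ 4 * (1 - 4^-1 ^+ K)) * N ^+ 4)%:E)%E.
Proof.
elim: K => [|K ih].
  rewrite expr0 subrr mulr0 addr0 /G.
  under eq_integral do rewrite big_ord0 addr0 EFinM.
  rewrite ge0_integralZl//; last 3 first.
  - by apply/measurable_EFinP; apply: measurable_funX; exact: su.1.
  - by move=> x _; rewrite lee_fin sqr_ge0.
  - by rewrite lee_fin sqr_ge0.
  rewrite -nrmE// -EFinM lee_fin.
  have := nrm_ge0 mu u => n0.
  have : nrm mu u ^+ 2 <= N ^+ 2 by rewrite lerXn2r ?nnegrE// ltW.
  rewrite exprMn -mulrA => h; rewrite ler_wpM2l ?sqr_ge0//.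
  by rewrite [N ^+ 4](_ : _ = N ^+ 2 * N ^+ 2) ?ler_wpM2l ?sqr_ge0//; ring.
have -> : (\int[mu]_x (G K.+1 x)%:E = \int[mu]_x ((G K x)%:E +
    ((96 * 2 ^+ K * N) ^+ 4 * \1_(S K) x)%:E))%E.
  by apply: eq_integral => x _; rewrite /G big_ord_recr/= addrA EFinD.
rewrite ge0_integralD//; last 4 first.
- by move=> x _; rewrite lee_fin G_ge0.
- exact/measurable_EFinP.
- by move=> x _; rewrite lee_fin mulr_ge0 ?indicE// exprn_even_ge0.
- by apply/measurable_EFinP/measurable_funM => //; exact: measurable_indic.
have c0 : 0 <= (96 * 2 ^+ K * N) ^+ 4 by rewrite exprn_even_ge0.
have -> : (\int[mu]_x ((96 * 2 ^+ K * N) ^+ 4 * \1_(S K) x)%:E =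
    ((96 * 2 ^+ K * N) ^+ 4)%:E * mu (S K))%E.
  under eq_integral do rewrite EFinM.
  rewrite ge0_integralZl//; last by apply/measurable_EFinP; exact: measurable_indic.
  by rewrite integral_indic// setIT.
apply: le_trans (leeD ih (lee_wpmul2l _ (weak_bound K))) _; first by rewrite lee_fin.
rewrite -EFinM -EFinD lee_fin !exprMn.
have p2 : 2 ^+ K != 0 :> R by rewrite gt_eqF// exprn_gt0.
have e4 : 4^-1 ^+ K = (2 ^+ K) ^- 2 :> R.
  by rewrite -exprM mulnC exprM exprVn; congr (_^-1); congr (_ ^+ _); ring.
have e64 : 64^-1 ^+ K = (2 ^+ K) ^- 6 :> R.
  by rewrite -exprM mulnC exprM exprVn; congr (_^-1); congr (_ ^+ _); ring.
rewrite [4^-1 ^+ K.+1]exprS e4 e64.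
rewrite (_ : 96 ^+ 4 * (2 ^+ K) ^+ 4 * N ^+ 4 * (2 ^+ K) ^- 6 = 96 ^+ 4 * (2 ^+ K) ^- 2 * N ^+ 4); last by field.
have : 0 <= 96 ^+ 4 * ((2 ^+ K) ^- 2 * N ^+ 4) :> R.
  by rewrite !mulr_ge0 ?exprn_ge0// ?invr_ge0 ?exprn_ge0// ltW.
rewrite -mulrDl -subr_ge0 -mulrBl; move: (2 ^+ K) p2 => X p2 h.
have h' : 0 <= 2^-1 * (96 ^+ 4 * (X ^- 2 * N ^+ 4)) by rewrite mulr_ge0.
by apply: (le_trans h'); apply: le_of_eq; field.
Qed.

(** Cut off at height [48 * 2 ^+ K * N], the fourth power lies below [G K], by induction on the
    levels; Fatou removes the cut-off. *)
Lemma sobolev_L4 : (\int[mu]_x (u x ^+ 4)%:E <= (sobolev_const * N ^+ 4)%:E)%E.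
Proof.
have mU : measurable_fun setT u := su.1.
have N4 : 0 <= N ^+ 4 by rewrite exprn_even_ge0.
pose f K x := u x ^+ 4 * \1_(~` S K) x.
have f_le K x : f K x <= G K x.
  elim: K => [|K ih].
    rewrite /f /G big_ord0 addr0; have [Sx|Sx] := pselect (S 0 x).
      have nS : ~ (~` S 0) x by move=> h; exact: h Sx.
      by rewrite indicE (memNset nS) mulr0 mulr_ge0 ?sqr_ge0.
    rewrite indicE mem_set//= mulr1 [u x ^+ 4](_ : _ = u x ^+ 2 * u x ^+ 2); last by ring.
    apply: ler_wpM2r; first exact: sqr_ge0.
    move/negP : Sx; rewrite -leNgt expr0 mulr1 => h.
    by rewrite -[leLHS]real_normK ?num_real// lerXn2r ?nnegrE// mulr_ge0// ltW.
  have [SK|SK] := pselect (S K x); last first.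
    have GK : G K x <= G K.+1 x.
      by rewrite /G big_ord_recr/= lerD2l lerDl mulr_ge0 ?indicE// exprn_even_ge0.
    apply: le_trans GK; apply: le_trans ih; rewrite /f !indicE [x \in ~` S K]mem_set//.
    by apply: ler_wpM2l; [rewrite exprn_even_ge0|case: (_ \in _)].
  rewrite /G big_ord_recr/= [\1_(S K) x]indicE (mem_set SK) mulr1 /f.
  rewrite (le_trans _ (_ : (96 * 2 ^+ K * N) ^+ 4 <= _))//; last first.
    rewrite addrA lerDr; exact: G_ge0.
  have [SK1|SK1] := pselect (S K.+1 x).
    have nS : ~ (~` S K.+1) x by move=> h; exact: h SK1.
    by rewrite indicE (memNset nS) mulr0 exprn_even_ge0.
  rewrite indicE mem_set//= mulr1; move/negP : SK1; rewrite -leNgt exprS => h.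
  rewrite (_ : u x ^+ 4 = `|u x| ^+ 4); last by rewrite -normrX ger0_norm// exprn_even_ge0.
  rewrite lerXn2r ?nnegrE//; first by rewrite !mulr_ge0 ?exprn_ge0// ltW.
  apply: (le_trans h); apply: le_of_eq; ring.
have mf K : measurable_fun setT (f K).
  apply: measurable_funM; first exact: measurable_funX.
  by apply: measurable_indic; exact: measurableC.
apply: (@fatou_bound _ _ _ mu f) => //.
- by move=> K x; rewrite mulr_ge0 ?indicE// exprn_even_ge0.
- exact: measurable_funX.
- apply: aeW => x; apply: cvg_near_cst; near=> K.
  rewrite /f indicE mem_set ?mulr1//= => SK.
  have : 48 * 2 ^+ K * N < 48 * (`|u x| / (48 * N) + 1) * N.
    apply: lt_le_trans SK _; rewrite [leRHS](_ : _ = `|u x| + 48 * N); last by field; rewrite gt_eqF.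
    by rewrite lerDl mulr_ge0// ltW.
  rewrite ltr_pM2r// ltr_pM2l//; apply/negP; rewrite -leNgt.
  apply: (@le_trans _ _ K%:R); last first.
    by rewrite -natrX ler_nat ltnW// ltn_expl.
  near: K; exact: nbhs_infty_ger.
- move=> K; apply: (@le_trans _ _ (\int[mu]_x (G K x)%:E)%E).
    apply: ge0_le_integral => //.
    + by move=> x _; rewrite lee_fin mulr_ge0 ?indicE// exprn_even_ge0.
    + exact/measurable_EFinP.
    + exact/measurable_EFinP.
    + by move=> x _; rewrite lee_fin.
  apply: le_trans (int_G K) _; rewrite lee_fin /sobolev_const ler_wpM2r//.
  by rewrite lerD2l ler_piMr.
Unshelve. all: by end_near. Qed.

End Sobolev.

(** * The forms of the energy on the radial Sobolev space *)

Section RadialSobolevForms.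
Context {R : realType}.
Notation mu := (leb3 R).
Notation V := (H1rad R).
Implicit Types (u v w x y : V) (a : R).

Lemma sqint_fun w : sqint mu (H1fun w).
Proof. by apply/sqintP; exact: Lfun2_val. Qed.

Lemma sqint_grad w i : sqint mu (H1grad w i).
Proof. by apply/sqintP; exact: Lfun2_val. Qed.

Lemma H1_weak_gradient w : weak_gradient (H1fun w) (H1grad w).
Proof. by have /asboolP[] := valP (repr w). Qed.

Lemma H1_radial w : radial (H1fun w).
Proof. by have /asboolP[] := valP (repr w). Qed.

Lemma L2_linearE a (f g : L2 R) (t : E3 R) : (a *: f + g : L2 R) t = a * f t + g t.
Proof. by []. Qed.

Lemma L2_subE (f g : L2 R) (t : E3 R) : (f - g : L2 R) t = f t - g t.
Proof. by []. Qed.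

Lemma null_ae (p q : preH1rad R) : p - q \in @Defs.null_fun R ->
  {ae mu, forall t, (val p).1 t = (val q).1 t} /\
  forall i, {ae mu, forall t, (val p).2 i t = (val q).2 i t}.
Proof.
move=> /asboolP; rewrite raddfB => -[h1 h2]; split.
  by apply: filterS h1 => x /eqP; rewrite L2_subE subr_eq0 => /eqP.
by move=> i; apply: filterS (h2 i) => x /eqP; rewrite !ffunE L2_subE subr_eq0 => /eqP.
Qed.

Lemma H1_make (u : E3 R -> R) (g : 'I_3 -> E3 R -> R) :
  sqint mu u -> (forall i, sqint mu (g i)) -> weak_gradient u g -> radial u ->
  exists w : V, {ae mu, forall t, H1fun w t = u t} /\
    forall i, {ae mu, forall t, H1grad w i t = g i t}.
Proof.
move=> su sg wg ru.
have u2 : u \in Lfun mu 2%:E by apply/sqintP.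
have g2 i : g i \in Lfun mu 2%:E by apply/sqintP.
pose U : L2 R := Lfun_Sub (lee1n 2) u2.
pose G : {ffun 'I_3 -> L2 R} := [ffun i => Lfun_Sub (lee1n 2) (g2 i)].
have UG : (U, G) \in @sobolev_radial R.
  apply/asboolP; split => //= i phi tphi; rewrite /= ffunE.
  exact: wg.
pose p := PreH1rad UG.
have [h1 h2] := null_ae (repr_null p).
exists (\pi_(H1rad R)%qT p); split; first exact: h1.
by move=> i; apply: filterS (h2 i) => x; rewrite /= ffunE.
Qed.

Lemma repr_linear a x y : repr (a *: x + y : V) - (a *: repr x + repr y) \in @Defs.null_fun R.
Proof. by apply/H1radP; rewrite reprK piD pi_scale !reprK. Qed.

Lemma val_linear a (p q : preH1rad R) : val (a *: p + q) = a *: val p + val q.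
Proof. by []. Qed.

Lemma H1fun_linear a x y :
  {ae mu, forall t, H1fun (a *: x + y) t = a * H1fun x t + H1fun y t}.
Proof.
have [h _] := null_ae (repr_linear a x y).
by apply: filterS h => t h; rewrite {1}/H1fun h val_linear [LHS]L2_linearE.
Qed.

Lemma H1grad_linear a x y i :
  {ae mu, forall t, H1grad (a *: x + y) i t = a * H1grad x i t + H1grad y i t}.
Proof.
have [_ /(_ i) h] := null_ae (repr_linear a x y).
by apply: filterS h => t h; rewrite {1}/H1grad h val_linear /= !ffunE [LHS]L2_linearE.
Qed.

Definition mdot x y : R := ip mu (H1fun x) (H1fun y).

Definition kdot x y : R := \sum_(i < 3) ip mu (H1grad x i) (H1grad y i).

Lemma H1dot_split x y : H1dot x y = mdot x y + kdot x y.
Proof. by []. Qed.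

Lemma ip_linear_ae a (f g h k : E3 R -> R) : sqint mu f -> sqint mu g -> sqint mu h ->
  sqint mu k -> {ae mu, forall t, k t = a * f t + g t} ->
  ip mu k h = a * ip mu f h + ip mu g h.
Proof.
move=> sf sg sh sk kE; have saf := sqintZ a sf.
rewrite -(ipZl a sf sh) -(ipDl saf sg sh).
by apply: eq_ip_ae => //; [exact: (sqintD saf sg)|exact: aeW].
Qed.

Lemma mdotC x y : mdot x y = mdot y x.
Proof. exact: ipC. Qed.

Lemma mdot_linear a x y z : mdot (a *: x + y) z = a * mdot x z + mdot y z.
Proof.
by apply: ip_linear_ae; [exact: sqint_fun..|exact: H1fun_linear].
Qed.

Lemma kdotC x y : kdot x y = kdot y x.
Proof. by apply: eq_bigr => i _; exact: ipC. Qed.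

Lemma kdot_linear a x y z : kdot (a *: x + y) z = a * kdot x z + kdot y z.
Proof.
rewrite /kdot mulr_sumr -big_split/=; apply: eq_bigr => i _.
by apply: ip_linear_ae; [exact: sqint_grad..|exact: H1grad_linear].
Qed.

Lemma mdot_ge0 x : 0 <= mdot x x. Proof. exact: ip_ge0. Qed.

Lemma kdot_ge0 x : 0 <= kdot x x.
Proof. by apply: sumr_ge0 => i _; exact: ip_ge0. Qed.

Lemma H1_normE x : `|x| = Num.sqrt (mdot x x + kdot x x).
Proof. by []. Qed.

Lemma H1_norm_sqr x : `|x| ^+ 2 = mdot x x + kdot x x.
Proof. by rewrite H1_normE sqr_sqrtr// addr_ge0 ?mdot_ge0 ?kdot_ge0. Qed.

Lemma nrm_fun_le x : nrm mu (H1fun x) <= `|x|.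
Proof. by rewrite H1_normE ler_wsqrtr// lerDl kdot_ge0. Qed.

Lemma nrm_grad_le x i : nrm mu (H1grad x i) <= `|x|.
Proof.
rewrite H1_normE ler_wsqrtr// /kdot (bigD1 i)//= addrCA lerDl addr_ge0 ?mdot_ge0//.
by apply: sumr_ge0 => j _; exact: ip_ge0.
Qed.

End RadialSobolevForms.

(* Shared by the L^2 product, the Dirichlet form and the H^1 product. *)
Section BilinearForm.
Context {R : realType} {V : lmodType R} (b : V -> V -> R).
Hypothesis bC : forall x y, b x y = b y x.
Hypothesis bl : forall a x y z, b (a *: x + y) z = a * b x z + b y z.

Lemma bformDl x y z : b (x + y) z = b x z + b y z.
Proof. by have := bl 1 x y z; rewrite scale1r mul1r. Qed.

Lemma bform0l z : b 0 z = 0.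
Proof. by apply: (addrI (b 0 z)); rewrite -bformDl !addr0. Qed.

Lemma bformZl a x z : b (a *: x) z = a * b x z.
Proof. by have := bl a x 0 z; rewrite addr0 bform0l addr0. Qed.

Lemma bformNl x z : b (- x) z = - b x z.
Proof. by rewrite -scaleN1r bformZl mulN1r. Qed.

Lemma bformBl x y z : b (x - y) z = b x z - b y z.
Proof. by rewrite bformDl bformNl. Qed.

Lemma bformDr x y z : b z (x + y) = b z x + b z y.
Proof. by rewrite bC bformDl ![b _ z]bC. Qed.

Lemma bformZr a x z : b z (a *: x) = a * b z x.
Proof. by rewrite bC bformZl bC. Qed.

Lemma bformBr x y z : b z (x - y) = b z x - b z y.
Proof. by rewrite bC bformBl ![b _ z]bC. Qed.

Lemma bform_sqrD x y : b (x + y) (x + y) = b x x + 2 * b x y + b y y.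
Proof. by rewrite bformDl !bformDr [b y x]bC; ring. Qed.

Hypothesis b0 : forall x, 0 <= b x x.

Lemma bform_CauchySchwarz x y : `|b x y| <= Num.sqrt (b x x) * Num.sqrt (b y y).
Proof.
rewrite -sqrtrM// -sqrtr_sqr; apply: ler_wsqrtr.
set B := b x y; set A := b x x; set C := b y y.
have q a : 0 <= A + 2 * a * B + a ^+ 2 * C.
  have := b0 (x + a *: y); rewrite bform_sqrD bformZr bformZl bformZr -/A -/B -/C.
  by move=> /le_trans; apply; apply: le_of_eq; ring.
have A0 : 0 <= A by exact: b0.
have [C0|C0] := eqVneq C 0.
  rewrite C0 mulr0; have [->|B0] := eqVneq B 0; first by rewrite expr0n.
  have := q (- (A + 1) / (2 * B)); rewrite C0 mulr0 addr0.
  have -> : 2 * (- (A + 1) / (2 * B)) * B = - (A + 1) by field.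
  by lra.
have Cp : 0 < C by rewrite lt_neqAle eq_sym C0 b0.
have := q (- B / C).
have -> : A + 2 * (- B / C) * B + (- B / C) ^+ 2 * C = (A * C - B ^+ 2) / C.
  by field.
by rewrite pmulr_lge0 ?invr_gt0// subr_ge0.
Qed.

End BilinearForm.

(** * The quartic form and its bound by the H^1 norm *)

Section QuarticForm.
Context {R : realType}.
Notation mu := (leb3 R).
Notation V := (H1rad R).
Implicit Types (u v w x y z : V) (a : R).

Lemma hdotC x y : H1dot x y = H1dot y x.
Proof. by rewrite !H1dot_split mdotC kdotC. Qed.

Lemma hdot_linear a x y z : H1dot (a *: x + y) z = a * H1dot x z + H1dot y z.
Proof. by rewrite !H1dot_split mdot_linear kdot_linear mulrDr addrACA. Qed.

Lemma hdot_norm x : H1dot x x = `|x| ^+ 2.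
Proof. by rewrite H1_norm_sqr. Qed.

Lemma hdot_ge0 x : 0 <= H1dot x x.
Proof. by rewrite hdot_norm sqr_ge0. Qed.

Lemma hdot_CauchySchwarz x y : `|H1dot x y| <= `|x| * `|y|.
Proof. exact: (bform_CauchySchwarz hdotC hdot_linear hdot_ge0). Qed.

Lemma mdot_le x y : `|mdot x y| <= `|x| * `|y|.
Proof.
apply: le_trans (ip_CauchySchwarz (sqint_fun x) (sqint_fun y)) _.
by apply: ler_pM; rewrite ?nrm_ge0 ?nrm_fun_le.
Qed.

Lemma kdot_le x y : `|kdot x y| <= `|x| * `|y|.
Proof.
apply: le_trans (bform_CauchySchwarz (@kdotC R) (@kdot_linear R) (@kdot_ge0 R) x y) _.
by apply: ler_pM; rewrite ?sqrtr_ge0// H1_normE ler_wsqrtr// lerDr mdot_ge0.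
Qed.

Lemma sobolev_const_ge0 : 0 <= @sobolev_const R.
Proof. by rewrite addr_ge0// mulr_ge0. Qed.

(** The embedding is stated for a strict bound [0 < N] on the norms; an element of norm 0 is reached
    by letting [N] tend to 0. *)
Lemma int_fun4_le x : (\int[mu]_t (H1fun x t ^+ 4)%:E <= (@sobolev_const R * `|x| ^+ 4)%:E)%E.
Proof.
have key N : 0 < N -> `|x| <= N ->
    (\int[mu]_t (H1fun x t ^+ 4)%:E <= (@sobolev_const R * N ^+ 4)%:E)%E.
  move=> N0 xN; apply: (@sobolev_L4 _ _ (H1grad x)) => //.
  - exact: sqint_fun.
  - exact: sqint_grad.
  - exact: H1_weak_gradient.
  - exact: le_trans (nrm_fun_le x) xN.
  - by move=> i; exact: le_trans (nrm_grad_le x i) xN.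
have [x0|x0] := eqVneq `|x| 0; last first.
  by apply: key => //; rewrite lt_neqAle eq_sym x0 normr_ge0.
rewrite x0 [in leRHS]expr0n mulr0; apply/lee_addgt0Pr => e e0.
have N0 : 0 < Num.min 1 (e / (@sobolev_const R + 1)).
  by rewrite lt_min ltr01 divr_gt0// ltr_wpDl// sobolev_const_ge0.
apply: le_trans (key _ N0 _) _; first by rewrite x0 ltW.
rewrite add0e lee_fin; set N := Num.min _ _ in N0 *.
have N1 : N <= 1 by rewrite /N ge_min lexx.
have Ne : N * (@sobolev_const R + 1) <= e.
  by rewrite -ler_pdivlMr ?ltr_wpDl ?sobolev_const_ge0// /N ge_min lexx orbT.
have N4 : N ^+ 4 <= N.
  rewrite exprS ler_piMr//; first exact: ltW.
  by rewrite exprn_ile1// ltW.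
have := ler_wpM2l sobolev_const_ge0 N4; have := sobolev_const_ge0; nra.
Qed.

Definition pr x y : E3 R -> R := fun t => H1fun x t * H1fun y t.

Lemma sqint_sqr_fun x : sqint mu (pr x x).
Proof.
have mx := (sqint_fun x).1; split; first exact: measurable_funM.
apply/integrableP; split.
  by apply/measurable_EFinP; apply: measurable_funX; exact: measurable_funM.
apply: le_lt_trans (ltry (@sobolev_const R * `|x| ^+ 4)).
apply: le_trans (int_fun4_le x).
apply: le_of_eq; apply: eq_integral => t _ /=.
by rewrite /pr ger0_norm ?sqr_ge0//; congr EFin; ring.
Qed.

Lemma nrm_sqr_fun_le x : nrm mu (pr x x) <= Num.sqrt (@sobolev_const R) * `|x| ^+ 2.
Proof.
rewrite -ler_sqr ?nnegrE ?mulr_ge0 ?nrm_ge0 ?sqrtr_ge0 ?sqr_ge0//.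
have -> : (Num.sqrt sobolev_const * `|x| ^+ 2) ^+ 2 = Num.sqrt sobolev_const ^+ 2 * `|x| ^+ 4 :> R by ring.
rewrite sqr_sqrtr ?sobolev_const_ge0// -lee_fin (nrmE (sqint_sqr_fun x)).
apply: le_trans (int_fun4_le x).
apply: le_of_eq; apply: eq_integral => t _ /=.
by rewrite /pr; congr EFin; ring.
Qed.

Lemma sqint_pr x y : sqint mu (pr x y).
Proof.
have mx := (sqint_fun x).1; have my := (sqint_fun y).1.
apply: (@sqint_le _ _ _ _ (pr x y) (pr x x \+ pr y y)).
- exact: measurable_funM.
- exact: (sqintD (sqint_sqr_fun x) (sqint_sqr_fun y)).
- move=> t; rewrite /pr /= -!expr2 [leRHS]ger0_norm ?addr_ge0 ?sqr_ge0//.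
  rewrite normrM -[H1fun x t ^+ 2]real_normK ?num_real// -[H1fun y t ^+ 2]real_normK ?num_real//.
  by have := normr_ge0 (H1fun x t); have := normr_ge0 (H1fun y t); nra.
Qed.

(** The square of [x y] regroups as the product of [x x] and [y y], to which Cauchy-Schwarz and the
    L^4 bound apply. *)
Lemma nrm_pr_le x y : nrm mu (pr x y) <= Num.sqrt (@sobolev_const R) * (`|x| * `|y|).
Proof.
set S := Num.sqrt _; have S0 : 0 <= S by exact: sqrtr_ge0.
rewrite -ler_sqr ?nnegrE ?mulr_ge0 ?nrm_ge0// sqr_nrm.
have -> : ip mu (pr x y) (pr x y) = ip mu (pr x x) (pr y y).
  by apply: eq_Rintegral => t _; rewrite /pr; ring.
apply: le_trans (ler_norm _) _.
apply: le_trans (ip_CauchySchwarz (sqint_sqr_fun x) (sqint_sqr_fun y)) _.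
have h1 := nrm_sqr_fun_le x; have h2 := nrm_sqr_fun_le y.
apply: le_trans (ler_pM (nrm_ge0 _ _) (nrm_ge0 _ _) h1 h2) _.
by rewrite -/S; apply: le_of_eq; ring.
Qed.

(** The symmetric quadrilinear form behind [quartic], split into two products that are in L^2 by the
    embedding. *)
Definition I4 x y z w : R := ip mu (pr x y) (pr z w).

Lemma I4_le x y z w : `|I4 x y z w| <= @sobolev_const R * (`|x| * `|y| * (`|z| * `|w|)).
Proof.
apply: le_trans (ip_CauchySchwarz (sqint_pr x y) (sqint_pr z w)) _.
apply: le_trans (ler_pM (nrm_ge0 _ _) (nrm_ge0 _ _) (nrm_pr_le x y) (nrm_pr_le z w)) _.
rewrite mulrACA -[X in X * _]expr2 sqr_sqrtr ?sobolev_const_ge0//.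
Qed.

Lemma I4_swap12 x y z w : I4 x y z w = I4 y x z w.
Proof. by apply: eq_Rintegral => t _; rewrite /pr; ring. Qed.

Lemma I4_swap34 x y z w : I4 x y z w = I4 x y w z.
Proof. by apply: eq_Rintegral => t _; rewrite /pr; ring. Qed.

Lemma I4_swap23 x y z w : I4 x y z w = I4 x z y w.
Proof. by apply: eq_Rintegral => t _; rewrite /pr; ring. Qed.

Lemma I4_swap14 x y z w : I4 x y z w = I4 w y z x.
Proof. by apply: eq_Rintegral => t _; rewrite /pr; ring. Qed.

Lemma I4_linear a x x' y z w : I4 (a *: x + x') y z w = a * I4 x y z w + I4 x' y z w.
Proof.
apply: ip_linear_ae; [exact: sqint_pr..|].
by apply: filterS (H1fun_linear a x x') => t h; rewrite /pr h mulrDl mulrA.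
Qed.

Lemma kineticE (w : V * V) : kinetic w = kdot w.1 w.1 + kdot w.2 w.2.
Proof.
have ig (u : V) : mu.-integrable setT (EFin \o (fun t => grad_sq u t)).
  have -> : EFin \o (fun t => grad_sq u t) =
      (fun t => \sum_(i < 3) (EFin \o (fun t => H1grad u i t ^+ 2)%R) t)%E.
    by apply/funext => t; rewrite /grad_sq /= sumEFin.
  by apply: integrable_sum => // i _; case: (sqint_grad u i).
have kE (u : V) : \int[mu]_t grad_sq u t = kdot u u.
  rewrite /kdot /grad_sq /ip.
  have sum3 (F : 'I_3 -> E3 R -> R) : (forall i, mu.-integrable setT (EFin \o F i)) ->
      \int[mu]_t (\sum_(i < 3) F i t) = \sum_(i < 3) \int[mu]_t F i t.
    move=> iF; rewrite /Rintegral; under eq_integral do rewrite -sumEFin.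
    rewrite integral_sum//.
      rewrite (eq_bigr (fun i => (fine (\int[mu]_t (F i t)%:E)%E)%:E)) => [|i _].
        by rewrite sumEFin.
      by rewrite fineK//; exact: (integrable_fin_num measurableT (iF i)).
  rewrite sum3; last by move=> i; case: (sqint_grad u i).
  by apply: eq_bigr => i _; apply: eq_Rintegral => t _; rewrite expr2.
by rewrite /kinetic RintegralD// !kE.
Qed.

Lemma quarticE (mu1 mu2 beta : R) (w : V * V) : quartic mu1 mu2 beta w =
  mu1 * I4 w.1 w.1 w.1 w.1 + 2 * beta * I4 w.1 w.1 w.2 w.2 + mu2 * I4 w.2 w.2 w.2 w.2.
Proof.
have s1 := sqint_sqr_fun w.1; have s2 := sqint_sqr_fun w.2.
rewrite /I4 -!(ipZl _ s1)// -(ipZl _ s2)//.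
have i1 := sqint_mul (sqintZ mu1 s1) s1.
have i2 := sqint_mul (sqintZ (2 * beta) s1) s2.
have i3 := sqint_mul (sqintZ mu2 s2) s2.
rewrite /ip -(RintegralD measurableT i1 i2) -(RintegralD measurableT _ i3).
  by apply: eq_Rintegral => t _; rewrite /pr; ring.
exact: (integrableD measurableT i1 i2).
Qed.

Lemma sphereE (a : R) (u : V) : sphere a u <-> mdot u u = a ^+ 2.
Proof.
by rewrite /sphere /mdot /ip /=; under eq_Rintegral do rewrite expr2.
Qed.

End QuarticForm.

(** * Completeness and Riesz representation *)

Section Completeness.
Context {R : realType}.
Notation mu := (leb3 R).
Notation V := (H1rad R).
Implicit Types (x y z w : V).

Lemma eq_nrm_ae (f g : E3 R -> R) : sqint mu f -> sqint mu g ->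
  {ae mu, forall t, f t = g t} -> nrm mu f = nrm mu g.
Proof. by move=> sf sg fg; congr Num.sqrt; exact: eq_ip_ae. Qed.

Lemma H1fun_sub x y : {ae mu, forall t, H1fun (x - y) t = H1fun x t - H1fun y t}.
Proof.
have := H1fun_linear (-1) y x; rewrite scaleN1r addrC.
by apply: filterS => t ->; rewrite mulN1r addrC.
Qed.

Lemma H1grad_sub x y i :
  {ae mu, forall t, H1grad (x - y) i t = H1grad x i t - H1grad y i t}.
Proof.
have := H1grad_linear (-1) y x i; rewrite scaleN1r addrC.
by apply: filterS => t ->; rewrite mulN1r addrC.
Qed.

Lemma nrm_fun_sub x y : nrm mu (H1fun (x - y)) = nrm mu (H1fun x \- H1fun y).
Proof.
apply: eq_nrm_ae; [exact: sqint_fun| |exact: H1fun_sub].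
exact: (sqintB (sqint_fun x) (sqint_fun y)).
Qed.

Lemma nrm_grad_sub x y i :
  nrm mu (H1grad (x - y) i) = nrm mu (H1grad x i \- H1grad y i).
Proof.
apply: eq_nrm_ae; [exact: sqint_grad| |exact: H1grad_sub].
exact: (sqintB (sqint_grad x i) (sqint_grad y i)).
Qed.

(** The function and three partial derivatives make four components, whence the factor 2. *)
Lemma H1_dist_le x y e : 0 <= e -> nrm mu (H1fun x \- H1fun y) <= e ->
  (forall i, nrm mu (H1grad x i \- H1grad y i) <= e) -> `|x - y| <= 2 * e.
Proof.
move=> e0 h hi; rewrite -ler_sqr ?nnegrE ?mulr_ge0// H1_norm_sqr /mdot /kdot.
have sq (f : E3 R -> R) : nrm mu f <= e -> ip mu f f <= e ^+ 2.
  by move=> fe; rewrite -sqr_nrm ler_sqr ?nnegrE ?nrm_ge0.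
rewrite -nrm_fun_sub in h; have {}hi i : nrm mu (H1grad (x - y) i) <= e by rewrite nrm_grad_sub.
rewrite !big_ord_recl big_ord0.
have h1 := sq _ h; have h2 := sq _ (hi ord0); have h3 := sq _ (hi (lift ord0 ord0)).
have h4 := sq _ (hi (lift ord0 (lift ord0 ord0))).
by move: h1 h2 h3 h4; do 4!move: (ip _ _ _) => ?; move=> *; lra.
Qed.

Lemma cvg_ip (f : nat -> E3 R -> R) g h : (forall n, sqint mu (f n)) -> sqint mu g ->
  sqint mu h -> nrm mu (f n \- g) @[n --> \oo] --> (0 : R) ->
  ip mu (f n) h @[n --> \oo] --> ip mu g h.
Proof.
move=> sf sg sh fg; apply/subr_cvg0; apply: norm_cvg0.
apply: (@squeeze_cvgr _ _ _ _ (cst 0) (fun n => nrm mu (f n \- g) * nrm mu h)).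
- apply: nearW => n; rewrite normr_ge0/= -ipBl//.
  by apply: ip_CauchySchwarz => //; exact: (sqintB (sf n) sg).
- exact: cvg_cst.
- by rewrite -[X in _ --> X](mul0r (nrm mu h)); apply: cvgMl.
Qed.

(** Function and derivatives converge separately in L^2. The weak gradient relation passes to the
    limit against each fixed test function, and radiality follows from an a.e. convergent
    subsequence. *)
Lemma H1_complete (x : nat -> V) :
  (forall e, 0 < e -> exists N, forall m n, (N <= m)%N -> (N <= n)%N -> `|x m - x n| <= e) ->
  exists l, forall e, 0 < e -> exists N, forall n, (N <= n)%N -> `|x n - l| <= e.
Proof.
move=> xC.
have cf : sqint_cauchy mu (fun n => H1fun (x n)).
  move=> e /xC[N hN]; exists N => m n Nm Nn; rewrite -nrm_fun_sub.
  exact: le_trans (nrm_fun_le _) (hN _ _ Nm Nn).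
have cg i : sqint_cauchy mu (fun n => H1grad (x n) i).
  move=> e /xC[N hN]; exists N => m n Nm Nn; rewrite -nrm_grad_sub.
  exact: le_trans (nrm_grad_le _ _) (hN _ _ Nm Nn).
have [u [su ul [phi _ uae]]] := sqint_complete (fun n => sqint_fun (x n)) cf.
have /choice[g hg] i : exists g, sqint mu g /\
    nrm mu (H1grad (x n) i \- g) @[n --> \oo] --> (0 : R).
  by have [g [sg gl _]] := sqint_complete (fun n => sqint_grad (x n) i) (cg i); exists g.
have wg : weak_gradient u g.
  move=> i p tp; have sp := test_function_sqint tp; have sdp := partial_sqint i tp.
  have [sgi gl] := hg i.
  have h1 := cvg_ip (fun n => sqint_fun (x n)) su sdp ul.
  have h2 := cvg_ip (fun n => sqint_grad (x n) i) sgi sp gl.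
  have h3 : ip mu (H1fun (x n)) (partial i p) @[n --> \oo] --> - ip mu (g i) p.
    have -> : (fun n => ip mu (H1fun (x n)) (partial i p)) =
        (fun n => - ip mu (H1grad (x n) i) p).
      by apply/funext => n; exact: (H1_weak_gradient (x n) i tp).
    exact: cvgN.
  exact: (cvg_unique _ h1 h3).
have ru : radial u.
  have /choice[r hr] n := H1_radial (x n).
  (* The limit of the radial profiles; its value matters only at radii [euclid t] of points [t]
     where the functions converge. *)
  exists (fun s => lim (r (phi k) s @[k --> \oo])).
  have hr' : {ae mu, forall t, forall n, H1fun (x n) t = r n (euclid t)}.
    exact/ae_foralln.
  apply: filterS2 uae hr' => t ut rt; apply/esym/cvg_lim => //.
  by have -> : (fun k => r (phi k) (euclid t)) = (fun k => H1fun (x (phi k)) t);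
    [apply/funext => k; rewrite rt|].
have [w [wu wgi]] := H1_make su (fun i => (hg i).1) wg ru.
exists w => e e0; have e2 : 0 < e / 2 by rewrite divr_gt0.
have [N _ hN] : \forall n \near \oo, nrm mu (H1fun (x n) \- u) <= e / 2 /\
    forall i, nrm mu (H1grad (x n) i \- g i) <= e / 2.
  apply: filterI.
    have [N _ hN] := cvgr0_norm_le _ ul _ e2.
    by exists N => // n /hN; rewrite ger0_norm// nrm_ge0.
  have /choice[N hN] i : exists N, forall n, (N <= n)%N -> nrm mu (H1grad (x n) i \- g i) <= e / 2.
    have [N _ hN] := cvgr0_norm_le _ (hg i).2 _ e2.
    by exists N => n /hN; rewrite ger0_norm// nrm_ge0.
  by exists (\max_i N i)%N => // n /= Nn i; apply: hN; apply: leq_trans Nn; exact: leq_bigmax.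
exists N => n Nn; have [h1 h2] := hN n Nn.
have -> : e = 2 * (e / 2) by field.
apply: H1_dist_le; first exact: ltW.
- rewrite (_ : nrm _ _ = nrm mu (H1fun (x n) \- u))//.
  apply: eq_nrm_ae; [exact: (sqintB (sqint_fun _) (sqint_fun _))| |].
    exact: (sqintB (sqint_fun _) su).
  by apply: filterS wu => t /= ->.
- move=> i; rewrite (_ : nrm _ _ = nrm mu (H1grad (x n) i \- g i))//.
  apply: eq_nrm_ae; [exact: (sqintB (sqint_grad _ _) (sqint_grad _ _))| |].
    exact: (sqintB (sqint_grad _ _) (hg i).1).
  by apply: filterS (wgi i) => t /= ->.
Qed.

End Completeness.

Section Riesz.
Context {R : realType}.
Notation V := (H1rad R).
Implicit Types (x y z w : V) (f : V -> R).

Let hC := @hdotC R.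
Let hl := @hdot_linear R.

Lemma hdot0_eq z : (forall x, H1dot z x = 0) -> z = 0.
Proof. by move=> h; apply/eqP; rewrite -normr_eq0 -sqrf_eq0 -hdot_norm h. Qed.

(* Minimise [|x|^2 / 2 - f x]; minimising sequences are Cauchy by the
   parallelogram identity. *)
Lemma riesz_exists f M : (forall a x y, f (a *: x + y) = a * f x + f y) ->
  (forall x, `|f x| <= M * `|x|) -> exists z, forall x, H1dot z x = f x.
Proof.
move=> fl fM.
have fD x y : f (x + y) = f x + f y by have := fl 1 x y; rewrite scale1r mul1r.
have f0 : f 0 = 0 by apply: (addrI (f 0)); rewrite -fD !addr0.
have fZ a x : f (a *: x) = a * f x by have := fl a x 0; rewrite !addr0 f0 addr0.
pose Phi x := H1dot x x / 2 - f x.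
have PhiD x y : Phi (x + y) = Phi x + H1dot x y + H1dot y y / 2 - f y.
  by rewrite /Phi (bform_sqrD hC hl) fD; field.
pose S := [set Phi x | x in setT].
have lbS : lbound S (- (M ^+ 2 / 2)).
  move=> _ [x _ <-]; rewrite /Phi hdot_norm.
  have := le_trans (ler_norm _) (fM x); move: (f x) (`|x|) => a b; have := sqr_ge0 (M - b); nra.
have hS : has_inf S.
  by split; [exists (Phi 0); exists 0|exists (- (M ^+ 2 / 2)); exact: lbS].
pose m := inf S.
have Phim x : m <= Phi x by apply: (ge_inf hS.2); exists x.
have /choice[x hx] (n : nat) : exists x, Phi x < m + n.+1%:R^-1.
  have n0 : 0 < n.+1%:R^-1 :> R by rewrite invr_gt0.
  by have [_ [y _ <-] hy] := inf_adherent n0 hS; exists y.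
have par y z : H1dot (y - z) (y - z) = 4 * (Phi y + Phi z - 2 * Phi (2^-1 *: (y + z))).
  rewrite /Phi !(bformBl hl) !(bformBr hC hl) !(bformZl hl) !(bformZr hC hl) fZ fD.
  by rewrite !(bformDl hl) !(bformDr hC hl) [H1dot z y]hC; field.
have dec e : 0 < e -> exists N : nat, forall n, (N <= n)%N -> n.+1%:R^-1 <= e :> R.
  move=> e0; have [N _ hN] := near_infty_natSinv_lt (PosNum e0).
  by exists N => n Nn; exact: ltW (hN n Nn).
have [z hz] : exists l, forall e, 0 < e -> exists N, forall n, (N <= n)%N -> `|x n - l| <= e.
  apply: H1_complete => e e0.
  have [N hN] : exists N : nat, forall n, (N <= n)%N -> n.+1%:R^-1 <= e ^+ 2 / 8 :> R.
    by apply: dec; rewrite divr_gt0// exprn_gt0.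
  exists N => p n Np Nn; rewrite -ler_sqr ?nnegrE//; last exact: ltW.
  rewrite -hdot_norm par.
  have := hx p; have := hx n; have := hN _ Np; have := hN _ Nn.
  have := Phim (2^-1 *: (x p + x n)).
  move: (Phi (x p)) (Phi (x n)) (Phi (2^-1 *: (x p + x n))) => P1 P2 P3.
  by move: (n.+1%:R^-1) (p.+1%:R^-1) => a b; lra.
exists z => y.
(* First variation at the minimiser, obtained in the limit from [m <= Phi (x n + s *: y)]. *)
have key s : 0 <= s * (H1dot z y - f y) + s ^+ 2 * (H1dot y y / 2).
  apply/ler_addgt0Pr => e e0.
  have d0 : 0 < e / (2 * (1 + `|s| * `|y|)).
    by rewrite divr_gt0// mulr_gt0// ltr_wpDr// mulr_ge0.
  set d := e / _ in d0; have e2 : 0 < e / 2 by rewrite divr_gt0.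
  have [N1 h1] := hz _ d0; have [N2 h2] := dec _ e2.
  set n := maxn N1 N2.
  have {}h1 := h1 n (leq_maxl _ _); have {}h2 := h2 n (leq_maxr _ _).
  have := Phim (x n + s *: y); rewrite PhiD fZ (bformZr hC hl) (bformZl hl) (bformZr hC hl).
  have -> : H1dot (x n) y = H1dot z y + H1dot (x n - z) y.
    by rewrite -(bformDl hl) addrC subrK.
  have h3 : s * H1dot (x n - z) y <= e / 2.
    apply: le_trans (ler_norm _) _; rewrite normrM.
    apply: le_trans (ler_wpM2l (normr_ge0 s) (hdot_CauchySchwarz _ _)) _.
    have h4 : `|s| * (`|x n - z| * `|y|) <= d * (`|s| * `|y|).
      rewrite mulrCA; apply: ler_wpM2r h1; exact: mulr_ge0.
    apply: le_trans h4 _.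
    have -> : e / 2 = d * (1 + `|s| * `|y|).
      by rewrite /d; field; rewrite gt_eqF// ltr_wpDr// mulr_ge0.
    by rewrite ler_wpM2l ?(ltW d0)// lerDr.
  have := hx n; move: h2 h3; move: (n.+1%:R^-1) => q.
  by move: (H1dot z y) (H1dot (x n - z) y) (Phi (x n)) (H1dot y y) (f y) => a b c d' e'; nra.
apply/eqP; rewrite -subr_eq0; apply/eqP.
have Y0 := hdot_ge0 y; move: (H1dot y y) Y0 key => Y Y0; move: (_ - f y) => d key.
have Y1 : 0 < Y + 1 by lra.
(* The 1 in the denominator covers [y = 0] without a case distinction. *)
have := key (- (d / (Y + 1))).
have -> : - (d / (Y + 1)) * d + (- (d / (Y + 1))) ^+ 2 * (Y / 2) =
    - (d ^+ 2 * ((Y / 2 + 1) / (Y + 1) ^+ 2)) by field; rewrite gt_eqF.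
rewrite oppr_ge0 => h; apply/eqP; rewrite -sqrf_eq0 eq_le sqr_ge0 andbT.
have c0 : 0 < (Y / 2 + 1) / (Y + 1) ^+ 2 by rewrite divr_gt0 ?exprn_gt0//; lra.
by rewrite -(pmulr_lle0 _ c0).
Qed.

Definition riesz f : V := xget 0 [set z | forall x, H1dot z x = f x].

Lemma rieszE f M : (forall a x y, f (a *: x + y) = a * f x + f y) ->
  (forall x, `|f x| <= M * `|x|) -> forall x, H1dot (riesz f) x = f x.
Proof.
move=> fl fM; have [z hz] := riesz_exists fl fM.
by rewrite /riesz; case: xgetP => [y _ //|/(_ z)].
Qed.

(** In analytic terms [(1 - Laplacian)^-1 x]: half the H^1 gradient of the mass, hence the normal at
    [x] to the sphere through it. *)
Definition mass_rep x : V := riesz (mdot x).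

Lemma mass_repE x y : H1dot (mass_rep x) y = mdot x y.
Proof.
apply: (@rieszE _ (`|x|)); last by move=> z; exact: mdot_le.
by move=> a z w; rewrite mdotC mdot_linear !(mdotC x).
Qed.

(** In analytic terms [(1 - Laplacian)^-1 (x y z)]; the cubic part of the energy gradient is built
    from it. *)
Definition T3 x y z : V := riesz (I4 x y z).

Lemma T3E x y z w : H1dot (T3 x y z) w = I4 x y z w.
Proof.
apply: (@rieszE _ (sobolev_const * (`|x| * `|y| * `|z|))).
  by move=> a w1 w2; rewrite -!(I4_swap14 _ y z x) I4_linear.
by move=> v; apply: le_trans (I4_le x y z v) _; rewrite !mulrA.
Qed.

Lemma hdot_inj x y : (forall z, H1dot x z = H1dot y z) -> x = y.
Proof.
move=> h; apply/eqP; rewrite -subr_eq0; apply/eqP/hdot0_eq => z.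
by rewrite (bformBl hl) h subrr.
Qed.

Lemma hdot_norm_le z M : 0 <= M -> (forall w, H1dot z w <= M * `|w|) -> `|z| <= M.
Proof.
move=> M0 h; have [->|z0] := eqVneq z 0; first by rewrite normr0.
have zp : 0 < `|z| by rewrite normr_gt0.
by rewrite -(ler_pM2r zp) -expr2 -hdot_norm.
Qed.

Lemma mass_repB x y : mass_rep (x - y) = mass_rep x - mass_rep y.
Proof.
apply: hdot_inj => z; rewrite (bformBl hl) !mass_repE.
exact: (bformBl (@mdot_linear R)).
Qed.

Lemma mass_rep_le x : `|mass_rep x| <= `|x|.
Proof.
by apply: hdot_norm_le => // w; rewrite mass_repE (le_trans (ler_norm _))// mdot_le.
Qed.

Lemma T3B x x' y z : T3 (x - x') y z = T3 x y z - T3 x' y z.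
Proof.
apply: hdot_inj => w; rewrite (bformBl hl) !T3E.
exact: (bformBl (b := fun a b => I4 a y z b) (fun a x x' w => I4_linear a x x' y z w)).
Qed.

Lemma T3_swap12 x y z : T3 x y z = T3 y x z.
Proof. by apply: hdot_inj => w; rewrite !T3E I4_swap12. Qed.

Lemma T3_swap23 x y z : T3 x y z = T3 x z y.
Proof. by apply: hdot_inj => w; rewrite !T3E I4_swap23. Qed.

Lemma T3_le x y z : `|T3 x y z| <= sobolev_const * (`|x| * `|y| * `|z|).
Proof.
apply: hdot_norm_le => [|w]; first by rewrite !mulr_ge0// sobolev_const_ge0.
rewrite T3E; apply: le_trans (ler_norm _) _; apply: le_trans (I4_le x y z w) _.
by rewrite !mulrA.
Qed.

End Riesz.

(** * Continuity of the forms along an arbitrary filter *)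

Section Continuity.
Context {R : realType} {T : Type} {F : set_system T} {FF : Filter F}.
Notation V := (H1rad R).

Lemma cvg_dist (X : normedModType R) (f : T -> X) (l : X) :
  (fun t => `|f t - l|) @ F --> (0 : R) -> f @ F --> l.
Proof. by move=> h; apply/subr_cvg0; apply: norm_cvg0. Qed.

Lemma dist_cvg (X : normedModType R) (f : T -> X) (l : X) :
  f @ F --> l -> (fun t => `|f t - l|) @ F --> (0 : R).
Proof.
move=> h; rewrite -(normr0 X); apply: cvg_norm; exact/subr_cvg0.
Qed.

Lemma cvg_hdot (f g : T -> V) x y : f @ F --> x -> g @ F --> y ->
  (fun t => H1dot (f t) (g t)) @ F --> H1dot x y.
Proof.
move=> fx gy; apply: cvg_dist.
apply: (@squeeze_cvgr _ _ _ _ (cst 0)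
  (fun t => `|f t - x| * `|g t| + `|x| * `|g t - y|)).
- apply: nearW => t; rewrite normr_ge0/=.
  have -> : H1dot (f t) (g t) - H1dot x y = H1dot (f t - x) (g t) + H1dot x (g t - y).
    by rewrite (bformBl (@hdot_linear R)) (bformBr (@hdotC R) (@hdot_linear R)) addrA subrK.
  by apply: le_trans (ler_normD _ _) _; rewrite lerD// hdot_CauchySchwarz.
- exact: cvg_cst.
- rewrite -[X in _ --> X](addr0 0) -[X in _ --> X + _](mul0r `|y|) -[X in _ --> _ + X](mulr0 `|x|).
  apply: cvgD; apply: cvgM; [exact: dist_cvg|exact: cvg_norm|exact: cvg_cst|exact: dist_cvg].
Qed.

Lemma cvg_mass_rep (f : T -> V) x : f @ F --> x -> (fun t => mass_rep (f t)) @ F --> mass_rep x.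
Proof.
move=> fx; apply: cvg_dist.
apply: (@squeeze_cvgr _ _ _ _ (cst 0) (fun t => `|f t - x|)); [|exact: cvg_cst|exact: dist_cvg].
by apply: nearW => t; rewrite normr_ge0/= -mass_repB mass_rep_le.
Qed.

Lemma cvg_mdot (f g : T -> V) x y : f @ F --> x -> g @ F --> y ->
  (fun t => mdot (f t) (g t)) @ F --> mdot x y.
Proof.
move=> fx gy; rewrite -mass_repE.
have -> : (fun t => mdot (f t) (g t)) = (fun t => H1dot (mass_rep (f t)) (g t)).
  by apply/funext => t; rewrite mass_repE.
by apply: cvg_hdot => //; exact: cvg_mass_rep.
Qed.

Lemma cvg_kdot (f g : T -> V) x y : f @ F --> x -> g @ F --> y ->
  (fun t => kdot (f t) (g t)) @ F --> kdot x y.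
Proof.
move=> fx gy; have kE a b : kdot a b = H1dot a b - mdot a b by rewrite H1dot_split addrC addKr.
rewrite kE; have -> : (fun t => kdot (f t) (g t)) = (fun t => H1dot (f t) (g t) - mdot (f t) (g t)).
  by apply/funext => t; exact: kE.
by apply: cvgB; [exact: cvg_hdot|exact: cvg_mdot].
Qed.

Lemma cvg_T3 (f g h : T -> V) x y z : f @ F --> x -> g @ F --> y -> h @ F --> z ->
  (fun t => T3 (f t) (g t) (h t)) @ F --> T3 x y z.
Proof.
move=> fx gy hz; apply: cvg_dist.
apply: (@squeeze_cvgr _ _ _ _ (cst 0) (fun t => sobolev_const *
  (`|f t - x| * `|g t| * `|h t| + `|g t - y| * `|x| * `|h t| + `|h t - z| * `|x| * `|y|))).
- apply: nearW => t; rewrite normr_ge0/=.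
  have -> : T3 (f t) (g t) (h t) - T3 x y z =
      T3 (f t - x) (g t) (h t) + T3 (g t - y) x (h t) + T3 (h t - z) x y.
    rewrite !T3B [T3 y _ _]T3_swap12 [T3 (g t) _ _]T3_swap12.
    rewrite [T3 (h t) _ _]T3_swap12 [T3 x (h t) _]T3_swap23.
    by rewrite [T3 z _ _]T3_swap12 [T3 x z _]T3_swap23 subrKA subrKA.
  rewrite !mulrDr; apply: le_trans (ler_normD _ _) _; apply: lerD; last exact: T3_le.
  by apply: le_trans (ler_normD _ _) _; apply: lerD; exact: T3_le.
- exact: cvg_cst.
- rewrite -[X in _ --> X](mulr0 sobolev_const); apply: cvgM; first exact: cvg_cst.
  have [[dx dy] dz] := (dist_cvg fx, dist_cvg gy, dist_cvg hz).
  have [ny nz] := (cvg_norm gy, cvg_norm hz).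
  have cM (p q : T -> R) (b : R) : p @ F --> (0 : R) -> q @ F --> b -> (fun t => p t * q t) @ F --> (0 : R).
    by move=> p0 qb; rewrite -[X in _ --> X](mul0r b); exact: cvgM.
  have cc (a : R) : (fun=> a) @ F --> a by exact: cvg_cst.
  rewrite -[X in _ --> X]addr0 -[X in _ --> X + _]addr0.
  apply: cvgD; first apply: cvgD.
  - exact: (cM _ _ _ (cM _ _ _ dx ny) nz).
  - exact: (cM _ _ _ (cM _ _ _ dy (cc `|x|)) nz).
  - exact: (cM _ _ _ (cM _ _ _ dz (cc `|x|)) (cc `|y|)).
Qed.

Lemma cvg_I4 (f g h k : T -> V) x y z w :
  f @ F --> x -> g @ F --> y -> h @ F --> z -> k @ F --> w ->
  (fun t => I4 (f t) (g t) (h t) (k t)) @ F --> I4 x y z w.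
Proof.
move=> fx gy hz kw; rewrite -T3E.
have -> : (fun t => I4 (f t) (g t) (h t) (k t)) = (fun t => H1dot (T3 (f t) (g t) (h t)) (k t)).
  by apply/funext => t; rewrite T3E.
by apply: cvg_hdot => //; exact: cvg_T3.
Qed.

End Continuity.

(** * Mass-preserving dilations *)

Section Dilation.
Context {R : realType}.
Notation mu := (leb3 R).
Notation V := (H1rad R).
Implicit Types (x y z w : V) (l : R).

Lemma ae_dil l (P : E3 R -> Prop) : 0 < l ->
  {ae mu, forall t, P t} -> {ae mu, forall t, P (dil l t)}.
Proof.
move=> l0 [N [mN N0 PN]].
have mdN : measurable (dil l @^-1` N).
  by have := measurable_affine3 l (0, 0, 0) measurableT mN; rewrite setTI.
exists (dil l @^-1` N); split => //; last by move=> t; exact: PN.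
have mF : measurable_fun setT (EFin \o (\1_N : E3 R -> R)).
  by apply/measurable_EFinP; exact: measurable_indic.
have F0 t : (0 <= (EFin \o (\1_N : E3 R -> R)) t)%E by rewrite lee_fin indicE ler0n.
have := ge0_integral_affine (0, 0, 0) l0 mF F0.
rewrite [in X in _ = X]integral_indic// setIT N0 mule0.
have -> : (fun t => (EFin \o (\1_N : E3 R -> R)) (affine3 l (0, 0, 0) t)) =
    EFin \o (\1_(dil l @^-1` N) : E3 R -> R) by apply/funext.
by rewrite integral_indic// setIT.
Qed.

(* [l^(3/2)]: the factor that makes [u |-> u(l x)] an isometry of L^2. *)
Definition dcoef l : R := Num.sqrt l ^+ 3.

Lemma dcoef_sqr l : 0 < l -> dcoef l * dcoef l * l ^- 3 = 1.
Proof.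
move=> l0; rewrite /dcoef -expr2 -exprM mulnC exprM sqr_sqrtr ?(ltW l0)//.
by rewrite divff// expf_neq0// gt_eqF.
Qed.

Lemma dcoef1 : dcoef 1 = 1.
Proof. by rewrite /dcoef sqrtr1 expr1n. Qed.

Lemma dcoefM l m : 0 <= l -> dcoef (l * m) = dcoef l * dcoef m.
Proof. by move=> l0; rewrite /dcoef sqrtrM// exprMn. Qed.

Lemma sqint_dilZ l a f : 0 < l -> sqint mu f -> sqint mu (fun t => a * f (dil l t)).
Proof. by move=> l0 sf; exact: (sqintZ a (sqint_affine (0, 0, 0) l0 sf)). Qed.

Lemma ip_dilZ l a b f g : 0 < l -> sqint mu f -> sqint mu g ->
  ip mu (fun t => a * f (dil l t)) (fun t => b * g (dil l t)) = a * b * l ^- 3 * ip mu f g.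
Proof.
move=> l0 sf sg.
have sF := sqint_affine (0, 0, 0) l0 sf; have sG := sqint_affine (0, 0, 0) l0 sg.
rewrite (ipZl a sF (sqintZ b sG)) (ipZr b sG sF) (ip_affine (0, 0, 0) l0 sf sg).
by rewrite !mulrA.
Qed.

Lemma nrm_dcoef l f : 0 < l -> sqint mu f ->
  nrm mu (fun t => dcoef l * f (dil l t)) = nrm mu f.
Proof. by move=> l0 sf; rewrite /nrm ip_dilZ// dcoef_sqr// mul1r. Qed.

Lemma dilM l m (t : E3 R) : dil l (dil m t) = dil (l * m) t.
Proof. by rewrite /dil /affine3 /= !addr0 !mulrA. Qed.

Lemma dil1 (t : E3 R) : dil 1 t = t.
Proof. by case: t => [[a b] c]; rewrite /dil /affine3 /= !addr0 !mul1r. Qed.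

(** The test function is written as a dilate of [q], so that both integrals become dilated pairings
    and the identity reduces to that of [u] against [q]. *)
Lemma weak_gradient_dil l a u g : 0 < l -> sqint mu u -> (forall i, sqint mu (g i)) ->
  weak_gradient u g ->
  weak_gradient (fun t => a * u (dil l t)) (fun i t => a * l * g i (dil l t)).
Proof.
move=> l0 su sg wg i p tp; have l0' : l != 0 by rewrite gt_eqF.
pose q := p \o dil l^-1.
have tq : test_function q by apply: test_function_affine tp; rewrite invr_eq0.
have pE : p = q \o dil l by apply/funext => t; rewrite /q /= dilM mulVf// dil1.
have sp := test_function_sqint tq; have sdp := partial_sqint i tq.
have dp : partial i p = (fun t => l * partial i q (dil l t)).
  by rewrite [in LHS]pE; exact: (partial_affine l (0, 0, 0) i tq.1).
transitivity (ip mu (fun t => a * u (dil l t)) (fun t => l * partial i q (dil l t))).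
  by rewrite dp.
rewrite ip_dilZ// [ip mu u _](wg i q tq) mulrN; congr (- _).
transitivity (ip mu (fun t => a * l * g i (dil l t)) (fun t => 1 * q (dil l t))).
  by rewrite ip_dilZ// mulr1.
by apply: eq_Rintegral => t _; rewrite mul1r pE.
Qed.

Lemma euclid_dil l (t : E3 R) : 0 < l -> euclid (dil l t) = l * euclid t.
Proof.
move=> l0; rewrite /euclid /dil /affine3 /= !addr0.
rewrite -[in RHS](ger0_norm (ltW l0)) -sqrtr_sqr -sqrtrM ?sqr_ge0//.
by congr Num.sqrt; ring.
Qed.

Lemma dilation_exists l x : 0 < l -> exists w : V,
  {ae mu, forall t, H1fun w t = dcoef l * H1fun x (dil l t)} /\
  forall i, {ae mu, forall t, H1grad w i t = dcoef l * l * H1grad x i (dil l t)}.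
Proof.
move=> l0; apply: (H1_make (u := fun t => dcoef l * H1fun x (dil l t))
  (g := fun i t => dcoef l * l * H1grad x i (dil l t))).
- exact: sqint_dilZ (sqint_fun x).
- by move=> i; exact: sqint_dilZ (sqint_grad x i).
- exact: weak_gradient_dil (sqint_fun x) (sqint_grad x) (H1_weak_gradient x).
- have [r hr] := H1_radial x; exists (fun s => dcoef l * r (l * s)).
  by apply: filterS (ae_dil l0 hr) => t ->; rewrite euclid_dil.
Qed.

(** Representatives are known only up to a.e. equality, hence the selection by [xget]; the value is
    meaningful for [0 < l]. *)
Definition dilate l x : V := xget 0 [set w : V |
  {ae mu, forall t, H1fun w t = dcoef l * H1fun x (dil l t)} /\
  forall i, {ae mu, forall t, H1grad w i t = dcoef l * l * H1grad x i (dil l t)}].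

Lemma dilateP l x : 0 < l ->
  {ae mu, forall t, H1fun (dilate l x) t = dcoef l * H1fun x (dil l t)} /\
  forall i, {ae mu, forall t, H1grad (dilate l x) i t = dcoef l * l * H1grad x i (dil l t)}.
Proof.
move=> l0; have [w hw] := dilation_exists x l0.
by rewrite /dilate; case: xgetP => [y _ //|/(_ w)].
Qed.

Lemma mdot_dilate l x y : 0 < l -> mdot (dilate l x) (dilate l y) = mdot x y.
Proof.
move=> l0; have [sx sy] := (sqint_fun x, sqint_fun y).
rewrite /mdot (eq_ip_ae (sqint_fun _) (sqint_dilZ (dcoef l) l0 sx) (sqint_fun _)
  (sqint_dilZ (dcoef l) l0 sy) (dilateP x l0).1 (dilateP y l0).1).
by rewrite ip_dilZ// dcoef_sqr// mul1r.
Qed.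

Lemma kdot_dilate l x y : 0 < l -> kdot (dilate l x) (dilate l y) = l ^+ 2 * kdot x y.
Proof.
move=> l0; rewrite /kdot mulr_sumr; apply: eq_bigr => i _.
have [sx sy] := (sqint_grad x i, sqint_grad y i).
rewrite (eq_ip_ae (sqint_grad _ i) (sqint_dilZ (dcoef l * l) l0 sx) (sqint_grad _ i)
  (sqint_dilZ (dcoef l * l) l0 sy) ((dilateP x l0).2 i) ((dilateP y l0).2 i)).
rewrite ip_dilZ//; congr (_ * _).
have -> : dcoef l * l * (dcoef l * l) * l ^- 3 = l ^+ 2 * (dcoef l * dcoef l * l ^- 3) by ring.
by rewrite dcoef_sqr// mulr1.
Qed.

Lemma I4_dilate l x y z w : 0 < l ->
  I4 (dilate l x) (dilate l y) (dilate l z) (dilate l w) = l ^+ 3 * I4 x y z w.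
Proof.
move=> l0; pose c := dcoef l * dcoef l.
have pE a b : {ae mu, forall t, pr (dilate l a) (dilate l b) t = c * pr a b (dil l t)}.
  apply: filterS2 (dilateP a l0).1 (dilateP b l0).1 => t h1 h2.
  by rewrite /pr h1 h2 /c; ring.
rewrite /I4 (eq_ip_ae (sqint_pr _ _) (sqint_dilZ c l0 (sqint_pr x y)) (sqint_pr _ _)
  (sqint_dilZ c l0 (sqint_pr z w)) (pE x y) (pE z w)).
rewrite ip_dilZ//; try exact: sqint_pr.
congr (_ * _); have h := dcoef_sqr l0; have l0' : l ^+ 3 != 0 by rewrite expf_neq0// gt_eqF.
have cE : c = l ^+ 3 by move: h; rewrite -/c => /(congr1 ( *%R^~ (l ^+ 3))); rewrite mulfVK// mul1r.
by rewrite cE mulfK.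
Qed.

Lemma H1_ext x y : {ae mu, forall t, H1fun x t = H1fun y t} ->
  (forall i, {ae mu, forall t, H1grad x i t = H1grad y i t}) -> x = y.
Proof.
move=> h hi; apply/eqP; rewrite -subr_eq0 -normr_eq0 eq_le normr_ge0 andbT.
rewrite -(mulr0 2).
have z (f g : E3 R -> R) : sqint mu f -> sqint mu g ->
    {ae mu, forall t, f t = g t} -> nrm mu (f \- g) <= 0.
  move=> sf sg fg; rewrite (eq_nrm_ae (sqintB sf sg) (sqintB sg sg)).
    rewrite (eq_nrm _ (g := fun t => 0 * g t)); last by move=> t /=; rewrite subrr mul0r.
    by rewrite nrmZ// normr0 mul0r.
  by apply: filterS fg => t /= ->.
apply: H1_dist_le => //.
  by apply: z h; exact: sqint_fun.
by move=> i; apply: z (hi i); exact: sqint_grad.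
Qed.

Lemma dilate1 x : dilate 1 x = x.
Proof.
have [h hi] := dilateP x (@ltr01 R); apply: H1_ext.
  by apply: filterS h => t ->; rewrite dcoef1 mul1r dil1.
by move=> i; apply: filterS (hi i) => t ->; rewrite dcoef1 !mul1r dil1.
Qed.

(** Dilation preserves the L^2 norm and multiplies that of the gradient by [l]; the factor [1 + l]
    covers both, and 2 comes from [H1_dist_le]. *)
Lemma dilate_lip l x y : 0 < l -> `|dilate l x - dilate l y| <= 2 * ((1 + l) * `|x - y|).
Proof.
move=> l0; have e0 : 0 <= (1 + l) * `|x - y| by rewrite mulr_ge0// addr_ge0// ltW.
have key (f g f' g' : E3 R -> R) a : sqint mu f -> sqint mu g -> sqint mu f' -> sqint mu g' ->
   {ae mu, forall t, f' t = dcoef l * a * f (dil l t)} ->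
   {ae mu, forall t, g' t = dcoef l * a * g (dil l t)} ->
   nrm mu (f' \- g') = `|a| * nrm mu (f \- g).
  move=> sf sg sf' sg' hf hg; have sfg := sqintB sf sg.
  rewrite -(nrm_dcoef l0 sfg) -(nrmZ a (sqint_dilZ (dcoef l) l0 sfg)).
  apply: eq_nrm_ae; first exact: sqintB.
    exact: (sqintZ a (sqint_dilZ (dcoef l) l0 sfg)).
  by apply: filterS2 hf hg => t /= -> ->; ring.
have [hx hxi] := dilateP x l0; have [hy hyi] := dilateP y l0.
apply: H1_dist_le => //.
  rewrite (key (H1fun x) (H1fun y) _ _ 1) ?mulr1//; try exact: sqint_fun.
  rewrite normr1; apply: ler_pM => //; first exact: nrm_ge0.
    by rewrite lerDl ltW.
  by rewrite -nrm_fun_sub nrm_fun_le.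
move=> i; rewrite (key (H1grad x i) (H1grad y i) _ _ l)//; try exact: sqint_grad.
rewrite (ger0_norm (ltW l0)); apply: ler_pM => //; first exact: ltW.
- exact: nrm_ge0.
- by rewrite lerDr.
- by rewrite -nrm_grad_sub nrm_grad_le.
Qed.

(* [l * m] and [l] differ by the unitary dilation [dilate l] applied to the
   difference between [m] and [1]. *)
Lemma dilate_dist l m x : 0 < l -> 0 < m ->
  `|dilate (l * m) x - dilate l x| <= 2 *
    (nrm mu (fun t => dcoef m * H1fun x (dil m t) - H1fun x t) +
     l * \sum_(i < 3) nrm mu (fun t => dcoef m * m * H1grad x i (dil m t) - H1grad x i t)).
Proof.
move=> l0 m0; have lm0 : 0 < l * m by exact: mulr_gt0.
have key (f f' f'' : E3 R -> R) a b : sqint mu f -> sqint mu f' -> sqint mu f'' ->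
   {ae mu, forall t, f' t = dcoef (l * m) * (a * b) * f (dil (l * m) t)} ->
   {ae mu, forall t, f'' t = dcoef l * a * f (dil l t)} ->
   nrm mu (f' \- f'') = `|a| * nrm mu (fun t => dcoef m * b * f (dil m t) - f t).
  move=> sf sf' sf'' hf' hf''; have sd := sqintB (sqint_dilZ (dcoef m * b) m0 sf) sf.
  rewrite -(nrm_dcoef l0 sd) -(nrmZ a (sqint_dilZ (dcoef l) l0 sd)).
  apply: eq_nrm_ae; first exact: sqintB.
    exact: (sqintZ a (sqint_dilZ (dcoef l) l0 sd)).
  apply: filterS2 hf' hf'' => t /= -> ->.
  by rewrite dilM (mulrC m) dcoefM ?(ltW l0)//; ring.
have [hx hxi] := dilateP x lm0; have [hy hyi] := dilateP x l0.
have s0 : 0 <= \sum_(i < 3) nrm mu (fun t => dcoef m * m * H1grad x i (dil m t) - H1grad x i t).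
  by apply: sumr_ge0 => i _; exact: nrm_ge0.
apply: H1_dist_le; first by rewrite addr_ge0 ?nrm_ge0// mulr_ge0// ltW.
  rewrite (key (H1fun x) _ _ 1 1) ?mulr1//; try exact: sqint_fun.
  by rewrite normr1 mul1r lerDl mulr_ge0// ltW.
move=> i; rewrite (key (H1grad x i) _ _ l m)//; try exact: sqint_grad.
rewrite (ger0_norm (ltW l0)) ler_wpDl ?nrm_ge0// ler_wpM2l ?(ltW l0)//.
by rewrite (bigD1 i)//= lerDl sumr_ge0// => j _; exact: nrm_ge0.
Qed.

End Dilation.

Section DilationContinuity.
Context {R : realType} {T : Type} {F : set_system T} {FF : Filter F}.
Notation mu := (leb3 R).
Notation V := (H1rad R).

Lemma cvg_nrm_dil (f : E3 R -> R) (m a : T -> R) : sqint mu f ->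
  m @ F --> (1 : R) -> a @ F --> (1 : R) ->
  (fun s => nrm mu (fun t => a s * f (dil (m s) t) - f t)) @ F --> (0 : R).
Proof.
move=> sf m1 a1.
have n0 : (fun s => nrm mu (f \o dil (m s) \- f)) @ F --> (0 : R).
  apply/cvgr0Pnorm_le => e e0; have [d d0 hd] := dilation_continuous sf e0.
  near=> s; rewrite ger0_norm ?nrm_ge0//; apply: hd; rewrite distrC; near: s.
  by move/cvgrPdist_lt : m1; apply.
have a0 : (fun s => `|a s - 1| * (3 * nrm mu f)) @ F --> (0 : R).
  rewrite -(mul0r (3 * nrm mu f)); apply: cvgM; [exact: dist_cvg|exact: cvg_cst].
have h2 : (0 : R) < 2^-1 by rewrite invr_gt0 ltr0n.
apply: (@squeeze_cvgr _ _ _ _ (cst 0)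
  (fun s => `|a s - 1| * (3 * nrm mu f) + nrm mu (f \o dil (m s) \- f))).
- near=> s; rewrite nrm_ge0/=.
  have ms : 2^-1 <= m s.
    near: s; move/cvgrPdist_lt : m1 => /(_ _ h2).
    by apply: filterS => s; rewrite ltr_norml => /andP[]; lra.
  have ms0 : 0 < m s by lra.
  have sd := sqint_affine (0, 0, 0) ms0 sf.
  rewrite (eq_nrm _ (g := (fun t => (a s - 1) * (f \o dil (m s)) t) \+ (f \o dil (m s) \- f))).
    apply: le_trans (nrmD (sqintZ _ sd) (sqintB sd sf)) _.
    by rewrite nrmZ// lerD2r ler_wpM2l// nrm_dil_le.
  by move=> t /=; ring.
- exact: cvg_cst.
- by rewrite -[X in _ --> X]addr0; apply: cvgD.
Unshelve. all: by end_near. Qed.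

(** Joint continuity, from a Lipschitz constant in the function that is locally bounded in [l], and
    from strong continuity in [l] at the fixed function [x]. *)
Lemma cvg_dilate (l : T -> R) (f : T -> V) (l0 : R) (x : V) : 0 < l0 ->
  l @ F --> l0 -> f @ F --> x -> (fun s => dilate (l s) (f s)) @ F --> dilate l0 x.
Proof.
move=> l0p ll fx; have l0n : l0 != 0 by rewrite gt_eqF.
pose m s := l s / l0.
have m1 : m @ F --> (1 : R).
  by rewrite -(divff l0n); apply: cvgM => //; exact: cvg_cst.
have c1 : (fun s => dcoef (m s)) @ F --> (1 : R).
  have s1 : (fun s => Num.sqrt (m s)) @ F --> (1 : R).
    rewrite -[X in _ --> X](@sqrtr1 R); apply: continuous_cvg m1.
    exact: sqrt_continuous.
  have -> : (fun s => dcoef (m s)) = (fun s => Num.sqrt (m s) * (Num.sqrt (m s) * Num.sqrt (m s))).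
    by apply/funext => s; rewrite /dcoef !exprS expr0 mulr1.
  by rewrite -(mulr1 1); apply: cvgM => //; rewrite -(mulr1 1); apply: cvgM.
apply: cvg_dist.
pose bound s := 2 * ((1 + l s) * `|f s - x|) + 2 *
    (nrm mu (fun t => dcoef (m s) * H1fun x (dil (m s) t) - H1fun x t) +
     l0 * \sum_(i < 3) nrm mu (fun t => dcoef (m s) * m s * H1grad x i (dil (m s) t) - H1grad x i t)).
apply: (@squeeze_cvgr _ _ _ _ (cst 0) bound).
- near=> s; rewrite normr_ge0/=.
  have ls : 0 < l s by near: s; exact: (cvgr_gt l0).
  have ms : 0 < m s by rewrite divr_gt0.
  have -> : dilate (l s) (f s) - dilate l0 x =
    (dilate (l s) (f s) - dilate (l s) x) + (dilate (l0 * m s) x - dilate l0 x).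
    by rewrite /m mulrCA divff// mulr1 subrKA.
  apply: le_trans (ler_normD _ _) _; apply: lerD; first exact: dilate_lip.
  exact: dilate_dist.
- exact: cvg_cst.
- rewrite /bound.
  rewrite [X in _ --> X](_ : _ = 2 * ((1 + l0) * 0) + 2 * (0 + l0 * \sum_(i < 3) 0)); last first.
    by rewrite big1//; ring.
  apply: cvgD; apply: cvgM; try exact: cvg_cst.
    apply: cvgM; last exact: dist_cvg.
    by apply: cvgD => //; exact: cvg_cst.
  apply: cvgD; first exact: (cvg_nrm_dil (sqint_fun x)).
  apply: cvgM; first exact: cvg_cst.
  rewrite /=; apply: cvg_big => [|i _]; first by apply: add_continuous.
  apply: (cvg_nrm_dil (sqint_grad x i)) => //.
  by rewrite -(mulr1 1); exact: cvgM.
Unshelve. all: by end_near. Qed.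

End DilationContinuity.

(** * Expansion of the energy and its constrained gradient *)

Section EnergyExpansion.
Context {R : realType} (mu1 mu2 beta : R).
Notation V := (H1rad R).
Notation W := (H1rad R * H1rad R)%type.
Notation S4 := (@sobolev_const R).
Notation Q := (quartic mu1 mu2 beta).
Notation J := (energy mu1 mu2 beta).
Implicit Types (u v x y z : V) (w h : W).

Lemma I4C x y z u : I4 x y z u = I4 z u x y.
Proof. exact: ipC. Qed.

Lemma I4_D1 x x' y z u : I4 (x + x') y z u = I4 x y z u + I4 x' y z u.
Proof.
exact: (bformDl (b := fun a b => I4 a y z b) (fun a x x' u => I4_linear a x x' y z u)).
Qed.

Lemma I4_D2 x y y' z u : I4 x (y + y') z u = I4 x y z u + I4 x y' z u.
Proof. by rewrite I4_swap12 I4_D1 ![I4 _ x _ _]I4_swap12. Qed.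

Lemma I4_D3 x y z z' u : I4 x y (z + z') u = I4 x y z u + I4 x y z' u.
Proof. by rewrite I4C I4_D1 ![I4 _ u _ _]I4C. Qed.

Lemma I4_D4 x y z u u' : I4 x y z (u + u') = I4 x y z u + I4 x y z u'.
Proof. by rewrite I4C I4_D2 ![I4 z _ _ _]I4C. Qed.

Lemma I4_expand u x v y : I4 (u + x) (u + x) (v + y) (v + y) =
  I4 u u v v + 2 * (I4 v v u x + I4 u u v y) +
  (I4 u u y y + 4 * I4 u x v y + 2 * I4 u x y y + I4 x x v v + 2 * I4 x x v y + I4 x x y y).
Proof.
rewrite I4_D1 !I4_D2 !I4_D3 !I4_D4 [I4 v v u x]I4C.
rewrite ![I4 x u _ _]I4_swap12 ![I4 _ _ y v]I4_swap34.
by do 9!(move: (I4 _ _ _ _) => ?); ring.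
Qed.

(** Eleven is the sum [1 + 4 + 2 + 1 + 2 + 1] of the coefficients of the terms of order at least two
    in [x] and [y]; for [r <= M] each of them is bounded as a quadratic one. *)
Lemma I4_remainder u x v y (M r : R) : `|u| <= M -> `|v| <= M -> `|x| <= r -> `|y| <= r ->
  r <= M ->
  `|I4 (u + x) (u + x) (v + y) (v + y) - I4 u u v v - 2 * (I4 v v u x + I4 u u v y)|
    <= 11 * (S4 * (M ^+ 2 * r ^+ 2)).
Proof.
move=> uM vM xr yr rM.
have r0 : 0 <= r by exact: le_trans xr.
have M0 : 0 <= M by exact: le_trans rM.
set B := S4 * _.
have q1 : M * M * (r * r) <= M ^+ 2 * r ^+ 2 by rewrite -!expr2.
have q2 : M * r * (M * r) <= M ^+ 2 * r ^+ 2 by rewrite mulrACA -!expr2.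
have Mr : r * r <= M * r by rewrite ler_wpM2r.
have q3 : M * r * (r * r) <= M ^+ 2 * r ^+ 2.
  by apply: le_trans q2; apply: ler_wpM2l => //; exact: mulr_ge0.
have q4 : r * r * (M * M) <= M ^+ 2 * r ^+ 2 by rewrite mulrC.
have q5 : r * r * (M * r) <= M ^+ 2 * r ^+ 2 by rewrite mulrC.
have q6 : r * r * (r * r) <= M ^+ 2 * r ^+ 2.
  by apply: le_trans q3; apply: ler_wpM2r => //; exact: mulr_ge0.
have key (p q s t : V) (a b c d : R) : `|p| <= a -> `|q| <= b -> `|s| <= c -> `|t| <= d ->
    a * b * (c * d) <= M ^+ 2 * r ^+ 2 -> `|I4 p q s t| <= B.
  move=> pa qb sc td h; apply: le_trans (I4_le p q s t) _.
  rewrite /B ler_wpM2l ?sobolev_const_ge0//; apply: le_trans h.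
  by apply: ler_pM; rewrite ?mulr_ge0//; apply: ler_pM.
have h1 := key _ _ _ _ _ _ _ _ uM uM yr yr q1; have h2 := key _ _ _ _ _ _ _ _ uM xr vM yr q2.
have h3 := key _ _ _ _ _ _ _ _ uM xr yr yr q3; have h4 := key _ _ _ _ _ _ _ _ xr xr vM vM q4.
have h5 := key _ _ _ _ _ _ _ _ xr xr vM yr q5; have h6 := key _ _ _ _ _ _ _ _ xr xr yr yr q6.
clear key q1 q2 q3 q4 q5 q6 Mr uM vM xr yr; clearbody B.
rewrite I4_expand; move: h1 h2 h3 h4 h5 h6.
move: (I4 u u y y) (I4 u x v y) (I4 u x y y) (I4 x x v v) (I4 x x v y) (I4 x x y y).
move: (I4 u u v v) (_ + I4 u u v y) => A1 A2 e1 e2 e3 e4 e5 e6.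
by rewrite !ler_norml => /andP[? ?] /andP[? ?] /andP[? ?] /andP[? ?] /andP[? ?] /andP[? ?];
  apply/andP; split; lra.
Qed.

Definition qconst : R := S4 * (`|mu1| + 2 * `|beta| + `|mu2|).

Lemma qconst_ge0 : 0 <= qconst.
Proof. by rewrite mulr_ge0 ?sobolev_const_ge0// !addr_ge0// mulr_ge0. Qed.

(** The differentials of [kinetic] and [quartic] are [2 * kd w] and [4 * qd w], so that of the
    energy is [kd w - qd w]. *)
Definition kd w h : R := kdot w.1 h.1 + kdot w.2 h.2.

Definition qd w h : R := mu1 * I4 w.1 w.1 w.1 h.1
  + beta * (I4 w.2 w.2 w.1 h.1 + I4 w.1 w.1 w.2 h.2) + mu2 * I4 w.2 w.2 w.2 h.2.

Lemma weighted_sum_le (a b c B : R) : `|a| <= B -> `|b| <= B -> `|c| <= B ->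
  `|mu1 * a + 2 * beta * b + mu2 * c| <= (`|mu1| + 2 * `|beta| + `|mu2|) * B.
Proof.
move=> aB bB cB.
have -> : (`|mu1| + 2 * `|beta| + `|mu2|) * B = `|mu1| * B + 2 * `|beta| * B + `|mu2| * B by ring.
apply: le_trans (ler_normD _ _) _; apply: lerD; last by rewrite normrM ler_wpM2l.
apply: le_trans (ler_normD _ _) _; apply: lerD; first by rewrite normrM ler_wpM2l.
by rewrite !normrM ger0_norm// ler_wpM2l// mulr_ge0.
Qed.

Lemma quartic_expand w h (M r : R) : `|w.1| <= M -> `|w.2| <= M -> `|h.1| <= r -> `|h.2| <= r ->
  r <= M -> `|Q (w + h) - Q w - 4 * qd w h| <= 11 * (qconst * (M ^+ 2 * r ^+ 2)).
Proof.
case: w h => [u v] [x y] /= uM vM xr yr rM; rewrite !quarticE /qd /=.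
have h1 := I4_remainder uM uM xr xr rM; have h2 := I4_remainder uM vM xr yr rM.
have h3 := I4_remainder vM vM yr yr rM.
have := weighted_sum_le h1 h2 h3; rewrite /qconst.
have -> : (`|mu1| + 2 * `|beta| + `|mu2|) * (11 * (S4 * (M ^+ 2 * r ^+ 2))) =
  11 * (S4 * (`|mu1| + 2 * `|beta| + `|mu2|) * (M ^+ 2 * r ^+ 2)) by ring.
apply: le_trans; apply: le_of_eq; congr `|_|.
move: (I4 (u + x) (u + x) (u + x) (u + x)) (I4 (u + x) (u + x) (v + y) (v + y)) => ? ?.
move: (I4 (v + y) (v + y) (v + y) (v + y)) (I4 u u u u) (I4 u u v v) (I4 v v v v) => ? ? ? ?.
by move: (I4 u u u x) (I4 v v u x) (I4 u u v y) (I4 v v v y) => ? ? ? ?; ring.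
Qed.

Lemma qd_le w h (M r : R) : `|w.1| <= M -> `|w.2| <= M -> `|h.1| <= r -> `|h.2| <= r ->
  `|qd w h| <= qconst * (M ^+ 3 * r).
Proof.
case: w h => [u v] [x y] /= uM vM xr yr.
have M0 : 0 <= M by exact: le_trans uM.
have key (p s z : V) : `|p| <= M -> `|s| <= M -> `|z| <= r -> `|I4 p p s z| <= S4 * (M ^+ 3 * r).
  move=> pM sM zr; apply: le_trans (I4_le p p s z) _.
  rewrite ler_wpM2l ?sobolev_const_ge0// (_ : M ^+ 3 * r = M * M * (M * r)); last by ring.
  by apply: ler_pM; rewrite ?mulr_ge0//; apply: ler_pM.
have h1 := key _ _ _ uM uM xr; have h2 := key _ _ _ vM uM xr.
have h3 := key _ _ _ uM vM yr; have h4 := key _ _ _ vM vM yr.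
(* The mean of the two mixed terms, because [weighted_sum_le] carries the weight [2 * beta]. *)
have h5 : `|(I4 v v u x + I4 u u v y) / 2| <= S4 * (M ^+ 3 * r).
  move: h2 h3; rewrite !ler_norml => /andP[? ?] /andP[? ?]; apply/andP; split; lra.
have := weighted_sum_le h1 h5 h4; rewrite /qconst /qd /=.
have -> : (`|mu1| + 2 * `|beta| + `|mu2|) * (S4 * (M ^+ 3 * r)) =
  S4 * (`|mu1| + 2 * `|beta| + `|mu2|) * (M ^+ 3 * r) by ring.
apply: le_trans; apply: le_of_eq; congr `|_|.
by field.
Qed.

Lemma kinetic_expand w h : kinetic (w + h) = kinetic w + 2 * kd w h + kinetic h.
Proof.
case: w h => [u v] [x y]; rewrite !kineticE /kd /=.
rewrite !(bform_sqrD (@kdotC R) (@kdot_linear R)).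
by move: (kdot u u) (kdot u x) (kdot x x) (kdot v v) (kdot v y) (kdot y y) => *; ring.
Qed.

Lemma kd_le w h (M r : R) : `|w.1| <= M -> `|w.2| <= M -> `|h.1| <= r -> `|h.2| <= r ->
  `|kd w h| <= 2 * (M * r).
Proof.
move=> uM vM xr yr; apply: le_trans (ler_normD _ _) _.
have -> : 2 * (M * r) = M * r + M * r by ring.
by apply: lerD; apply: le_trans (kdot_le _ _) _; apply: ler_pM.
Qed.

Lemma kinetic_ge0 h : 0 <= kinetic h.
Proof. by rewrite kineticE addr_ge0 ?kdot_ge0. Qed.

Lemma kinetic_le h (r : R) : `|h.1| <= r -> `|h.2| <= r -> kinetic h <= 2 * r ^+ 2.
Proof.
move=> xr yr; have -> : 2 * r ^+ 2 = 2 * (r * r) by ring.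
by apply: le_trans (kd_le xr yr xr yr); rewrite kineticE ler_norm.
Qed.

(** Since the H^1 product is [mdot + kdot], the Dirichlet form of [u] is represented by
    [u - mass_rep u]. *)
Definition grad_part (c d : R) u v : V :=
  u - mass_rep u - c *: T3 u u u - d *: T3 v v u.

Lemma grad_part_dot c d u v x :
  H1dot (grad_part c d u v) x = kdot u x - c * I4 u u u x - d * I4 v v u x.
Proof.
have hl := @hdot_linear R.
rewrite (bformBl hl (u - mass_rep u - c *: T3 u u u) (d *: T3 v v u) x).
rewrite (bformBl hl (u - mass_rep u) (c *: T3 u u u) x) (bformBl hl u (mass_rep u) x).
rewrite (bformZl hl c (T3 u u u) x) (bformZl hl d (T3 v v u) x).
by rewrite (T3E u u u x) (T3E v v u x) (mass_repE u x) (H1dot_split u x) [mdot u x + _]addrC addrK.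
Qed.

Definition free_grad w : W := (grad_part mu1 beta w.1 w.2, grad_part mu2 beta w.2 w.1).

Definition energy_diff w h : R := pair_dot (free_grad w) h.

Lemma energy_diffE w h : energy_diff w h = kd w h - qd w h.
Proof.
rewrite /energy_diff /pair_dot (grad_part_dot mu1 beta w.1 w.2 h.1).
rewrite (grad_part_dot mu2 beta w.2 w.1 h.2) /kd /qd.
move: (kdot w.1 h.1) (kdot w.2 h.2) (I4 w.1 w.1 w.1 h.1) (I4 w.2 w.2 w.1 h.1) => ? ? ? ?.
by move: (I4 w.1 w.1 w.2 h.2) (I4 w.2 w.2 w.2 h.2) => *; ring.
Qed.

(** The kinetic part contributes at most [r ^+ 2], the quartic one [11 / 4], rounded up to 3, times
    [qconst * M ^+ 2 * r ^+ 2]. *)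
Lemma energy_expand w h (M r : R) : `|w.1| <= M -> `|w.2| <= M -> `|h.1| <= r -> `|h.2| <= r ->
  r <= M -> `|J (w + h) - J w - energy_diff w h| <= (1 + 3 * qconst * M ^+ 2) * r ^+ 2.
Proof.
move=> uM vM xr yr rM; rewrite /energy energy_diffE kinetic_expand.
have := quartic_expand uM vM xr yr rM; have := kinetic_le xr yr.
have B0 : 0 <= qconst * (M ^+ 2 * r ^+ 2) by rewrite mulr_ge0 ?qconst_ge0// mulr_ge0 ?sqr_ge0.
have -> : (1 + 3 * qconst * M ^+ 2) * r ^+ 2 = r ^+ 2 + 3 * (qconst * (M ^+ 2 * r ^+ 2)) by ring.
have := kinetic_ge0 h.
move: (qconst * _) B0 => B B0; move: (kinetic h) (kinetic w) (Q w) (Q (w + h)) (kd w h) (qd w h).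
move=> k K0 q q' a b k0 kr; rewrite !ler_norml => /andP[? ?]; apply/andP; split; lra.
Qed.

Lemma hdot_linear_r a x y z : H1dot z (a *: x + y) = a * H1dot z x + H1dot z y.
Proof. by rewrite hdotC (hdot_linear a x y z) !(hdotC z). Qed.

Lemma energy_diff_linear w : scalar (energy_diff w).
Proof.
move=> a h h'; rewrite /energy_diff /pair_dot; move: (free_grad w) => g.
have -> : (a *: h + h').1 = a *: h.1 + h'.1 by [].
have -> : (a *: h + h').2 = a *: h.2 + h'.2 by [].
rewrite (hdot_linear_r a h.1 h'.1 g.1) (hdot_linear_r a h.2 h'.2 g.2).
by move: (H1dot g.1 h.1) (H1dot g.1 h'.1) (H1dot g.2 h.2) (H1dot g.2 h'.2) => *; ring.
Qed.

HB.instance Definition _ w :=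
  GRing.isLinear.Build R W R *%R (energy_diff w) (energy_diff_linear w).

Lemma prod_norm1_le w : `|w.1| <= `|w|.
Proof. by rewrite prod_normE le_max lexx. Qed.

Lemma prod_norm2_le w : `|w.2| <= `|w|.
Proof. by rewrite prod_normE le_max lexx orbT. Qed.

Lemma energy_diff_locally w : continuous (energy_diff w : W -> R^o) /\
  (J : W -> R^o) \o shift w = cst (J w : R^o) + (energy_diff w : {linear W -> R^o}) +o_ (0 : W) id.
Proof.
split=> [h|].
  apply: cvgD; apply: cvg_hdot; try exact: cvg_cst.
    exact: cvg_fst.
  exact: cvg_snd.
pose M := `|w| + 1; pose C := 1 + 3 * qconst * M ^+ 2.
have C0 : 0 < C.
  rewrite ltr_wpDr//; apply: mulr_ge0; last exact: sqr_ge0.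
  by apply: mulr_ge0 => //; exact: qconst_ge0.
apply/eqaddoP => e e0; near=> h.
have hM : `|h| <= M.
  apply: (@le_trans _ _ 1); last by rewrite /M lerDr.
  near: h; apply: (@nbhs0_le R W); exact: ltr01.
have he : `|h| <= e / C.
  by near: h; apply: (@nbhs0_le R W); rewrite divr_gt0.
have -> : (J \o shift w - (cst (J w) + energy_diff w)) h = J (w + h) - J w - energy_diff w h.
  by rewrite !fctE /= /cst [h + w]addrC opprD addrA.
have wM : `|w| <= M by rewrite /M lerDl.
apply: le_trans (energy_expand (le_trans (prod_norm1_le w) wM) (le_trans (prod_norm2_le w) wM)
  (prod_norm1_le h) (prod_norm2_le h) hM) _.
rewrite -/C expr2 mulrA ler_wpM2r//.
by rewrite mulrC -ler_pdivlMr.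
Unshelve. all: by end_near. Qed.

Lemma energy_differentiable w : differentiable J w /\ 'd J w = energy_diff w :> (W -> R).
Proof.
have [c l] := energy_diff_locally w; have E := diff_unique c l.
by split => //; apply/diff_locallyP; rewrite E.
Qed.

(** The H^1-orthogonal projection onto the tangent space of the sphere, along the normal
    [mass_rep u]. *)
Definition tangent_part u x : V :=
  x - (H1dot x (mass_rep u) / H1dot (mass_rep u) (mass_rep u)) *: mass_rep u.

Definition constrained_grad w : W :=
  (tangent_part w.1 (free_grad w).1, tangent_part w.2 (free_grad w).2).

Lemma mass_rep_neq0 (a : R) u : a != 0 -> sphere a u -> H1dot (mass_rep u) (mass_rep u) != 0.
Proof.
move=> a0 /sphereE ua; rewrite hdot_norm sqrf_eq0 normr_eq0; apply/eqP => u0.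
have := mass_repE u u; rewrite u0 ua (bform0l (@hdot_linear R)) => /esym/eqP.
by rewrite sqrf_eq0 (negbTE a0).
Qed.

Lemma tangent_part_tangent u x : H1dot (mass_rep u) (mass_rep u) != 0 -> mdot u (tangent_part u x) = 0.
Proof.
move=> u0; rewrite -mass_repE (bformBr (@hdotC R) (@hdot_linear R)).
by rewrite (bformZr (@hdotC R) (@hdot_linear R)) mulfVK// hdotC subrr.
Qed.

Lemma tangent_part_dot u x y : mdot u y = 0 -> H1dot (tangent_part u x) y = H1dot x y.
Proof.
by move=> uy; rewrite (bformBl (@hdot_linear R)) (bformZl (@hdot_linear R)) (mass_repE u y) uy mulr0 subr0.
Qed.

Lemma tangent_part_le u x : H1dot (mass_rep u) (mass_rep u) != 0 -> `|tangent_part u x| <= `|x|.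
Proof.
move=> /tangent_part_tangent-/(_ x) t; set g := tangent_part u x in t *.
have [->|g0] := eqVneq g 0; first by rewrite normr0.
rewrite -(@ler_pM2r _ `|g|) ?normr_gt0// -expr2 -hdot_norm.
rewrite {1}/g (tangent_part_dot _ t).
exact: le_trans (ler_norm _) (hdot_CauchySchwarz _ _).
Qed.

Variables (a1 a2 : R).
Hypotheses (a1_gt0 : 0 < a1) (a2_gt0 : 0 < a2).

Lemma constraint_mass_rep w : mass_constraint a1 a2 w ->
  H1dot (mass_rep w.1) (mass_rep w.1) != 0 /\ H1dot (mass_rep w.2) (mass_rep w.2) != 0.
Proof. by move=> [h1 h2]; split; [apply: mass_rep_neq0 h1|apply: mass_rep_neq0 h2]; rewrite gt_eqF. Qed.

Lemma constrained_grad_tangent w : mass_constraint a1 a2 w ->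
  mdot w.1 (constrained_grad w).1 = 0 /\ mdot w.2 (constrained_grad w).2 = 0.
Proof. by move=> /constraint_mass_rep[h1 h2]; split; exact: tangent_part_tangent. Qed.

Lemma constrained_gradP w : mass_constraint a1 a2 w ->
  is_constrained_gradient J w (constrained_grad w).
Proof.
move=> hw; have [dJ E] := energy_differentiable w.
split => //; first exact: (constrained_grad_tangent hw).
move=> h [h1 h2]; transitivity (energy_diff w h); first exact: (congr1 (@^~ h) E).
have e1 := tangent_part_dot (free_grad w).1 h1; have e2 := tangent_part_dot (free_grad w).2 h2.
exact: (esym (congr2 +%R e1 e2)).
Qed.

Lemma energy_diff_grad w : mass_constraint a1 a2 w ->
  energy_diff w (constrained_grad w) = pair_norm (constrained_grad w) ^+ 2.
Proof.
move=> /constrained_grad_tangent[h1 h2].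
rewrite sqr_sqrtr; last by rewrite /pair_dot addr_ge0 ?hdot_ge0.
have e1 := tangent_part_dot (free_grad w).1 h1; have e2 := tangent_part_dot (free_grad w).2 h2.
exact: (esym (congr2 +%R e1 e2)).
Qed.

Lemma pair_norm1 w : `|w.1| <= pair_norm w.
Proof. by rewrite /pair_norm /pair_dot !hdot_norm -[leLHS]normr_id -sqrtr_sqr ler_wsqrtr// lerDl sqr_ge0. Qed.

Lemma pair_norm2 w : `|w.2| <= pair_norm w.
Proof. by rewrite /pair_norm /pair_dot !hdot_norm -[leLHS]normr_id -sqrtr_sqr ler_wsqrtr// lerDr sqr_ge0. Qed.

Lemma pair_norm_le w (M : R) : `|w.1| <= M -> `|w.2| <= M -> pair_norm w <= 2 * M.
Proof.
move=> h1 h2; have M0 : 0 <= M by exact: le_trans h1.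
rewrite -ler_sqr ?nnegrE ?sqrtr_ge0 ?mulr_ge0// sqr_sqrtr /pair_dot !hdot_norm; last first.
  by rewrite addr_ge0 ?sqr_ge0.
have : `|w.1| ^+ 2 <= M ^+ 2 by rewrite ler_sqr ?nnegrE.
have : `|w.2| ^+ 2 <= M ^+ 2 by rewrite ler_sqr ?nnegrE.
by move: (`|w.1| ^+ 2) (`|w.2| ^+ 2) => ? ? ? ?; have := sqr_ge0 M; lra.
Qed.

Lemma constrained_grad_le w (M : R) : mass_constraint a1 a2 w -> `|w.1| <= M -> `|w.2| <= M ->
  pair_norm (constrained_grad w) <= 2 * (2 * M + qconst * M ^+ 3).
Proof.
have aux (a b c : R) : 0 <= b -> 0 <= c -> a + b <= a + 2 * b + c by move=> *; lra.
move=> /constraint_mass_rep[i1 i2] h1 h2; have M0 : 0 <= M by exact: le_trans h1.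
have key (u v : V) (c d : R) : `|u| <= M -> `|v| <= M ->
    `|c| + `|d| <= `|mu1| + 2 * `|beta| + `|mu2| ->
    `|grad_part c d u v| <= 2 * M + qconst * M ^+ 3.
  move=> uM vM cd.
  have T3M (p q s : V) : `|p| <= M -> `|q| <= M -> `|s| <= M -> `|T3 p q s| <= S4 * M ^+ 3.
    move=> pM qM sM; apply: le_trans (T3_le _ _ _) _.
    rewrite ler_wpM2l ?sobolev_const_ge0// (_ : M ^+ 3 = M * M * M); last by ring.
    by apply: ler_pM; rewrite ?mulr_ge0//; apply: ler_pM.
  have n1 : `|c *: T3 u u u| <= `|c| * (S4 * M ^+ 3) by rewrite normrZ ler_wpM2l// T3M.
  have n2 : `|d *: T3 v v u| <= `|d| * (S4 * M ^+ 3) by rewrite normrZ ler_wpM2l// T3M.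
  have n3 := mass_rep_le u.
  apply: le_trans (ler_normB _ _) _; apply: le_trans (lerD (ler_normB _ _) (lexx _)) _.
  apply: le_trans (lerD (lerD (ler_normB _ _) (lexx _)) (lexx _)) _.
  have n4 : (`|c| + `|d|) * (S4 * M ^+ 3) <= qconst * M ^+ 3.
    have -> : qconst * M ^+ 3 = (`|mu1| + 2 * `|beta| + `|mu2|) * (S4 * M ^+ 3).
      by rewrite /qconst; ring.
    by rewrite ler_wpM2r// mulr_ge0 ?sobolev_const_ge0// exprn_ge0.
  clear T3M cd i1 i2 h1 h2; move: n1 n2 n3 n4 uM; rewrite (mulrDl `|c| `|d|).
  move: (`|c| * _) (`|d| * _) (qconst * _) => A1 A2 A3.
  by move: `|c *: T3 u u u| `|d *: T3 v v u| `|mass_rep u| `|u| => *; lra.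
apply: pair_norm_le; apply: le_trans (tangent_part_le _ _) _ => //=.
  exact: key h1 h2 (aux _ _ _ (normr_ge0 _) (normr_ge0 _)).
apply: key h2 h1 _.
have -> : `|mu1| + 2 * `|beta| + `|mu2| = `|mu2| + 2 * `|beta| + `|mu1| by ring.
exact: (aux _ _ _ (normr_ge0 _) (normr_ge0 _)).
Qed.

End EnergyExpansion.

(** * Continuity of the energy and of the constrained gradient *)

Section GradientContinuity.
Context {R : realType} {T : Type} {F : set_system T} {FF : Filter F}.
Context (mu1 mu2 beta : R).
Notation V := (H1rad R).
Notation W := (H1rad R * H1rad R)%type.

Lemma cvg_kinetic (f : T -> W) (w : W) : f @ F --> w -> (fun t => kinetic (f t)) @ F --> kinetic w.
Proof.
move=> fw; have f1 : (fun t => (f t).1) @ F --> w.1 by apply: cvg_comp fw cvg_fst.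
have f2 : (fun t => (f t).2) @ F --> w.2 by apply: cvg_comp fw cvg_snd.
have -> : (fun t => kinetic (f t)) = (fun t => kdot (f t).1 (f t).1 + kdot (f t).2 (f t).2).
  by apply/funext => t; exact: kineticE.
by rewrite kineticE; apply: cvgD; exact: cvg_kdot.
Qed.

Lemma cvg_quartic (f : T -> W) (w : W) : f @ F --> w ->
  (fun t => quartic mu1 mu2 beta (f t)) @ F --> quartic mu1 mu2 beta w.
Proof.
move=> fw; have f1 : (fun t => (f t).1) @ F --> w.1 by apply: cvg_comp fw cvg_fst.
have f2 : (fun t => (f t).2) @ F --> w.2 by apply: cvg_comp fw cvg_snd.
rewrite quarticE; under eq_fun do rewrite quarticE.
apply: cvgD; first apply: cvgD.
all: by apply: cvgM; [exact: cvg_cst|exact: cvg_I4].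
Qed.

Lemma cvg_energy (f : T -> W) (w : W) : f @ F --> w ->
  (fun t => energy mu1 mu2 beta (f t)) @ F --> energy mu1 mu2 beta w.
Proof.
move=> fw; apply: cvgB; apply: cvgM; try exact: cvg_cst.
  exact: cvg_kinetic.
exact: cvg_quartic.
Qed.

Lemma cvg_tangent_part (f g : T -> V) u x : H1dot (mass_rep u) (mass_rep u) != 0 ->
  f @ F --> u -> g @ F --> x -> (fun t => tangent_part (f t) (g t)) @ F --> tangent_part u x.
Proof.
move=> u0 fu gx; have iu : (fun t => mass_rep (f t)) @ F --> mass_rep u by exact: cvg_mass_rep.
apply: cvgB => //; apply: cvgZ => //; apply: cvgM; first exact: cvg_hdot.
by apply: cvgV => //; exact: cvg_hdot.
Qed.

Lemma cvg_constrained_grad (f : T -> W) (w : W) :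
  H1dot (mass_rep w.1) (mass_rep w.1) != 0 -> H1dot (mass_rep w.2) (mass_rep w.2) != 0 -> f @ F --> w ->
  (fun t => constrained_grad mu1 mu2 beta (f t)) @ F --> constrained_grad mu1 mu2 beta w.
Proof.
move=> i1 i2 fw; have f1 : (fun t => (f t).1) @ F --> w.1 by apply: cvg_comp fw cvg_fst.
have f2 : (fun t => (f t).2) @ F --> w.2 by apply: cvg_comp fw cvg_snd.
have Z (c : R) (p q s : T -> V) x y z : p @ F --> x -> q @ F --> y -> s @ F --> z ->
    (fun t => c *: T3 (p t) (q t) (s t)) @ F --> c *: T3 x y z.
  by move=> px qy sz; apply: cvgZr; exact: cvg_T3.
have G c d (p q : T -> V) x y : p @ F --> x -> q @ F --> y ->
    (fun t => grad_part c d (p t) (q t)) @ F --> grad_part c d x y.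
  move=> px qy; rewrite /grad_part.
  by apply: cvgB; [apply: cvgB; [apply: cvgB => //; exact: cvg_mass_rep|exact: Z]|exact: Z].
have g1 := cvg_tangent_part i1 f1 (G mu1 beta _ _ _ _ f1 f2).
have g2 := cvg_tangent_part i2 f2 (G mu2 beta _ _ _ _ f2 f1).
exact: (cvg_pair g1 g2).
Qed.

End GradientContinuity.

(** * One step of normalised gradient descent *)

Section Descent.
Context {R : realType} (mu1 mu2 beta a1 a2 : R).
Hypotheses (a1_gt0 : 0 < a1) (a2_gt0 : 0 < a2).
Notation V := (H1rad R).
Notation W := (H1rad R * H1rad R)%type.
Notation Q := (quartic mu1 mu2 beta).
Notation J := (energy mu1 mu2 beta).
Notation P := (pohozaev a1 a2 mu1 mu2 beta).
Notation L := (qconst mu1 mu2 beta).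
Implicit Types (u v x y z : V) (w h : W).

(* The left-hand side is the energy of the point of the Pohozaev set on the
   dilation orbit of a pair with kinetic energy [K + x] and quartic energy
   [4 / 3 * K + y]; for [x = y = 0] its differential is that of the energy. *)
Lemma fiber_energy_le (K x y : R) : 0 < K -> `|x| <= K / 2 -> `|y| <= K / 2 ->
  8 / 27 * (K + x) ^+ 3 / (4 / 3 * K + y) ^+ 2 <=
  K / 6 + (x / 2 - y / 4) + 6 / K * (x ^+ 2 + y ^+ 2).
Proof.
move=> K0; have Kn : K != 0 by rewrite gt_eqF.
pose a := x / K; pose b := 3 / 4 * (y / K).
have xE : x = a * K by rewrite /a mulfVK.
have yE : y = 4 / 3 * b * K by rewrite /b; field.
move: a b xE yE => a b -> ->.
have hK (c : R) : `|c * K| <= K / 2 -> - 2^-1 <= c <= 2^-1.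
  by rewrite normrM (gtr0_norm K0) [K / 2]mulrC ler_pM2r// ler_norml.
move=> /hK/andP[a1' a2'] /hK/andP[b1' b2'].
have {}b1' : - 2^-1 <= b by lra.
have {}b2' : b <= 2^-1 by lra.
have bp : 0 < 1 + b by lra.
have -> : 4 / 3 * K + 4 / 3 * b * K = 4 / 3 * K * (1 + b) by ring.
have -> : K + a * K = K * (1 + a) by ring.
have -> : 8 / 27 * (K * (1 + a)) ^+ 3 / (4 / 3 * K * (1 + b)) ^+ 2 =
    K / 6 * ((1 + a) ^+ 3 / (1 + b) ^+ 2).
  by field; rewrite Kn gt_eqF.
(* Cleared of denominators, the error is at most [9 * (a ^+ 2 + b ^+ 2)]; as [(1 + b) ^+ 2 >= 1/4],
   the constant 36 absorbs it. *)
have key : (1 + a) ^+ 3 / (1 + b) ^+ 2 <= 1 + 3 * a - 2 * b + 36 * (a ^+ 2 + b ^+ 2).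
  rewrite ler_pdivrMr ?exprn_gt0//.
  have c1 : 0 <= a ^+ 2 * (2^-1 - a) by rewrite mulr_ge0 ?sqr_ge0//; lra.
  have c2 : 0 <= b ^+ 2 * (2^-1 + a) by rewrite mulr_ge0 ?sqr_ge0//; lra.
  have c3 : 0 <= b ^+ 2 * (2^-1 - b) by rewrite mulr_ge0 ?sqr_ge0//; lra.
  have c4 : 0 <= (a + b) ^+ 2 by exact: sqr_ge0.
  have c5 : 9 * (a ^+ 2 + b ^+ 2) <= 36 * (a ^+ 2 + b ^+ 2) * (1 + b) ^+ 2.
    have h4 : 1 <= 4 * (1 + b) ^+ 2 by nra.
    have ab0 : 0 <= 9 * (a ^+ 2 + b ^+ 2) by rewrite mulr_ge0// addr_ge0// sqr_ge0.
    by have := ler_wpM2l ab0 h4; lra.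
  rewrite mulrDl; apply: (@le_trans _ _ ((1 + 3 * a - 2 * b) * (1 + b) ^+ 2 + 9 * (a ^+ 2 + b ^+ 2))).
    by move: c1 c2 c3 c4; clear; move=> *; have := sqr_ge0 a; have := sqr_ge0 b; lra.
  by rewrite lerD2l.
have K6 : 0 <= K / 6 by lra.
apply: le_trans (ler_wpM2l K6 key) _.
have -> : K / 6 + (a * K / 2 - 4 / 3 * b * K / 4) + 6 / K * ((a * K) ^+ 2 + (4 / 3 * b * K) ^+ 2)
    = K / 6 * (1 + 3 * a - 2 * b) + 6 * K * (a ^+ 2 + 16 / 9 * b ^+ 2) by field.
have : 0 <= K * b ^+ 2 by rewrite mulr_ge0 ?sqr_ge0// ltW.
by move: (a ^+ 2) (b ^+ 2) => A B; lra.
Qed.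

(** For tangent [x] the root is the L^2 norm of [u - s *: x], by Pythagoras. In this form the
    denominator is positive for all arguments once [a] is, which makes continuity immediate. *)
Definition normalize (a : R) u (s : R) x : V :=
  (a / Num.sqrt (a ^+ 2 + s ^+ 2 * mdot x x)) *: (u - s *: x).

Lemma normalize_sphere (a : R) u s x : 0 < a -> sphere a u -> mdot u x = 0 ->
  sphere a (normalize a u s x).
Proof.
move=> a0 /sphereE ua ux; apply/sphereE; have ml := @mdot_linear R; have mC := @mdotC R.
rewrite /normalize (bformZl ml) (bformZr mC ml) (bformBl ml) !(bformBr mC ml).
rewrite !(bformZl ml) !(bformZr mC ml) (mC x u) ux ua.
set D := a ^+ 2 + s ^+ 2 * mdot x x.
have D0 : 0 < D by rewrite ltr_wpDr ?exprn_gt0// mulr_ge0 ?sqr_ge0// mdot_ge0.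
have -> : a ^+ 2 - s * 0 - (s * 0 - s * (s * mdot x x)) = D by rewrite /D; ring.
have sD : Num.sqrt D != 0 by rewrite sqrtr_eq0 -ltNge.
by rewrite -[X in _ * (_ * X)](sqr_sqrtr (ltW D0)); field.
Qed.

Lemma normalize0 (a : R) u x : 0 < a -> normalize a u 0 x = u.
Proof.
move=> a0; rewrite /normalize expr0n mul0r addr0 sqrtr_sqr gtr0_norm//.
by rewrite divff ?gt_eqF// scale1r scale0r subr0.
Qed.

(** Rescaling is a second-order correction: with [t] the new norm and [p = (t - a) * (t + a)], the
    factor differs from 1 by [(t - a) / t <= p / a ^+ 2]. The factor [2 * M] bounds [u - s *: x]. *)
Lemma normalize_near (a : R) u s x (M r : R) : 0 < a -> `|u| <= M -> s * `|x| <= r ->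
  0 <= s -> r <= M ->
  exists2 z, normalize a u s x = u + (- s *: x + z) & `|z| <= a ^- 2 * r ^+ 2 * (2 * M).
Proof.
move=> a0 uM xr s0 rM; exists ((a / Num.sqrt (a ^+ 2 + s ^+ 2 * mdot x x) - 1) *: (u - s *: x)).
  by rewrite /normalize scalerBl scale1r scaleNr [u + (_ + _)]addrA [u - _ + _]addrC subrK.
have sx0 : 0 <= s * `|x| by exact: mulr_ge0.
have pr : s ^+ 2 * mdot x x <= r ^+ 2.
  apply: (@le_trans _ _ ((s * `|x|) ^+ 2)); last by rewrite ler_sqr ?nnegrE ?(le_trans sx0).
  by rewrite exprMn ler_wpM2l ?sqr_ge0// H1_norm_sqr lerDl kdot_ge0.
have p0 : 0 <= s ^+ 2 * mdot x x by rewrite mulr_ge0 ?sqr_ge0 ?mdot_ge0.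
rewrite normrZ; apply: ler_pM => //.
  move: (s ^+ 2 * _) pr p0 => p pr p0.
  set t := Num.sqrt (a ^+ 2 + p).
  have tE : p = (t - a) * (t + a) by rewrite -subr_sqr sqr_sqrtr ?addr_ge0 ?sqr_ge0//; ring.
  have ta : a <= t.
    by rewrite -[leLHS]gtr0_norm// -sqrtr_sqr; apply: ler_wsqrtr; rewrite lerDl.
  have t0 : 0 < t by exact: lt_le_trans ta.
  have -> : a / t - 1 = - ((t - a) / t) by field; rewrite gt_eqF.
  rewrite normrN ger0_norm; last by rewrite divr_ge0 ?subr_ge0// ltW.
  rewrite ler_pdivrMr// -mulrA [a ^- 2 * _]mulrC ler_pdivlMr ?exprn_gt0// [r ^+ 2 * t]mulrC.
  apply: (@le_trans _ _ (t * p)); last by rewrite ler_wpM2l// ltW.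
  have ta0 : 0 <= t - a by rewrite subr_ge0.
  rewrite tE [t * _]mulrCA ler_wpM2l// expr2.
  by apply: ler_pM; rewrite ?(ltW a0)// lerDr ltW.
apply: le_trans (ler_normB _ _) _; rewrite normrZ (ger0_norm s0).
by rewrite mulrDl !mul1r; apply: lerD => //; exact: le_trans rM.
Qed.

Definition descend (s : R) w : W :=
  (normalize a1 w.1 s (constrained_grad mu1 mu2 beta w).1,
   normalize a2 w.2 s (constrained_grad mu1 mu2 beta w).2).

Lemma descend_mass s w : mass_constraint a1 a2 w -> mass_constraint a1 a2 (descend s w).
Proof.
move=> hw; have [t1 t2] := constrained_grad_tangent mu1 mu2 beta a1_gt0 a2_gt0 hw.
by case: hw => h1 h2; split; exact: normalize_sphere.
Qed.

Lemma descend0 w : descend 0 w = w.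
Proof. by case: w => u v; rewrite /descend /= !normalize0. Qed.

Lemma H1_norm_bound (a M : R) u : sphere a u -> a ^+ 2 + kdot u u <= M -> 1 <= M -> `|u| <= M.
Proof.
move=> /sphereE ua h M1; have M0 : 0 <= M by exact: le_trans M1.
rewrite -ler_sqr ?nnegrE// H1_norm_sqr ua; apply: le_trans h _.
by rewrite expr2 ler_peMl.
Qed.

Lemma pohozaevE w : P w -> Q w = 4 / 3 * kinetic w /\ J w = kinetic w / 6.
Proof. by move=> [_ h]; rewrite /energy; split; lra. Qed.

(** The displacement is [- s *: G + z] with [z] quadratic in the step length [r], and [H * r] bounds
    it altogether. The differential applied to [- s *: G] is exactly [- s * g ^+ 2]; all other terms
    are of order [r ^+ 2]. The constants are [6 = 4 + 2] and [15 = 4 + 11], each a first-order part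
    and a remainder. *)
Lemma descend_le (M b r s : R) w :
  let H := 1 + 2 * b * M in let g := pair_norm (constrained_grad mu1 mu2 beta w) in
  mass_constraint a1 a2 w -> `|w.1| <= M -> `|w.2| <= M -> 1 <= M ->
  a1 ^- 2 <= b -> a2 ^- 2 <= b -> 0 <= s -> s * g = r -> H * r <= 1 ->
  [/\ `|kinetic (descend s w) - kinetic w| <= 6 * M * H * r,
      `|Q (descend s w) - Q w| <= 15 * L * M ^+ 3 * H * r &
      J (descend s w) - J w <= - s * g ^+ 2 +
        ((2 * M + L * M ^+ 3) * (2 * b * M) + (1 + 3 * L * M ^+ 2) * H ^+ 2) * r ^+ 2].
Proof.
move=> H g hw uM vM M1 ab1 ab2 s0 sg Hr.
have M0 : 0 <= M by lra.
have b0 : 0 <= b by apply: le_trans ab1; rewrite invr_ge0 exprn_ge0// ltW.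
have bM0 : 0 <= b * M by exact: mulr_ge0.
have g0 : 0 <= g by exact: sqrtr_ge0.
have r0 : 0 <= r by rewrite -sg mulr_ge0.
have H1 : 1 <= H by rewrite /H; lra.
have r1 : r <= 1 by apply: le_trans Hr; rewrite ler_peMl.
have rM : r <= M by lra.
pose G := constrained_grad mu1 mu2 beta w.
have n1 : s * `|G.1| <= r by rewrite -sg ler_wpM2l// pair_norm1.
have n2 : s * `|G.2| <= r by rewrite -sg ler_wpM2l// pair_norm2.
have [z1 e1 z1r] := normalize_near a1_gt0 uM n1 s0 rM.
have [z2 e2 z2r] := normalize_near a2_gt0 vM n2 s0 rM.
pose z : W := (z1, z2); pose h : W := (- s *: G.1 + z1, - s *: G.2 + z2).
have hE : h = - s *: G + z by [].
have dE : descend s w = w + h by rewrite /descend e1 e2; case: (w).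
have q0 : 0 <= r ^+ 2 * (2 * M) by rewrite mulr_ge0 ?sqr_ge0// mulr_ge0.
have zb (c : R) (zi : V) : c <= b -> `|zi| <= c * r ^+ 2 * (2 * M) -> `|zi| <= 2 * b * M * r ^+ 2.
  move=> cb /le_trans; apply; rewrite -mulrA; apply: le_trans (ler_wpM2r q0 cb) _.
  by apply: le_of_eq; ring.
have {}z1r := zb _ _ ab1 z1r; have {}z2r := zb _ _ ab2 z2r.
have rr : 2 * b * M * r ^+ 2 <= 2 * b * M * r.
  by rewrite ler_wpM2l//; [rewrite -mulrA mulr_ge0|rewrite expr2 ler_piMl].
have hb (x zi : V) : s * `|x| <= r -> `|zi| <= 2 * b * M * r ^+ 2 -> `|- s *: x + zi| <= H * r.
  move=> xr zr; apply: le_trans (ler_normD _ _) _; rewrite normrZ normrN (ger0_norm s0).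
  by have -> : H * r = r + 2 * b * M * r; [rewrite /H; ring|exact: lerD xr (le_trans zr rr)].
have h1 : `|h.1| <= H * r := hb _ _ n1 z1r.
have h2 : `|h.2| <= H * r := hb _ _ n2 z2r.
clear hb zb rr e1 e2; have HrM : H * r <= M by exact: le_trans Hr M1.
have Hr0 : 0 <= H * r by apply: mulr_ge0 => //; exact: le_trans ler01 H1.
have L0 := qconst_ge0 mu1 mu2 beta.
rewrite dE; have kE := kinetic_expand w h.
have k1 := kd_le uM vM h1 h2; have k2 := kinetic_le h1 h2; have k3 := kinetic_ge0 h.
have q1 := quartic_expand mu1 mu2 beta uM vM h1 h2 HrM.
have q2 := qd_le mu1 mu2 beta uM vM h1 h2.
have j1 := energy_expand mu1 mu2 beta uM vM h1 h2 HrM.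
have d1 := kd_le (h := z) uM vM z1r z2r; have d2 := qd_le mu1 mu2 beta (h := z) uM vM z1r z2r.
have dz : energy_diff mu1 mu2 beta w h = - s * g ^+ 2 + (kd w z - qd mu1 mu2 beta w z).
  rewrite -energy_diffE -(energy_diff_grad mu1 mu2 beta a1_gt0 a2_gt0 hw).
  by rewrite hE; exact: energy_diff_linear.
have sq : (H * r) ^+ 2 <= H * r by rewrite expr2 ler_piMl.
have MHr : H * r <= M * (H * r) by rewrite ler_peMl.
split.
- rewrite kE; have -> : 6 * M * H * r = 6 * (M * (H * r)) by ring.
  move: k1 k2 k3 sq MHr; clear; move: (kd w h) (kinetic h) (kinetic w) (H * r) => A B C D.
  move: (M * D) => E; rewrite !ler_norml => /andP[? ?] ? ? ? ?.
  by apply/andP; split; lra.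
- have -> : 15 * L * M ^+ 3 * H * r = 15 * (L * (M ^+ 3 * (H * r))) by ring.
  have h3 : L * (M ^+ 2 * (H * r) ^+ 2) <= L * (M ^+ 3 * (H * r)).
    rewrite ler_wpM2l//; have -> : M ^+ 3 * (H * r) = M ^+ 2 * (M * (H * r)) by ring.
    by rewrite ler_wpM2l ?sqr_ge0//; exact: le_trans sq MHr.
  move: q1 q2 h3; clear; move: (Q (w + h)) (Q w) (qd _ _ _ w h) => A B C.
  move: (L * _) (L * _) => D E; rewrite !ler_norml => /andP[? ?] /andP[? ?] ?.
  by apply/andP; split; lra.
- have -> : ((2 * M + L * M ^+ 3) * (2 * b * M) + (1 + 3 * L * M ^+ 2) * H ^+ 2) * r ^+ 2 =
    2 * (M * (2 * b * M * r ^+ 2)) + L * (M ^+ 3 * (2 * b * M * r ^+ 2)) +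
    (1 + 3 * L * M ^+ 2) * (H * r) ^+ 2 by ring.
  move: j1 d1 d2; rewrite dz; clear.
  move: (J (w + h)) (J w) (kd w z) (qd _ _ _ w z) (- s * _) => A B C D E.
  move: (2 * (M * _)) (L * _) (_ * (H * r) ^+ 2) => A' B' C'.
  by rewrite !ler_norml => /andP[? ?] /andP[? ?] /andP[? ?]; lra.
Qed.

(** The bound [K1] and the masses confine the point to a ball of radius [M], on which the constants
    are uniform; [K0] keeps the increments of both energies small relative to the kinetic energy, as
    [fiber_energy_le] asks. Half of the gain [s * g ^+ 2] pays for the quadratic errors. *)
Lemma descent_step (K0 K1 : R) : 0 < K0 -> exists2 s0, 0 < s0 &
  forall w s, P w -> K0 <= kinetic w <= K1 -> 0 <= s <= s0 ->
  [/\ 0 < kinetic (descend s w), 0 < Q (descend s w) &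
      8 / 27 * kinetic (descend s w) ^+ 3 / Q (descend s w) ^+ 2 <=
      J w - s / 2 * pair_norm (constrained_grad mu1 mu2 beta w) ^+ 2].
Proof.
move=> K0p.
pose M := 1 + a1 ^+ 2 + a2 ^+ 2 + `|K1|.
pose b := a1 ^- 2 + a2 ^- 2.
pose H := 1 + 2 * b * M.
pose Gam := 2 * (2 * M + L * M ^+ 3).
pose X := 6 * M * H; pose Y := 15 * L * M ^+ 3 * H.
pose C1 := (2 * M + L * M ^+ 3) * (2 * b * M) + (1 + 3 * L * M ^+ 2) * H ^+ 2.
pose C := C1 + 6 / K0 * (X ^+ 2 + Y ^+ 2).
have L0 := qconst_ge0 mu1 mu2 beta.
have A1 : 0 <= a1 ^+ 2 by exact: sqr_ge0.
have A2 : 0 <= a2 ^+ 2 by exact: sqr_ge0.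
have M1 : 1 <= M by have := normr_ge0 K1; rewrite /M; lra.
have M0 : 0 <= M by lra.
have i1 : 0 <= a1 ^- 2 by rewrite invr_ge0.
have i2 : 0 <= a2 ^- 2 by rewrite invr_ge0.
have b0 : 0 <= b by exact: addr_ge0.
have ab1 : a1 ^- 2 <= b by rewrite lerDl.
have ab2 : a2 ^- 2 <= b by rewrite lerDr.
have bM0 : 0 <= 2 * b * M by rewrite -mulrA mulr_ge0// mulr_ge0.
have H0 : 0 <= H by rewrite /H; lra.
have M3 n : 0 <= L * M ^+ n by rewrite mulr_ge0// exprn_ge0.
have Gam0 : 0 <= Gam by rewrite mulr_ge0// addr_ge0// mulr_ge0.
have X0 : 0 <= X by rewrite mulr_ge0// mulr_ge0.
have Y0 : 0 <= Y by rewrite mulr_ge0// -mulrA mulr_ge0.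
have C10 : 0 <= C1.
  apply: addr_ge0; apply: mulr_ge0 => //; last exact: sqr_ge0.
    by apply: addr_ge0 => //; exact: mulr_ge0.
  by apply: addr_ge0 => //; rewrite -mulrA mulr_ge0.
have K00 : 0 <= 6 / K0 by rewrite divr_ge0// ltW.
have C30 : 0 <= 6 / K0 * (X ^+ 2 + Y ^+ 2) by rewrite mulr_ge0// addr_ge0// sqr_ge0.
have C0 : 0 <= C by exact: addr_ge0.
(* Apart from the 1, which keeps [D] positive, each summand enforces one condition for [s <= D^-1]:
   displacement at most 1, increments of either energy at most [K0 / 2], quadratic error at most
   half the gain. *)
pose D := 1 + Gam * H + Gam * (2 * X / K0) + Gam * (2 * Y / K0) + 2 * C.
have d1 : 0 <= Gam * H by exact: mulr_ge0.
have d2 : 0 <= Gam * (2 * X / K0) by rewrite mulr_ge0// divr_ge0 ?(ltW K0p)// mulr_ge0.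
have d3 : 0 <= Gam * (2 * Y / K0) by rewrite mulr_ge0// divr_ge0 ?(ltW K0p)// mulr_ge0.
have D0 : 0 < D by rewrite /D; lra.
exists D^-1; first by rewrite invr_gt0.
move=> w s Pw /andP[wK0 wK1] /andP[s0 sD].
have sD1 c : 0 <= c -> c <= D -> s * c <= 1.
  move=> c0 cD; apply: (@le_trans _ _ (D^-1 * D)); last by rewrite mulVf// gt_eqF.
  exact: ler_pM.
have K1M : kinetic w <= `|K1| by exact: le_trans wK1 (ler_norm _).
have [k1 k2] : kdot w.1 w.1 <= `|K1| /\ kdot w.2 w.2 <= `|K1|.
  move: K1M; rewrite kineticE; have := kdot_ge0 w.1; have := kdot_ge0 w.2.
  by move: (kdot w.1 _) (kdot w.2 _) => *; split; lra.
have hw : mass_constraint a1 a2 w by case: Pw.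
have uM : `|w.1| <= M by apply: (H1_norm_bound hw.1) => //; rewrite /M; lra.
have vM : `|w.2| <= M by apply: (H1_norm_bound hw.2) => //; rewrite /M; lra.
set g := pair_norm (constrained_grad mu1 mu2 beta w).
have g0 : 0 <= g by exact: sqrtr_ge0.
have gG : g <= Gam by exact: (constrained_grad_le mu1 mu2 beta a1_gt0 a2_gt0 hw uM vM).
pose r := s * g; have r0 : 0 <= r by exact: mulr_ge0.
have rc c : 0 <= c -> Gam * c <= D -> c * r <= 1.
  move=> c0 cD; apply: le_trans (sD1 (Gam * c) _ cD); last exact: mulr_ge0.
  by rewrite /r mulrC -mulrA ler_wpM2l// ler_wpM2r.
have Hr : H * r <= 1 by apply: rc => //; rewrite /D; lra.
have Xr : X * r <= K0 / 2.
  have : 2 * X / K0 * r <= 1.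
    by apply: rc; [rewrite divr_ge0 ?(ltW K0p)// mulr_ge0|rewrite /D; lra].
  have -> : 2 * X / K0 * r = 2 * (X * r) / K0 by ring.
  by rewrite ler_pdivrMr// mul1r; lra.
have Yr : Y * r <= K0 / 2.
  have : 2 * Y / K0 * r <= 1.
    by apply: rc; [rewrite divr_ge0 ?(ltW K0p)// mulr_ge0|rewrite /D; lra].
  have -> : 2 * Y / K0 * r = 2 * (Y * r) / K0 by ring.
  by rewrite ler_pdivrMr// mul1r; lra.
have sC : s * (2 * C) <= 1 by apply: sD1; rewrite ?mulr_ge0// /D; lra.
have [kx qy jj] := descend_le hw uM vM M1 ab1 ab2 s0 (erefl : s * g = r) Hr.
have [QE JE] := pohozaevE Pw.
set x := kinetic (descend s w) - kinetic w in kx; set y := Q (descend s w) - Q w in qy.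
rewrite -/X in kx; rewrite -/Y in qy; rewrite -/C1 -/g in jj.
set K := kinetic w in wK0 wK1 QE JE x kx *.
have KE : kinetic (descend s w) = K + x by rewrite /x addrC subrK.
have QE' : Q (descend s w) = 4 / 3 * K + y by rewrite /y QE addrC subrK.
have Kp : 0 < K by exact: lt_le_trans wK0.
have K02 : K0 / 2 <= K / 2 by rewrite ler_wpM2r.
have xK : `|x| <= K / 2 by exact: le_trans kx (le_trans Xr K02).
have yK : `|y| <= K / 2 by exact: le_trans qy (le_trans Yr K02).
rewrite KE QE'; split.
- by move: xK Kp; rewrite ler_norml; clear; move=> /andP[? ?] ?; lra.
- by move: yK Kp; rewrite ler_norml; clear; move=> /andP[? ?] ?; lra.
apply: le_trans (fiber_energy_le Kp xK yK) _.
have e1 : x / 2 - y / 4 = J (descend s w) - J w.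
  by rewrite /energy KE QE' QE -/K; ring.
have sqb (p q : R) : `|p| <= q * r -> p ^+ 2 <= q ^+ 2 * r ^+ 2.
  move=> pq; rewrite -exprMn -real_normK ?num_real// ler_sqr ?nnegrE//.
  exact: le_trans pq.
have e2 : 6 / K * (x ^+ 2 + y ^+ 2) <= 6 / K0 * (X ^+ 2 + Y ^+ 2) * r ^+ 2.
  rewrite -[leRHS]mulrA; apply: ler_pM.
  - by rewrite divr_ge0// ltW.
  - by rewrite addr_ge0// sqr_ge0.
  - by rewrite ler_wpM2l// lef_pV2 ?posrE.
  - by rewrite mulrDl; apply: lerD; exact: sqb.
have e3 : C * r ^+ 2 <= s / 2 * g ^+ 2.
  have -> : C * r ^+ 2 = s * (2 * C) * (s / 2 * g ^+ 2) by rewrite /r; field.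
  by rewrite ler_piMl// mulr_ge0 ?sqr_ge0// divr_ge0.
rewrite e1 JE; move: e2 e3 jj; rewrite /C (mulrDl C1) JE; clear.
move: (J (descend s w)) (6 / K * _) (C1 * _) (_ * r ^+ 2) (g ^+ 2) (K / 6) => *.
lra.
Qed.

End Descent.

(** * Deformation of the Pohozaev set *)

Section Clamp.
Context {R : realType}.
Implicit Types x : R.

(** Truncation to the unit interval, by absolute values so that continuity is that of the norm. *)
Definition clamp x : R := (`|x| - `|x - 1| + 1) / 2.

Lemma clamp_itv x : 0 <= clamp x <= 1.
Proof.
have h1 := ler_normD x (-1); have h2 := ler_normB (x - 1) (-1).
move: h1 h2; rewrite opprK subrK !normrN normr1 /clamp.
by move: `|x| `|x - 1| => a b ? ?; apply/andP; split; lra.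
Qed.

Lemma clamp0 x : x <= 0 -> clamp x = 0.
Proof. by move=> x0; rewrite /clamp !ler0_norm; lra. Qed.

Lemma clamp1 x : 1 <= x -> clamp x = 1.
Proof. by move=> x1; rewrite /clamp !ger0_norm; lra. Qed.

Lemma cvg_clamp (T : Type) (F : set_system T) (FF : Filter F) (f : T -> R) x :
  f @ F --> x -> (fun t => clamp (f t)) @ F --> clamp x.
Proof.
move=> fx; apply: cvgM; last exact: cvg_cst.
apply: cvgD; last exact: cvg_cst.
apply: cvgB; apply: cvg_norm => //; apply: cvgB => //; exact: cvg_cst.
Qed.

End Clamp.

Section Deformation.
Context {R : realType} (mu1 mu2 beta a1 a2 : R).
Hypotheses (a1_gt0 : 0 < a1) (a2_gt0 : 0 < a2).
Notation V := (H1rad R).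
Notation W := (H1rad R * H1rad R)%type.
Notation Q := (quartic mu1 mu2 beta).
Notation J := (energy mu1 mu2 beta).
Notation P := (pohozaev a1 a2 mu1 mu2 beta).
Notation g := (constrained_grad mu1 mu2 beta).
Notation descend := (descend mu1 mu2 beta a1 a2).
Implicit Types (u v x y z : V) (w h : W).

(* Dilating by [l] multiplies the kinetic energy by [l^2] and the quartic one by
   [l^3]; this [l] makes the former 3/4 of the latter. *)
Definition project w : W :=
  let l := 4 / 3 * (kinetic w / Q w) in (dilate l w.1, dilate l w.2).

Lemma project_pohozaev w : mass_constraint a1 a2 w -> 0 < kinetic w -> 0 < Q w ->
  P (project w) /\ J (project w) = 8 / 27 * kinetic w ^+ 3 / Q w ^+ 2.
Proof.
move=> [/sphereE h1 /sphereE h2] K0 Q0; pose l := 4 / 3 * (kinetic w / Q w).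
have l0 : 0 < l by rewrite mulr_gt0// divr_gt0.
have pE : project w = (dilate l w.1, dilate l w.2) by [].
have kE : kinetic (project w) = l ^+ 2 * kinetic w.
  by rewrite pE !kineticE /= !(kdot_dilate _ _ l0) mulrDr.
have qE : Q (project w) = l ^+ 3 * Q w.
  rewrite pE !quarticE /= !(I4_dilate _ _ _ _ l0).
  by move: (I4 _ _ _ _) (I4 w.1 w.1 w.2 w.2) (I4 w.2 w.2 w.2 w.2) => *; ring.
have Q0' : Q w != 0 by rewrite gt_eqF.
split; last by rewrite /energy kE qE /l; field.
split; last by rewrite kE qE /l; field.
by split; apply/sphereE; rewrite pE (mdot_dilate _ _ l0).
Qed.

Lemma project_id w : P w -> 0 < kinetic w -> project w = w.
Proof.
case: w => u v Pw K0; have [QE _] := pohozaevE Pw.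
have l1 : 4 / 3 * (kinetic (u, v) / Q (u, v)) = 1 by rewrite QE; field; rewrite gt_eqF.
by rewrite /project l1 /= !dilate1.
Qed.

Section Cvg.
Context {T : Type} {F : set_system T} {FF : Filter F}.

Lemma cvg_project (f : T -> W) w : 0 < kinetic w -> 0 < Q w -> f @ F --> w ->
  (fun t => project (f t)) @ F --> project w.
Proof.
move=> K0 Q0 fw; have f1 : (fun t => (f t).1) @ F --> w.1 by apply: cvg_comp fw cvg_fst.
have f2 : (fun t => (f t).2) @ F --> w.2 by apply: cvg_comp fw cvg_snd.
have l0 : 0 < 4 / 3 * (kinetic w / Q w) by rewrite mulr_gt0// divr_gt0.
have ll : (fun t => 4 / 3 * (kinetic (f t) / Q (f t))) @ F --> 4 / 3 * (kinetic w / Q w).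
  apply: cvgM; first exact: cvg_cst.
  apply: cvgM; first exact: cvg_kinetic.
  by apply: cvgV; [rewrite gt_eqF|exact: cvg_quartic].
exact: (cvg_pair (cvg_dilate l0 ll f1) (cvg_dilate l0 ll f2)).
Qed.

Lemma cvg_normalize (a : R) (f h : T -> V) (s : T -> R) u x s0 : 0 < a ->
  f @ F --> u -> h @ F --> x -> s @ F --> s0 ->
  (fun t => normalize a (f t) (s t) (h t)) @ F --> normalize a u s0 x.
Proof.
move=> a0 fu hx ss.
have D0 : 0 < a ^+ 2 + s0 ^+ 2 * mdot x x.
  by rewrite ltr_wpDr ?exprn_gt0// mulr_ge0 ?sqr_ge0 ?mdot_ge0.
have s2 : (fun t => s t ^+ 2) @ F --> s0 ^+ 2.
  by under eq_fun do rewrite expr2; rewrite expr2; exact: cvgM.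
have DD : (fun t => a ^+ 2 + s t ^+ 2 * mdot (h t) (h t)) @ F --> a ^+ 2 + s0 ^+ 2 * mdot x x.
  by apply: cvgD; [exact: cvg_cst|apply: cvgM => //; exact: cvg_mdot].
apply: cvgZ; last by apply: cvgB => //; exact: cvgZ.
apply: cvgM; first exact: cvg_cst.
apply: cvgV; first by rewrite sqrtr_eq0 -ltNge.
by apply: continuous_cvg DD; exact: sqrt_continuous.
Qed.

Lemma cvg_descend (f : T -> W) (s : T -> R) w s0 : mass_constraint a1 a2 w ->
  f @ F --> w -> s @ F --> s0 -> (fun t => descend (s t) (f t)) @ F --> descend s0 w.
Proof.
move=> hw fw ss; have f1 : (fun t => (f t).1) @ F --> w.1 by apply: cvg_comp fw cvg_fst.
have f2 : (fun t => (f t).2) @ F --> w.2 by apply: cvg_comp fw cvg_snd.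
have [i1 i2] := constraint_mass_rep a1_gt0 a2_gt0 hw.
have gg : (fun t => g (f t)) @ F --> g w by exact: cvg_constrained_grad.
have g1 : (fun t => (g (f t)).1) @ F --> (g w).1 by apply: cvg_comp gg cvg_fst.
have g2 : (fun t => (g (f t)).2) @ F --> (g w).2 by apply: cvg_comp gg cvg_snd.
exact: (cvg_pair (cvg_normalize a1_gt0 f1 g1 ss) (cvg_normalize a2_gt0 f2 g2 ss)).
Qed.

End Cvg.

(** The time [t] scales the length of the step, which is followed by the projection. A cut-off in
    the energy freezes low energies, and high ones, where no uniform step length is available. *)
Lemma deformation (d c : R) : 0 < d -> d < c ->
  exists (s1 e1 : R) (eta : R * W -> W), [/\ 0 < s1, 0 < e1,
    {within `[0, 1]%classic `*` P, continuous eta},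
    forall t w, 0 <= t <= 1 -> P w -> P (eta (t, w)) &
    [/\ forall w, P w -> eta (0, w) = w,
      forall t w, J w <= d -> eta (t, w) = w,
      forall w, P w -> J (eta (1, w)) <= J w &
      forall w, P w -> c - e1 <= J w <= c + e1 ->
        J (eta (1, w)) <= J w - s1 * pair_norm (g w) ^+ 2]].
Proof.
move=> d0 dc.
(* On the Pohozaev set the kinetic energy is [6 * J], so these bounds cover the energies between [d]
   and [c + 2]. *)
have [s0 s0p step] := @descent_step R mu1 mu2 beta a1 a2 a1_gt0 a2_gt0 (6 * d) (6 * (c + 2))
  (mulr_gt0 (ltr0n _ 6) d0).
(* The cut-off vanishes up to [d'], strictly above [d]: on the Pohozaev set the two branches of
   [eta] then agree for energies between [d] and [d'], which gives continuity across the level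
   [d]. *)
pose d' := (d + c) / 2; pose e := (c - d') / 2.
have dd' : d < d' by rewrite /d'; lra.
have e0 : 0 < e by rewrite /e /d'; lra.
pose chi j := clamp ((j - d') / e) * clamp (c + 2 - j).
have chi_itv j : 0 <= chi j <= 1.
  have /andP[p0 p1] := clamp_itv ((j - d') / e); have /andP[q0 q1] := clamp_itv (c + 2 - j).
  by rewrite /chi mulr_ge0//= mulr_ile1.
have chi_low j : j <= d' -> chi j = 0.
  by move=> jd; rewrite /chi clamp0 ?mul0r// pmulr_lle0 ?invr_gt0// subr_le0.
have chi_high j : c + 2 <= j -> chi j = 0.
  by move=> cj; rewrite /chi [X in _ * X]clamp0 ?mulr0// subr_le0.
pose e1 := Num.min e 1.
have chi_mid j : c - e1 <= j <= c + e1 -> chi j = 1.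
  have : e1 <= e by rewrite /e1 ge_min lexx.
  have : e1 <= 1 by rewrite /e1 ge_min lexx orbT.
  move=> e11 e1e /andP[j1 j2]; rewrite /chi !clamp1 ?mulr1//; first by lra.
  by rewrite ler_pdivlMr// mul1r; move: e1e; rewrite /e; lra.
pose s t w := t * (s0 * chi (J w)).
pose phi (p : R * W) := project (descend (s p.1 p.2) p.2).
pose eta (p : R * W) := if J p.2 <= d then p.2 else phi p.
have good t w : 0 <= t <= 1 -> P w -> d < J w ->
    [/\ 0 < kinetic (descend (s t w) w), 0 < Q (descend (s t w) w) &
      8 / 27 * kinetic (descend (s t w) w) ^+ 3 / Q (descend (s t w) w) ^+ 2 <=
      J w - s t w / 2 * pair_norm (g w) ^+ 2].
  move=> /andP[t0 t1] Pw dw; have [QE JE] := pohozaevE Pw.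
  have /andP[c0 c1] := chi_itv (J w).
  have [Jc|Jc] := leP (J w) (c + 2).
    apply: step => //; first by apply/andP; split; lra.
    have s00 : 0 <= s0 * chi (J w) by rewrite mulr_ge0// ltW.
    rewrite /s mulr_ge0//=; apply: le_trans (ler_piMl s00 t1) _.
    by rewrite ler_piMr// ltW.
  (* Above [c + 2] the step has length 0, and the closed formula returns the energy of the point
     itself. *)
  rewrite /s (chi_high _ (ltW Jc)) !mulr0 descend0// mul0r mul0r subr0.
  have K0 : 0 < kinetic w by lra.
  split => //; rewrite QE; first by rewrite mulr_gt0.
  by rewrite JE; apply: le_of_eq; field; rewrite gt_eqF.
have phi_good t w : 0 <= t <= 1 -> P w -> d < J w ->
    P (phi (t, w)) /\ J (phi (t, w)) <= J w - s t w / 2 * pair_norm (g w) ^+ 2.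
  move=> t01 Pw dw; have [K0 Q0 h] := good _ _ t01 Pw dw.
  have hw : mass_constraint a1 a2 w by case: Pw.
  have [h1 h2] := project_pohozaev (descend_mass mu1 mu2 beta a1_gt0 a2_gt0 (s t w) hw) K0 Q0.
  by split => //; rewrite /phi /= h2.
have phi_id t w : P w -> d < J w -> s t w = 0 -> phi (t, w) = w.
  move=> Pw dw s00; rewrite /phi /= s00 descend0// project_id//.
  by have [_ JE] := pohozaevE Pw; lra.
exists (s0 / 2), e1, eta; split.
- by rewrite divr_gt0.
- by rewrite lt_min e0 ltr01.
- apply/subspace_continuousP => -[t w] [/= t01 Pw].
  set A := `[0, 1]%classic `*` P.
  have FA : Filter (within A (nbhs (t, w))) by exact: within_filter.
  have c2 : (fun p : R * W => p.2) @ within A (nbhs (t, w)) --> w.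
    move=> U hU; have h : nbhs (t, w) [set p : R * W | U p.2] by exact: cvg_snd hU.
    exact: (filterS (fun p Up (_ : A p) => Up) h).
  have c1 : (fun p : R * W => p.1) @ within A (nbhs (t, w)) --> t.
    move=> U hU; have h : nbhs (t, w) [set p : R * W | U p.1] by exact: cvg_fst hU.
    exact: (filterS (fun p Up (_ : A p) => Up) h).
  have cJ : (fun p : R * W => J p.2) @ within A (nbhs (t, w)) --> J w by exact: cvg_energy.
  change (eta @ within A (nbhs (t, w)) --> eta (t, w)).
  have [Jw|Jw] := leP (J w) d.
    have -> : eta (t, w) = w by rewrite /eta /= Jw.
    apply: cvg_trans c2; apply: near_eq_cvg.
    have nJ : \forall p \near within A (nbhs (t, w)), J p.2 < d'.
      by apply: (cvgr_lt _ cJ); exact: le_lt_trans dd'.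
    have nA : \forall p \near within A (nbhs (t, w)), A p by exact: withinT.
    apply: filterS2 nJ nA => -[t' w'] /= Jd [_ Pw'].
    rewrite /eta /=; case: leP => // dw'; apply/esym/phi_id => //.
    by rewrite /s (chi_low _ (ltW Jd)) !mulr0.
  have hw : mass_constraint a1 a2 w by case: Pw.
  have -> : eta (t, w) = phi (t, w) by rewrite /eta /= leNgt Jw.
  have [K0 Q0 _] := good t w t01 Pw Jw.
  have cs : (fun p : R * W => s p.1 p.2) @ within A (nbhs (t, w)) --> s t w.
    apply: cvgM => //; apply: cvgM; first exact: cvg_cst.
    apply: cvgM; apply: cvg_clamp.
      by apply: cvgM; [apply: cvgB => //|]; exact: cvg_cst.
    by apply: cvgB => //; exact: cvg_cst.
  have cphi : phi @ within A (nbhs (t, w)) --> phi (t, w).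
    by apply: cvg_project => //; exact: cvg_descend.
  apply: cvg_trans cphi; apply: near_eq_cvg.
  have nJ : \forall p \near within A (nbhs (t, w)), d < J p.2 by exact: (cvgr_gt _ cJ).
  by apply: filterS nJ => p dp; rewrite /eta leNgt dp.
- move=> t w t01 Pw; rewrite /eta /=; case: leP => // dw.
  exact: (phi_good t w t01 Pw dw).1.
split.
- move=> w Pw; rewrite /eta /=; case: leP => // dw; apply: phi_id => //.
  by rewrite /s mul0r.
- by move=> t w Jw; rewrite /eta /= Jw.
- move=> w Pw; rewrite /eta /=; have [//|dw] := leP (J w) d.
  have t01 : 0 <= (1 : R) <= 1 by rewrite ler01 lexx.
  apply: le_trans (phi_good 1 w t01 Pw dw).2 _.
  have /andP[x0 _] := chi_itv (J w).
  by rewrite gerBl mulr_ge0 ?sqr_ge0// divr_ge0// /s mul1r mulr_ge0// ltW.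
- move=> w Pw /[dup] Jc /chi_mid x1.
  have t01 : 0 <= (1 : R) <= 1 by rewrite ler01 lexx.
  have dw : d < J w.
    have e1e : e1 <= e by rewrite /e1 ge_min lexx.
    by move: Jc e1e => /andP[? _]; rewrite /e /d'; lra.
  have -> : eta (1, w) = phi (1, w) by rewrite /eta /= leNgt dw.
  by have := (phi_good 1 w t01 Pw dw).2; rewrite /s x1 mul1r mulr1.
Qed.

End Deformation.

(** * The minimax argument *)

Lemma descent_arith (R : realType) (c e e' j j' q : R) : e' <= e / 2 -> c - e' < j -> j < c + e' ->
  0 < e -> c - e' < j' -> j' <= j - q -> `|j - c| <= e /\ q <= e.
Proof. by move=> *; rewrite ler_norml; split; [apply/andP; split|]; lra. Qed.

Section PalaisSmale.
Context {R : realType} (a1 a2 mu1 mu2 beta : R).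
Hypotheses (a1_gt0 : 0 < a1) (a2_gt0 : 0 < a2).
Notation W := (H1rad R * H1rad R)%type.
Notation J := (energy mu1 mu2 beta).
Notation P := (pohozaev a1 a2 mu1 mu2 beta).
Notation g := (constrained_grad mu1 mu2 beta).
Implicit Types (A B : set W) (F G : set (set W)) (w : W).

(** The deformed set is still in the family, so some point of [A] ends above [c - e'] although it
    started below [c + e']. It lost less than [2 * e'], and the loss dominates the squared gradient.
    As [e'] is independent of [A], every almost optimal set contains such a point. *)
Lemma almost_critical_point B F (c : R) : homotopy_stable R P B F ->
  (maxe (sup_on J B) 0 < c%:E)%E -> minimax_level J F = c%:E ->
  exists2 s1 : R, 0 < s1 & forall e, 0 < e -> exists2 e', 0 < e' & forall A, F A ->
    (sup_on J A < (c + e')%:E)%E ->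
    exists w, [/\ A w, P w, `|J w - c| <= e & s1 * pair_norm (g w) ^+ 2 <= e].
Proof.
move=> [_ FcP FB Fstable] Bc cE.
have [m mE m0] : exists2 m : R, maxe (sup_on J B) 0 = m%:E & 0 <= m.
  have h0 : (0 <= maxe (sup_on J B) 0)%E by rewrite le_max lexx orbT.
  move: Bc h0; case: (maxe _ _) => [m _|//|//].
  by rewrite lee_fin => m0; exists m.
have mc : m < c by move: Bc; rewrite mE lte_fin.
(* The number [m] may be 0, while the deformation needs a positive threshold; energies on [B] stay
   below it. *)
have [d [d0 md dc]] : exists d, [/\ 0 < d, m <= d & d < c].
  exists ((m + c) / 2); split; last exact: (midf_lt mc).2.
    by rewrite divr_gt0// ltr_wpDl// (le_lt_trans m0).
  exact: ltW (midf_lt mc).1.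
have Bd w : B w -> J w <= d.
  move=> Bw; have h : ((J w)%:E <= m%:E)%E.
    rewrite -mE le_max; apply/orP; left.
    by apply: ereal_sup_ubound; exists w.
  by move: h; rewrite lee_fin => /le_trans; exact.
have [s1 [e1 [eta [s1p e1p eta_c etaP [eta0 eta_d eta_le eta_dec]]]]] :=
  deformation mu1 mu2 beta a1_gt0 a2_gt0 d0 dc.
(* Below [e1] the cut-off is 1 on the whole energy band, and [2 * e' <= e] bounds the loss. *)
exists s1 => // e e0; exists (Num.min e1 (e / 2)).
  by rewrite lt_min e1p divr_gt0.
set e' := Num.min e1 (e / 2).
have e'1 : e' <= e1 by rewrite /e' ge_min lexx.
have e'2 : e' <= e / 2 by rewrite /e' ge_min lexx orbT.
move=> A FA supA; have [_ AP] := FcP _ FA.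
pose A' : set W := eta @` ([set (1 : R)] `*` A).
have FA' : F A'.
  exact: (Fstable A eta FA eta_c etaP eta0 (fun t x _ Bx => eta_d _ _ (Bd _ Bx))).
have e'0 : 0 < e' by rewrite lt_min e1p divr_gt0.
have : ((c - e')%:E < sup_on J A')%E.
  apply: (@lt_le_trans _ _ c%:E); first by rewrite lte_fin ltrBlDr ltrDl.
  by rewrite -cE; apply: ereal_inf_lbound; exists A'.
move=> /ereal_sup_gt[_ [_ [[t w] [/= -> Aw] <-] <-]]; rewrite lte_fin => Jeta.
have Pw := AP _ Aw.
have Jw : J w < c + e'.
  rewrite -lte_fin; apply: le_lt_trans supA.
  by apply: ereal_sup_ubound; exists w.
have Jle := eta_le _ Pw.
have Jb : c - e' < J w by exact: lt_le_trans Jle.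
have Je1 : c - e1 <= J w <= c + e1.
  by apply/andP; split; apply: ltW;
    [apply: le_lt_trans Jb; rewrite lerB|apply: lt_le_trans Jw _; rewrite lerD2l].
by have [] := descent_arith e'2 Jb Jw e0 Jeta (eta_dec _ Pw Je1); exists w.
Qed.

(** The subfamily [G] is the whole family for the first claim and the given minimizing sequence for
    the second. It need not be homotopy stable: the deformed sets serve only to locate points of the
    original ones. *)
Lemma palais_smale_in B F G (c : R) : homotopy_stable R P B F ->
  (maxe (sup_on J B) 0 < c%:E)%E -> minimax_level J F = c%:E -> G `<=` F ->
  (forall e, 0 < e -> exists2 A, G A & (sup_on J A < (c + e)%:E)%E) ->
  exists2 w, palais_smale_on_pohozaev a1 a2 mu1 mu2 beta c%:E w &
    forall n, exists2 A, G A & A (w n).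
Proof.
move=> Fst Bc cE GF Ginf.
have [s1 s1p H] := almost_critical_point Fst Bc cE.
have /choice[w hw] (n : nat) : exists w, [/\ exists2 A, G A & A w, P w,
    `|J w - c| <= n.+1%:R^-1 & s1 * pair_norm (g w) ^+ 2 <= n.+1%:R^-1].
  have n0 : (0 : R) < n.+1%:R^-1 by rewrite invr_gt0.
  have [e' e'0 h] := H _ n0; have [A GA supA] := Ginf _ e'0.
  by have [w [Aw Pw h1 h2]] := h A (GF _ GA) supA; exists w; split => //; exists A.
have inv0 : (n.+1%:R^-1 : R) @[n --> \oo] --> (0 : R) by exact: cvg_harmonic.
exists w; last by move=> n; have [] := hw n.
split; first by move=> n; have [] := hw n.
- apply: cvg_EFin; first exact: nearW.
  apply: cvg_dist; apply: (@squeeze_cvgr _ _ _ _ (cst 0) (fun n => n.+1%:R^-1)).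
  + by apply: nearW => n; rewrite normr_ge0/=; have [] := hw n.
  + exact: cvg_cst.
  + exact: inv0.
- exists (fun n => g (w n)).
    by move=> n; have [_ [hm _] _ _] := hw n; exact: (constrained_gradP mu1 mu2 beta a1_gt0 a2_gt0 hm).
  apply: (@squeeze_cvgr _ _ _ _ (cst 0) (fun n => Num.sqrt (s1^-1 * n.+1%:R^-1))).
  + apply: nearW => n; rewrite sqrtr_ge0/=.
    rewrite -[leLHS](ger0_norm (sqrtr_ge0 _)) -sqrtr_sqr ler_wsqrtr// ler_pdivlMl//.
    by have [] := hw n.
  + exact: cvg_cst.
  + rewrite -[X in _ --> X](@sqrtr0 R) -[X in Num.sqrt X](mulr0 s1^-1).
    apply: continuous_cvg; first exact: sqrt_continuous.
    by apply: cvgM => //; exact: cvg_cst.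
Qed.

End PalaisSmale.

Theorem theorem3p2 (R : realType) (a1 a2 mu1 mu2 beta : R)
    (B : set (H1rad R * H1rad R)) (F : set (set (H1rad R * H1rad R)))
    (J := energy mu1 mu2 beta) (P := pohozaev a1 a2 mu1 mu2 beta)
    (c := minimax_level J F) :
  0 < a1 -> 0 < a2 -> 0 < mu1 -> 0 < mu2 ->
  homotopy_stable R P B F ->
  (exists2 w0, P w0 & B `<=` connected_component P w0) ->
  (maxe (sup_on J B) 0 < c)%E ->
  (c < +oo)%E ->
  (exists w, palais_smale_on_pohozaev a1 a2 mu1 mu2 beta c w) /\
  ((exists A : nat -> set (H1rad R * H1rad R),
      [/\ forall n, F (A n),
          sup_on J (A n) @[n --> \oo] --> c &
          forall n w, A n w -> ae_ge0 w.1 /\ ae_ge0 w.2]) ->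
   exists w, [/\ palais_smale_on_pohozaev a1 a2 mu1 mu2 beta c w,
                 neg_part_cvg0 (fun n => (w n).1) &
                 neg_part_cvg0 (fun n => (w n).2)]).
Proof.
move=> a1p a2p _ _ Fst _ Bc cfin.
have [r rE] : exists r, c = r%:E.
  have c0 : (0 <= c)%E by apply: ltW; apply: le_lt_trans Bc; rewrite le_max lexx orbT.
  by move: (c) c0 cfin => [r|//|//] _ _; exists r.
rewrite rE in Bc *; split.
  have [||w hw _] := @palais_smale_in R a1 a2 mu1 mu2 beta a1p a2p B F F r Fst Bc rE => //.
    move=> e e0; have : (ereal_inf [set sup_on J A | A in F] < (r + e)%:E)%E.
      by rewrite -/(minimax_level J F) -/c rE lte_fin ltrDl.
    by move=> /ereal_inf_lt[_ [A FA <-] h]; exists A.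
  by exists w.
move=> [A [FA Ac Age0]].
have Ginf e : 0 < e -> exists2 A', range A A' & (sup_on J A' < (r + e)%:E)%E.
  move=> e0; have : nbhs r%:E [set y | (y < (r + e)%:E)%E].
    by apply: open_nbhs_nbhs; split; [exact: open_ereal_lt_ereal|rewrite /= lte_fin ltrDl].
  by move=> /Ac[n _ /(_ n (leqnn n)) h]; exists (A n).
have AF : range A `<=` F by move=> _ [n _ <-].
have [w hw hA] := palais_smale_in a1p a2p Fst Bc rE AF Ginf.
(* Points of the given sets are nonnegative a.e.; off the union of countably many null sets all the
   negative parts vanish identically. *)
have neg (f : nat -> H1rad R) : (forall n, ae_ge0 (f n)) -> neg_part_cvg0 f.
  move=> /ae_foralln h; apply: filterS h => x fx.
  have -> : (fun n => (H1fun (f n))^\- x) = cst 0; last exact: cvg_cst.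
  by apply/funext => n; rewrite /funrneg max_r// oppr_le0.
exists w; split => //; apply: neg => n.
  by have [_ [k _ <-] /Age0[]] := hA n.
by have [_ [k _ <-] /Age0[]] := hA n.
Qed.
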